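(* Let $\lambda\in\Lambda^+_{m|n}$, assumed to be stable in the case $\mathfrak g=\mathfrak{gl}(m|n)$, and let $s=\mathrm{tail}(\lambda)$. (i) If $\mathfrak g=\mathfrak{osp}(2m|2n)$ or $\mathfrak{osp}(2m+1|2n)$, then $j_s\,Re^\rho\,\mathcal E_\lambda=\mathrm{KW}(\lambda+\rho,S_s)$, where $j_s=\max(1,2^{s-1}s!)$ for $t(\lambda)=0$ and $j_s=2^ss!$ for $t(\lambda)=1,2$. (ii) If $\mathfrak g=\mathfrak{gl}(m|n)$ and $\lambda$ is stable, then $j_s\,Re^\rho\,\mathcal E_\lambda=\mathrm{KW}(\lambda+\rho_L,S_s)$, where $j_s=(-1)^{[s/2]}s!$ and $\rho_L$ is the Weyl vector for the base $\varepsilon^{m-s}(\varepsilon\delta)^s\delta^{n-s}$.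
   Context: Setting. $\mathfrak g$ is $\mathfrak{gl}(m|n)$, $\mathfrak{osp}(2m|2n)$ or $\mathfrak{osp}(2m+1|2n)$; $\mathfrak h^*$ has basis $\varepsilon_1,\dots,\varepsilon_m,\delta_1,\dots,\delta_n$ with $(\varepsilon_i|\varepsilon_j)=\delta_{ij}=-(\delta_i|\delta_j)$, $(\varepsilon_i|\delta_j)=0$; roots are the standard ones. Bases are encoded by words in $m$ letters $\varepsilon$ and $n$ letters $\delta$: the word orders the $\varepsilon_i$, $\delta_j$ (each in increasing index order), and a root is positive if its first nonzero coefficient in this ordering is positive. The fixed base $\Sigma$ is: $\varepsilon^m\delta^n$ for $\mathfrak{gl}(m|n)$; for $\mathfrak{osp}(2m|2n)$, $\delta^{n-m}(\delta\varepsilon)^m$ if $n\ge m$ and $\varepsilon^{m-n}(\delta\varepsilon)^n$ if $n\le m$; for $\mathfrak{osp}(2m+1|2n)$, $\delta^{n-m}(\varepsilon\delta)^m$ if $n\ge m$ and $\varepsilon^{m-n}(\varepsilon\delta)^n$ if $n\le m$. $\Delta^\pm$ etc. refer to $\Sigma$. $\rho=\frac12\sum_{\Delta_0^+}\alpha-\frac12\sum_{\Delta_1^+}\alpha$ for $\mathfrak{osp}$; $\rho=\sum_{i=1}^m(m+1-i)\varepsilon_i-\sum_{j=1}^n j\delta_j$ for $\mathfrak{gl}(m|n)$. Weyl vectors of other bases are normalized so that an odd reflection in an isotropic simple root $\beta$ changes the Weyl vector by $+\beta$; thus $\rho_L=\rho+\sum_{1\le j<i\le s}(\varepsilon_{m-s+i}-\delta_j)$.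 $R=\prod_{\alpha\in\Delta_0^+}(1-e^{-\alpha})/\prod_{\alpha\in\Delta_1^+}(1+e^{-\alpha})$; $W$ is the Weyl group of $\mathfrak g_0$, $\mathrm{sgn}(r_\alpha)=-1$, $J_W(P)=\sum_{w\in W}\mathrm{sgn}(w)w(P)$. $\Lambda^+_{m|n}$ is the set of $\lambda$ in the lattice spanned by the $\varepsilon_i,\delta_j$ such that the simple module $L(\lambda)$ of highest weight $\lambda$ with respect to $\Sigma$ is finite-dimensional. $S_0=\emptyset$ and for $1\le s\le\min(m,n)$: $S_s=\{\varepsilon_{m+1-i}-\delta_i\}_{i=1}^s$ for $\mathfrak{gl}(m|n)$, $S_s=\{\delta_{n-i}-\varepsilon_{m-i}\}_{i=0}^{s-1}$ for $\mathfrak{osp}(2m|2n)$, $S_s=\{\varepsilon_{m-i}-\delta_{n-i}\}_{i=0}^{s-1}$ for $\mathfrak{osp}(2m+1|2n)$. For $(\nu|S)=0$, $\mathrm{KW}(\nu,S)=J_W\bigl(e^\nu/\prod_{\beta\in S}(1+e^{-\beta})\bigr)$. Stability, tail, $t(\lambda)$. Write $\lambda+\rho=\sum a_i\varepsilon_i+\sum b_j\delta_j$. $\mathfrak{gl}(m|n)$: put $>$ at each integer $a_i$, $<$ at each $-b_j$; positions with both are $\times$, positions with exactly one carry a core symbol. $\lambda$ is stable if all $\times$ lie to the left of all core symbols; then $\mathrm{tail}(\lambda)$ is the length of the maximal run of consecutive positions occupied by $\times$ starting at the leftmost $\times$ ($0$ if there is none). $\mathfrak{osp}(2m|2n)$: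 with $z_\varepsilon=\#\{i:a_i=0\}$, $z_\delta=\#\{j:b_j=0\}$, one has $z_\varepsilon-z_\delta\in\{0,1\}$; $\mathrm{tail}(\lambda)=z_\delta$; $t(\lambda)=0$ if $z_\varepsilon=z_\delta$ and $t(\lambda)=2$ if $z_\varepsilon=z_\delta+1$. $\mathfrak{osp}(2m+1|2n)$: $t(\lambda)=1$; with $z_\varepsilon=\#\{i:|a_i|=\frac12\}$, $z_\delta=\#\{j:|b_j|=\frac12\}$, $\mathrm{tail}(\lambda)=\min(z_\varepsilon,z_\delta)$, decreased by $1$ if $z_\varepsilon=z_\delta>0$ and some $a_i=\frac12$. Let $\mathfrak g_\lambda$ (the tail subalgebra) be the subalgebra isomorphic to $\mathfrak{gl}(s|s)$, resp. $\mathfrak{osp}(2s+t(\lambda)|2s)$, whose roots are the roots of $\mathfrak g$ in the span of $\varepsilon_{m-s+1},\dots,\varepsilon_m,\delta_1,\dots,\delta_s$ for $\mathfrak{gl}$, and of the last $s$ (last $s+1$ if $t(\lambda)=2$) of the $\varepsilon_i$ together with the last $s$ of the $\delta_j$ for $\mathfrak{osp}$ (equivalently, the maximal subalgebra of such equal-rank type with base contained in $\Sigma$ on which $\lambda|_{\mathfrak h\cap[\mathfrak g_\lambda,\mathfrak g_\lambda]}=0$). The Euler character is $$\mathcal E_\lambda:=R^{-1}e^{-\rho}J_W\Bigl(\frac{e^{\lambda+\rho}}{\prod_{\alpha\in\Delta(\mathfrak g_\lambda)_1^+}(1+e^{-\alpha})}\Bigr).$$ *)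

(* Defs.v *)
From HB Require Import structures.
From mathcomp Require Import all_boot all_order all_algebra all_fingroup.
From mathcomp Require Import mpoly zify.

Set Implicit Arguments.
Unset Strict Implicit.
Unset Printing Implicit Defensive.

Import Order.TTheory GRing.Theory Num.Theory.
Local Open Scope ring_scope.

(* gl(m|n), osp(2m|2n), osp(2m+1|2n) *)
Variant superType := GL | OSPeven | OSPodd.

Definition is_gl (g : superType) := if g is GL then true else false.

Variant letter := Leps | Ldel.

(* A weight of h^* with rational coordinates is a row vector: its first m    *)
(* coordinates are those on eps_1..eps_m, the last n those on del_1..del_n.  *)

Notation weight m n := 'rV[rat]_(m + n).

Section Roots.

Variables (g : superType) (m n : nat).

(* Indices are 1-based; the value is 0 out of range. *)
Definition eps (i : nat) : weight m n :=
  row_mx (\row_(k < m) (k.+1 == i)%:R) 0.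

Definition del (j : nat) : weight m n :=
  row_mx 0 (\row_(k < n) (k.+1 == j)%:R).

Definition pairs (k l : nat) : seq (nat * nat) :=
  [seq (i, j) | i <- iota 1 k, j <- iota 1 l].

Definition pm (u v : weight m n) : seq (weight m n) :=
  [:: u + v; u - v; - u + v; - u - v].

Definition even_roots : seq (weight m n) :=
  match g with
  | GL =>
         [seq eps p.1 - eps p.2 | p <- pairs m m & p.1 != p.2]
      ++ [seq del p.1 - del p.2 | p <- pairs n n & p.1 != p.2]
  | OSPeven =>
         flatten [seq pm (eps p.1) (eps p.2) | p <- pairs m m & (p.1 < p.2)%N]
      ++ flatten [seq pm (del p.1) (del p.2) | p <- pairs n n & (p.1 < p.2)%N]
      ++ flatten [seq [:: del j *+ 2; - (del j *+ 2)] | j <- iota 1 n]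
  | OSPodd =>
         flatten [seq pm (eps p.1) (eps p.2) | p <- pairs m m & (p.1 < p.2)%N]
      ++ flatten [seq [:: eps i; - eps i] | i <- iota 1 m]
      ++ flatten [seq pm (del p.1) (del p.2) | p <- pairs n n & (p.1 < p.2)%N]
      ++ flatten [seq [:: del j *+ 2; - (del j *+ 2)] | j <- iota 1 n]
  end.

Definition odd_roots : seq (weight m n) :=
  match g with
  | GL =>
      flatten [seq [:: eps p.1 - del p.2; del p.2 - eps p.1] | p <- pairs m n]
  | OSPeven =>
      flatten [seq pm (eps p.1) (del p.2) | p <- pairs m n]
  | OSPodd =>
         flatten [seq pm (eps p.1) (del p.2) | p <- pairs m n]
      ++ flatten [seq [:: del j; - del j] | j <- iota 1 n]
  end.

(* The coordinates a_1, a_2, ... and b_1, b_2, ... listed in the order in    *)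
(* which the letters of the word w prescribe them.                           *)
Fixpoint word_coords (w : seq letter) (a b : seq rat) : seq rat :=
  match w with
  | [::] => [::]
  | Leps :: w' => head 0 a :: word_coords w' (behead a) b
  | Ldel :: w' => head 0 b :: word_coords w' a (behead b)
  end.

Definition positive (w : seq letter) (alpha : weight m n) : bool :=
  0 < head 0 [seq c <- word_coords w
                         [seq lsubmx alpha 0 i | i <- enum 'I_m]
                         [seq rsubmx alpha 0 j | j <- enum 'I_n] | c != 0].

Definition wpow (k : nat) (w : seq letter) : seq letter := flatten (nseq k w).

Definition Sigma : seq letter :=
  match g with
  | GL => wpow m [:: Leps] ++ wpow n [:: Ldel]
  | OSPeven =>
      if (m <= n)%N then wpow (n - m)%N [:: Ldel] ++ wpow m [:: Ldel; Leps]
      else wpow (m - n)%N [:: Leps] ++ wpow n [:: Ldel; Leps]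
  | OSPodd =>
      if (m <= n)%N then wpow (n - m)%N [:: Ldel] ++ wpow m [:: Leps; Ldel]
      else wpow (m - n)%N [:: Leps] ++ wpow n [:: Leps; Ldel]
  end.

Definition even_pos : seq (weight m n) :=
  [seq alpha <- even_roots | positive Sigma alpha].

Definition odd_pos : seq (weight m n) :=
  [seq alpha <- odd_roots | positive Sigma alpha].

Definition rho : weight m n :=
  match g with
  | GL => \sum_(1 <= i < m.+1) ((m + 1 - i)%N%:R *: eps i)
        - \sum_(1 <= j < n.+1) (j%:R *: del j)
  | _ => 2^-1 *: (\sum_(alpha <- even_pos) alpha)
       - 2^-1 *: (\sum_(alpha <- odd_pos) alpha)
  end.

End Roots.

Definition num_eps (w : seq letter) : nat :=
  count (fun x => if x is Leps then true else false) w.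

Definition num_del (w : seq letter) : nat :=
  count (fun x => if x is Ldel then true else false) w.

(* For gl(m|n): r is the Weyl vector of the base w. The odd reflection in    *)
(* the isotropic simple root eps_i - del_j exchanges two adjacent letters    *)
(* and adds eps_i - del_j.                                                   *)
Inductive gl_weyl_vector (m n : nat) : seq letter -> weight m n -> Prop :=
| WeylBase : gl_weyl_vector (Sigma GL m n) (rho GL m n)
| WeylReflect u v r :
    gl_weyl_vector (u ++ [:: Leps; Ldel] ++ v) r ->
    gl_weyl_vector (u ++ [:: Ldel; Leps] ++ v)
      (r + (eps m n (num_eps u).+1 - del m n (num_del u).+1)).

Definition wordL (m n s : nat) : seq letter :=
  wpow (m - s)%N [:: Leps] ++ wpow s [:: Leps; Ldel] ++ wpow (n - s)%N [:: Ldel].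

(* The Weyl vector of wordL, see gl_weyl_vector_wordL. *)
Definition rhoL (m n s : nat) : weight m n :=
  rho GL m n + \sum_(1 <= i < s.+1) \sum_(1 <= j < i)
                  (eps m n (m - s + i)%N - del m n j).

Lemma wpowSr k w : wpow k.+1 w = wpow k w ++ w.
Proof.
elim: k => [|k IH]; first by rewrite /wpow /= cats0.
by rewrite /wpow /= -catA -/(wpow k w) -IH.
Qed.

Lemma num_eps_cat u v : num_eps (u ++ v) = (num_eps u + num_eps v)%N.
Proof. exact: count_cat. Qed.

Lemma num_del_cat u v : num_del (u ++ v) = (num_del u + num_del v)%N.
Proof. exact: count_cat. Qed.

Lemma num_wpow k w :
  (num_eps (wpow k w) = k * num_eps w)%N /\
  (num_del (wpow k w) = k * num_del w)%N.
Proof.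
elim: k => [|k [IHe IHd]] //.
by rewrite wpowSr num_eps_cat num_del_cat IHe IHd !mulSnr.
Qed.

Lemma rhoLS m n s : (s < m)%N ->
  rhoL m n s.+1 =
  rhoL m n s + \sum_(1 <= i < s.+1) (eps m n (m - s + i)%N - del m n i).
Proof.
move=> sm; rewrite /rhoL; move: (rho GL m n) => r; rewrite -addrA; congr (_ + _).
rewrite [LHS]big_nat_recl // (big_geq (leqnn 1)) add0r -big_split /=.
apply: eq_big_nat => i /andP[i0 _]; rewrite big_nat_recr //=.
by rewrite (_ : m - s.+1 + i.+1 = m - s + i)%N //; lia.
Qed.

Lemma gl_weyl_vector_wordL m n s : (s <= m)%N -> (s <= n)%N ->
  gl_weyl_vector (wordL m n s) (rhoL m n s).
Proof.
elim: s => [_ _|s IH sm sn].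
  have -> : rhoL m n 0 = rho GL m n by rewrite /rhoL big_geq ?addr0.
  have -> : wordL m n 0 = Sigma GL m n by rewrite /wordL /= !subn0.
  exact: WeylBase.
have {}IH := IH (ltnW sm) (ltnW sn); rewrite rhoLS //.
have shift k : [:: Leps] ++ wpow k [:: Ldel; Leps]
               = wpow k [:: Leps; Ldel] ++ [:: Leps].
  by elim: k => // k IHk; rewrite [in RHS]/wpow /= -/(wpow _ _) -IHk.
have step k : (k <= s)%N ->
    gl_weyl_vector
      (wpow (m - s)%N [:: Leps] ++ wpow k [:: Ldel; Leps]
       ++ wpow (s - k)%N [:: Leps; Ldel] ++ wpow (n - s)%N [:: Ldel])
      (rhoL m n s
       + \sum_(1 <= i < k.+1) (eps m n (m - s + i)%N - del m n i)).
  elim: k => [_|k IHk ks]; first by rewrite big_geq // addr0 subn0.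
  have {}IHk := IHk (ltnW ks).
  rewrite big_nat_recr // addrA wpowSr.
  pose u := wpow (m - s)%N [:: Leps] ++ wpow k [:: Ldel; Leps].
  pose v := wpow (s - k.+1)%N [:: Leps; Ldel] ++ wpow (n - s)%N [:: Ldel].
  have Ee : num_eps u = (m - s + k)%N.
    by rewrite /u num_eps_cat !(num_wpow _ _).1 !muln1.
  have Ed : num_del u = k.
    by rewrite /u num_del_cat !(num_wpow _ _).2 muln0 muln1.
  have := @WeylReflect m n u v
    (rhoL m n s + \sum_(1 <= i < k.+1) (eps m n (m - s + i)%N - del m n i)).
  rewrite Ee Ed -addnS /u /v -!catA; apply.
  by move: IHk; rewrite -(subnSK ks).
have := step s (leqnn s); rewrite subnn /wordL.
rewrite -(subnSK sm) -(subnSK sn) [wpow (m - s.+1).+1 _]wpowSr.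
rewrite [wpow s.+1 _]wpowSr -!catA.
by rewrite (catA [:: Leps] (wpow s _)) shift -!catA.
Qed.

Definition evdim (g : superType) (m : nat) : nat :=
  match g with GL => m | OSPeven => (m + m)%N | OSPodd => (m + m + 1)%N end.

Definition odddim (g : superType) (n : nat) : nat :=
  match g with GL => n | _ => (n + n)%N end.

Section Superalgebra.

Variables (C : numClosedFieldType) (g : superType) (m n : nat).

Notation p := (evdim g m).
Notation q := (odddim g n).
Notation smx := 'M[C]_(p + q).

(* Gram matrix of the even supersymmetric form on the natural module. Its    *)
(* even basis is v_1..v_m, v_-1..v_-m (then v_0), its odd basis u_1..u_n,    *)
(* u_-1..u_-n, of weights +-eps_i (0) and +-del_j.                           *)
Definition gram_even : 'M[C]_p :=
  match g return 'M[C]_(evdim g m) with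
  | GL => 0
  | OSPeven => block_mx 0 1%:M 1%:M 0
  | OSPodd => block_mx (block_mx 0 1%:M 1%:M 0) 0 0 1%:M
  end.

Definition gram_odd : 'M[C]_q :=
  match g return 'M[C]_(odddim g n) with
  | GL => 0
  | OSPeven | OSPodd => block_mx 0 1%:M (- 1%:M) 0
  end.

Definition gram : smx := block_mx gram_even 0 0 gram_odd.

Definition homogeneous (b : bool) (X : smx) : Prop :=
  if b then ulsubmx X = 0 /\ drsubmx X = 0
  else ursubmx X = 0 /\ dlsubmx X = 0.

(* B(X e_i, e_j) + (-1)^(|X| |e_i|) B(e_i, X e_j) = 0 *)
Definition preserves_form (b : bool) (X : smx) : Prop :=
  forall i j : 'I_(p + q),
    (X^T *m gram) i j + (-1) ^+ (b && (p <= i)%N) * (gram *m X) i j = 0.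

(* The homogeneous component of parity b of the Lie superalgebra. *)
Definition in_g (b : bool) (X : smx) : Prop :=
  homogeneous b X /\ (if is_gl g then True else preserves_form b X).

Definition sbracket (b c : bool) (X Y : smx) : smx :=
  X *m Y - (-1) ^+ (b && c) *: (Y *m X).

(* The element of the Cartan subalgebra on which the i-th coordinate         *)
(* function (eps_1..eps_m, del_1..del_n) has value x 0 i.                    *)
Definition cartan (x : 'rV[C]_(m + n)) : smx :=
  match g return 'M[C]_(evdim g m + odddim g n) with
  | GL => diag_mx x
  | OSPeven =>
      diag_mx (row_mx (row_mx (lsubmx x) (- lsubmx x))
                      (row_mx (rsubmx x) (- rsubmx x)))
  | OSPodd =>
      diag_mx (row_mx (row_mx (row_mx (lsubmx x) (- lsubmx x)) 0)
                      (row_mx (rsubmx x) (- rsubmx x)))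
  end.

Definition weight_eval (mu : weight m n) (x : 'rV[C]_(m + n)) : C :=
  \sum_k ratr (mu 0 k) * x 0 k.

Definition root_vector (alpha : weight m n) (X : smx) : Prop :=
  forall x, cartan x *m X - X *m cartan x = weight_eval alpha x *: X.

(* V = V_0 + V_1 (V_ false and V_ true) is a module through r; only the      *)
(* values of r on homogeneous elements of the superalgebra matter.           *)
Record is_module (V : vectType C) (V_ : bool -> {vspace V})
    (r : smx -> 'End(V)) : Prop := {
  mod_sum : (V_ false + V_ true)%VS = fullv;
  mod_direct : (V_ false :&: V_ true)%VS = 0%VS;
  mod_linear : forall b a X Y, in_g b X -> in_g b Y ->
    r (a *: X + Y) = a *: r X + r Y;
  mod_parity : forall b c X, in_g b X -> (r X @: V_ c <= V_ (b (+) c))%VS;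
  mod_bracket : forall b c X Y, in_g b X -> in_g c Y ->
    r (sbracket b c X Y)
      = (r X \o r Y)%VF - (-1) ^+ (b && c) *: (r Y \o r X)%VF
}.

Definition is_submodule (V : vectType C) (V_ : bool -> {vspace V})
    (r : smx -> 'End(V)) (U : {vspace V}) : Prop :=
  (U :&: V_ false + U :&: V_ true)%VS = U
  /\ forall b X, in_g b X -> (r X @: U <= U)%VS.

Definition is_simple (V : vectType C) (V_ : bool -> {vspace V})
    (r : smx -> 'End(V)) : Prop :=
  (fullv : {vspace V}) <> 0%VS
  /\ forall U : {vspace V}, is_submodule V_ r U -> U = 0%VS \/ U = fullv.

(* Highest weight with respect to the base Sigma. *)
Definition highest_weight_vector (V : vectType C) (r : smx -> 'End(V))
    (mu : weight m n) (v : V) : Prop :=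
  [/\ v != 0,
      forall x, r (cartan x) v = weight_eval mu x *: v
    & forall b X alpha,
        alpha \in even_pos g m n ++ odd_pos g m n ->
        in_g b X -> root_vector alpha X -> r X v = 0].

Definition int_weight (lam : 'rV[int]_(m + n)) : weight m n :=
  map_mx intr lam.

(* L(lam) is finite-dimensional: vectType consists of finite-dimensional     *)
(* spaces, and L(lam) is the simple module with a highest weight vector of   *)
(* weight lam.                                                               *)
Definition Lambda_plus (lam : 'rV[int]_(m + n)) : Prop :=
  exists (V : vectType C) (V_ : bool -> {vspace V}) (r : smx -> 'End(V)),
    [/\ is_module V_ r, is_simple V_ r
      & exists v, highest_weight_vector r (int_weight lam) v].

End Superalgebra.

(* The identities live in the field of fractions of the group algebra of the *)
(* lattice spanned by the eps_i / 2 and del_j / 2, i.e. in the rational      *)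
(* functions in the variables e^(eps_i / 2), e^(del_j / 2).                  *)

Notation charField m n := {fraction {mpoly rat[m + n]}}.

Section Characters.

Variables (g : superType) (m n : nat).

Local Notation K := (charField m n).

(* e^mu, for mu with coordinates in (1/2)Z: then 2 mu_k is its numerator.    *)
Definition Exp (mu : weight m n) : K :=
  \prod_(k < m + n) ((@FracField.tofrac _ 'X_k : K) ^ numq (2 * mu 0 k)).

(* (s, t, A, B) maps eps_i to eps_(s i), or -eps_(s i) if i \in A, and       *)
(* del_j to del_(t j), or -del_(t j) if j \in B.                             *)
Definition signed_perm : finType :=
  ('S_m * 'S_n * {set 'I_m} * {set 'I_n})%type.

Definition wact (w : signed_perm) (mu : weight m n) : weight m n :=
  let: (s, t, A, B) := w in
  row_mx
    (\row_i ((-1) ^+ ((s^-1)%g i \in A) * lsubmx mu 0 ((s^-1)%g i)))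
    (\row_j ((-1) ^+ ((t^-1)%g j \in B) * rsubmx mu 0 ((t^-1)%g j))).

(* Type A x A, D x C, B x C respectively. *)
Definition Weyl : {set signed_perm} :=
  [set w : signed_perm |
    let: (s, t, A, B) := w in
    match g with
    | GL => (A == set0) && (B == set0)
    | OSPeven => ~~ odd #|A|
    | OSPodd => true
    end].

(* The determinant of wact w, so that every reflection has sign -1. *)
Definition wsgn (w : signed_perm) : K :=
  let: (s, t, A, B) := w in
  (-1) ^+ (odd_perm s + odd_perm t + #|A| + #|B|)%N.

(* The field automorphism with e^mu |-> e^(w mu): substitute the images of   *)
(* the variables in a numerator and a denominator.                           *)
Definition wsubst (w : signed_perm) (P : {mpoly rat[m + n]}) : K :=
  mmap (fun c => @FracField.tofrac _ c%:MP)
       (fun k => Exp (wact w (2^-1 *: delta_mx 0 k))) P.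

Definition wfrac (w : signed_perm) (f : K) : K :=
  wsubst w \n_(generic_quotient.repr f) / wsubst w \d_(generic_quotient.repr f).

Definition JW (f : K) : K := \sum_(w in Weyl) wsgn w * wfrac w f.

Definition R : K :=
  (\prod_(alpha <- even_pos g m n) (1 - Exp (- alpha)))
  / \prod_(alpha <- odd_pos g m n) (1 + Exp (- alpha)).

(* Total in nu and S; meaningful for S orthogonal to nu. *)
Definition KW (nu : weight m n) (S : seq (weight m n)) : K :=
  JW (Exp nu / \prod_(beta <- S) (1 + Exp (- beta))).

Definition isoset (s : nat) : seq (weight m n) :=
  match g with
  | GL => [seq eps m n (m + 1 - i)%N - del m n i | i <- iota 1 s]
  | OSPeven => [seq del m n (n - i)%N - eps m n (m - i)%N | i <- iota 0 s]
  | OSPodd => [seq eps m n (m - i)%N - del m n (n - i)%N | i <- iota 0 s]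
  end.

Variable lam : 'rV[int]_(m + n).

Definition lam_rho : weight m n := int_weight lam + rho g m n.

Definition acoord : 'rV[rat]_m := lsubmx lam_rho.
Definition bcoord : 'rV[rat]_n := rsubmx lam_rho.

Definition has_gt (x : rat) : bool := [exists i, acoord 0 i == x].
Definition has_lt (x : rat) : bool := [exists j, - bcoord 0 j == x].
Definition has_cross (x : rat) : bool := has_gt x && has_lt x.
Definition has_core (x : rat) : bool := has_gt x (+) has_lt x.

Definition gl_stable : Prop :=
  forall x y, has_cross x -> has_core y -> x < y.

Definition gl_leftmost (i : 'I_m) : bool :=
  has_cross (acoord 0 i)
  && [forall l, has_cross (acoord 0 l) ==> (acoord 0 i <= acoord 0 l)].

(* The largest k such that the k positions from the leftmost cross on are    *)
(* crosses (0 if there is no cross); there are at most m crosses.            *)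
Definition gl_tail : nat :=
  \max_(k < m.+1 | [exists i, gl_leftmost i
                      && [forall l : 'I_k, has_cross (acoord 0 i + l%:R)]]) k.

Definition num_a (x : rat) : nat := #|[pred i | `|acoord 0 i| == x]|.
Definition num_b (x : rat) : nat := #|[pred j | `|bcoord 0 j| == x]|.

Definition tail : nat :=
  match g with
  | GL => gl_tail
  | OSPeven => num_b 0
  | OSPodd =>
      let za := num_a 2^-1 in
      let zb := num_b 2^-1 in
      let has_half := [exists i, acoord 0 i == 2^-1] in
      (minn za zb - [&& za == zb, 0 < za & has_half])%N
  end.

(* The value for gl(m|n) is a convention: the tail subalgebra is gl(s|s). *)
Definition tpar : nat :=
  match g with
  | GL => 0
  | OSPeven => if num_a 0 == num_b 0 then 0 else 2
  | OSPodd => 1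
  end.

(* The index of a coordinate spanned by the tail subalgebra. *)
Definition tail_coord (k : 'I_(m + n)) : bool :=
  match split k with
  | inl i => (m - (tail + (tpar == 2)) <= i)%N
  | inr j => if is_gl g then (j < tail)%N else (n - tail <= j)%N
  end.

Definition tail_odd_pos : seq (weight m n) :=
  [seq alpha : weight m n <- odd_pos g m n |
     [forall k, (alpha 0 k != 0) ==> tail_coord k]].

Definition euler_char : K :=
  R^-1 * Exp (- rho g m n)
  * JW (Exp lam_rho / \prod_(alpha <- tail_odd_pos) (1 + Exp (- alpha))).

(* For s = 0 the truncated exponent gives maxn 1 1, as max(1, 1/2) = 1. *)
Definition j_osp : nat :=
  let s := tail in
  if tpar == 0 then maxn 1 (2 ^ (s - 1) * s`!)%N else (2 ^ s * s`!)%N.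

Definition j_gl : int := (-1) ^+ (tail %/ 2) * (tail`!)%:Z.

End Characters.

(* Main.v *)
(* Write x_i = e^(eps_i/2), y_j = e^(del_j/2) and u(z) = z^2 + z^-2, with i,  *)
(* j ranging over the tail.                                                   *)
(*                                                                            *)
(* For osp, the coordinates of lambda + rho on the tail are 0 (up to the      *)
(* shift by 1/2 in the odd case), so that the summand of the Euler character  *)
(* is a factor E free of the tail variables, times a staircase monomial in    *)
(* the x_i and y_j, divided by the product D of all u(x_i) + u(y_j) (and, in  *)
(* the odd case, of all y_j + y_j^-1).                                        *)
(* Symmetrising the monomial over the sign changes and permutations of the    *)
(* tail, which fix E and D, produces Vandermonde determinants V in the u(x_i) *)
(* and in the u(y_j); V(u(x)) V(u(y)) / D is the Cauchy determinant of the    *)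
(* matrix with entries 1 / (u(x_i) + u(y_j)), bordered by a row of ones when  *)
(* there is one more eps than del. On the side of KW, symmetrising the        *)
(* factors 1 / (1 + e^-beta) over the sign changes of the del_j gives the     *)
(* product of the diagonal entries of that matrix, and symmetrising over the  *)
(* permutations of the eps_i gives its determinant. The constants count the   *)
(* group elements used on the two sides. For gl only permutations occur, with *)
(* u(z) replaced by z^2, and the sign (-1)^[s/2] appears when the Vandermonde *)
(* determinant of the y_j^-2 is rewritten in terms of the y_j^2.              *)
(*                                                                            *)
(* The tail coordinates are found from dominance, which follows from          *)
(* sl_2-theory in L(lambda). For osp(2m+1|2n) one must also exclude that two  *)
(* coordinates of lambda on the eps_i equal 1 while a later one on the del_j  *)
(* vanishes: a product of three odd root vectors would then map the highest   *)
(* weight vector to a primitive vector of negative weight.                    *)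

Require Import Defs.
From HB Require Import structures.
From mathcomp Require Import all_boot all_order all_algebra all_fingroup.
From mathcomp Require Import mpoly.
From mathcomp Require Import zify ring.

Set Implicit Arguments.
Unset Strict Implicit.
Unset Printing Implicit Defensive.

Import Order.TTheory GRing.Theory Num.Theory.
Local Open Scope ring_scope.

(** * Determinants *)

(** The operator [JW] is antisymmetric under the Weyl group ([JW_wfrac]). Hence an expression inside
    it may be replaced by the signed sum of its images under a finite set of group elements, at the
    cost of the size of that set. The identity is proved by doing this on both sides with elements
    that move only tail coordinates, until both sides reach the same determinant.

    On the Euler side the positive odd roots of the tail subalgebra are grouped in pairs. By
    [even_pair] each pair contributes a Cauchy factor [uu x + uu y], up to a monomial that depends
    on which letter comes first in [Sigma]; these monomials multiply to a staircase. Symmetrising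
    the staircase is the Weyl denominator formula of types B, C, D ([det_cheb]) and gives
    Vandermonde products over the Cauchy denominator. On the other side [flip_even] and [flip_odd]
    turn the product over [isoset] into the diagonal of a Cauchy matrix, which [JW_det] completes to
    its determinant. The two expressions agree by [det_cauchy], or by [det_cauchy_ones] when the
    tail has one more eps than del. The quotient of the group orders is j_s ([core_even],
    [core_even_ones], [core_odd]). For gl the matrices have entries 1 / (x^2 + y^2) and only
    permutations act ([core_gl]).

    This uses the values of the weight on the tail. For osp, lambda + rho is 0 there (even case), or
    -1/2 on the eps and 1/2 on the del (odd case). For gl it runs through consecutive integers, and
    lambda + rho_L is constant up to sign. The proof of these values ([even_tail_eps],
    [odd_first_zero], [gl_tail_coords]) rests on inequalities for highest weights obtained from
    sl_2-triples, and on anticommutators of opposite odd root vectors ([long_trivial],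
    [no_repeated_half]). *)

Section Determinants.

Variable F : fieldType.

Definition vdm (r : nat) (u : 'I_r -> F) : F :=
  \prod_(i < r) \prod_(j < r | (i < j)%N) (u j - u i).

(** The matrix factors as the lower triangular matrix of coefficients of the [p i], a Vandermonde
    matrix, and the diagonal matrix of the [A j]. *)
Lemma det_poly_rows (r : nat) (p : 'I_r -> {poly F}) (u A : 'I_r -> F) :
  (forall i, (size (p i) <= i.+1)%N) ->
  \det (\matrix_(i, j) ((p i).[u j] * A j))
    = (\prod_i (p i)`_i) * (\prod_j A j) * vdm u.
Proof.
move=> sp; pose L : 'M[F]_r := \matrix_(i, k) (p i)`_k.
have -> : \matrix_(i, j) ((p i).[u j] * A j)
    = L *m Vandermonde r (\row_j u j) *m diag_mx (\row_j A j).
  apply/matrixP => i j; rewrite mul_mx_diag !mxE; congr (_ * _).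
  rewrite (horner_coef_wide _ (leq_trans (sp i) (ltn_ord i))).
  by apply: eq_bigr => k _; rewrite !mxE.
rewrite !det_mulmx det_diag det_Vandermonde det_trig; last first.
  apply/is_trig_mxP => i k ik; rewrite mxE nth_default //.
  exact: leq_trans (sp i) ik.
rewrite mulrAC; congr (_ * _ * _).
- by apply: eq_bigr => i _; rewrite mxE.
- by apply: eq_bigr => i _; rewrite mxE.
by apply: eq_bigr => i _; apply: eq_bigr => j _; rewrite !mxE.
Qed.

(* The recurrence satisfied by [z^k + z^-k] and [z^k - z^-k], as polynomials *)
(* in [z + z^-1].                                                            *)
Fixpoint cheb (p0 p1 : {poly F}) (k : nat) : {poly F} :=
  match k with
  | 0 => p0
  | k'.+1 => cheb p1 ('X * p1 - p0) k'
  end.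

Lemma chebP (a : nat -> F) u A (p0 p1 : {poly F}) k :
  (forall k, a k.+2 = u * a k.+1 - a k) -> a 0 = p0.[u] * A -> a 1 = p1.[u] * A ->
  a k = (cheb p0 p1 k).[u] * A.
Proof.
elim: k a p0 p1 => [|k IH] a p0 p1 aS a0 a1 //=.
apply: (IH (fun k => a k.+1)) => //.
rewrite aS a0 a1 hornerD hornerN [(_ * p1).[u]]hornerM hornerX.
by ring.
Qed.

Lemma cheb_size (p0 p1 : {poly F}) k : (size p0 <= 1)%N -> (size p1 <= 2)%N -> p1`_1 = 1 ->
  (size (cheb p0 p1 k) <= k.+1)%N /\ ((0 < k)%N -> (cheb p0 p1 k)`_k = 1).
Proof.
move=> s0 s1 l1.
(* The recurrence moves the starting pair, so the induction must let the starting degree [d]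
   vary. *)
have H d (q0 q1 : {poly F}) : (size q0 <= d.+1)%N -> (size q1 <= d.+2)%N -> q1`_d.+1 = 1 ->
    (size (cheb q0 q1 k) <= (k + d).+1)%N
    /\ ((0 < k)%N -> (cheb q0 q1 k)`_(k + d) = 1).
  elim: k d q0 q1 => [|k IH] d q0 q1 sq0 sq1 lq1 /=; first by [].
  have sq2 : (size ('X * q1 - q0)%R <= d.+3)%N.
    rewrite (leq_trans (size_polyD _ _)) // geq_max size_polyN; apply/andP; split.
      rewrite mulrC; have [->|q0'] := eqVneq q1 0; first by rewrite mul0r size_poly0.
      by rewrite size_mulX.
    by rewrite (leq_trans sq0) // ltnW.
  have lq2 : ('X * q1 - q0)`_d.+2 = 1.
    by rewrite coefB coefXM /= lq1 nth_default ?subr0 // (leq_trans sq0) // ltnW.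
  have [IHs IHc] := IH d.+1 q1 ('X * q1 - q0) sq1 sq2 lq2.
  split; first by rewrite addSnnS.
  move=> _; case: (posnP k) => [k0|/IHc]; last by rewrite addSnnS.
  by rewrite k0 add1n.
by have := H 0 p0 p1; rewrite addn0; apply.
Qed.

(** The Weyl denominator formulas of types B, C and D in one statement: all rows are polynomials in
    [u] times the common factor [A]. The constant [c] is 1 in types B and C; in type D it is 2,
    because row 0 is z^0 + z^-0. *)
Lemma det_cheb (r : nat) (a : nat -> 'I_r -> F) (u A : 'I_r -> F) (c : F) (p1 : {poly F}) :
  (size p1 <= 2)%N -> p1`_1 = 1 -> (0 < r)%N ->
  (forall j k, a k.+2 j = u j * a k.+1 j - a k j) ->
  (forall j, a 0 j = c * A j) -> (forall j, a 1 j = p1.[u j] * A j) ->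
  \det (\matrix_(i, j) a i j) = c * (\prod_j A j) * vdm u.
Proof.
move=> s1 l1 r0 aS a0 a1.
have sp (i : 'I_r) := cheb_size i (size_polyC_leq1 c) s1 l1.
rewrite -[c](_ : \prod_(i < r) (cheb c%:P p1 i)`_i = c); last first.
  case: r r0 {a u A aS a0 a1} sp => // r _ sp.
  rewrite big_ord_recl /= coefC eqxx big1 ?mulr1 // => i _.
  exact: (sp (lift ord0 i)).2.
rewrite -det_poly_rows; last by move=> i; case: (sp i).
congr (\det _); apply/matrixP => i j; rewrite !mxE.
by apply: (chebP (a := fun k => a k j)) => //; rewrite hornerC a0.
Qed.

(** The differences are reversed with respect to [vdm], because the Cauchy recursion removes index 0
    and produces u_0 - u_j. *)
Definition rvdm (r : nat) (u : 'I_r -> F) : F :=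
  \prod_(i < r) \prod_(j < r | (i < j)%N) (u i - u j).

Lemma rvdm_recl (r : nat) (u : 'I_r.+1 -> F) :
  rvdm u = (\prod_(j < r) (u ord0 - u (lift ord0 j))) * rvdm (fun j => u (lift ord0 j)).
Proof.
rewrite /rvdm big_ord_recl; congr (_ * _).
  by rewrite big_mkcond big_ord_recl /= mul1r.
apply: eq_bigr => i _.
by rewrite big_mkcond [RHS]big_mkcond big_ord_recl /= mul1r.
Qed.

Definition cauchy (r : nat) (u v : 'I_r -> F) : 'M[F]_r :=
  \matrix_(i, j) (u j + v i)^-1.

Definition cauchy1 (r : nat) (u : 'I_r.+1 -> F) (v : 'I_r -> F) : 'M[F]_r.+1 :=
  \matrix_(i, j) oapp (fun k => (u j + v k)^-1) 1 (unlift ord0 i).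

Definition cauchy_den (r s : nat) (u : 'I_r -> F) (v : 'I_s -> F) : F :=
  \prod_(i < s) \prod_(j < r) (u j + v i).

(** Column 0 is subtracted from the others: 1/(u_j + v_i) - 1/(u_0 + v_i) = (u_0 - u_j) / ((u_0 +
    v_i)(u_j + v_i)), which is a Cauchy entry up to a row factor and a column factor. *)
Lemma cauchy1_of_cauchy (r : nat) (u : 'I_r.+1 -> F) (v : 'I_r -> F) :
  (forall i j, u j + v i != 0) ->
  \det (cauchy1 u v)
    = (\prod_j (u ord0 - u (lift ord0 j))) * (\prod_i (u ord0 + v i)^-1)
      * \det (cauchy (fun j => u (lift ord0 j)) v).
Proof.
move=> uv0.
pose c i := (u ord0 + v i)^-1; pose d j := u ord0 - u (lift ord0 j).
have [B BE detB] : exists2 B : 'M[F]_r,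
    forall i j, B i j = c i * (u (lift ord0 j) + v i)^-1 * d j
    & \det B = \prod_i c i * \det (cauchy (fun j => u (lift ord0 j)) v) * \prod_j d j.
  exists (diag_mx (\row_i c i) *m cauchy (fun j => u (lift ord0 j)) v
          *m diag_mx (\row_j d j)) => [i j|].
    by rewrite mul_mx_diag mul_diag_mx !mxE.
  rewrite !det_mulmx !det_diag.
  by congr (_ * _ * _); apply: eq_bigr => i _; rewrite mxE.
have -> : cauchy1 u v
    = block_mx 1%:M 0 (\col_i c i) B *m block_mx 1%:M (const_mx 1) 0 1%:M :> 'M_(1 + r).
  rewrite mulmx_block !mulmx0 !mul0mx !mulmx1 !mul1mx !addr0.
  apply/matrixP => i j; rewrite !mxE.
  case: splitP => [i0|i'] Ei; rewrite mxE.
    rewrite (_ : i = ord0) ?unlift_none /=; last first.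
      by apply/val_inj; rewrite /= Ei (ord1 i0).
    by case: splitP => [j0|j'] Ej; rewrite !mxE // (ord1 i0) (ord1 j0).
  rewrite (_ : i = lift ord0 i') ?liftK /=; last by apply/val_inj.
  case: splitP => [j0|j'] Ej; rewrite !mxE.
    by rewrite (_ : j = ord0) //; apply/val_inj; rewrite /= Ej (ord1 j0).
  rewrite (_ : j = lift ord0 j'); last by apply/val_inj.
  rewrite big_ord1 !mxE BE mulr1 /c /d.
  have := uv0 i' (lift ord0 j'); have := uv0 i' ord0.
  by move: (u _) (u _) (v _) => a b w *; field; apply/andP.
rewrite [LHS](@det_mulmx _ (1 + r)) det_ublock det_lblock !det1 !mul1r mulr1 detB.
by rewrite mulrC mulrA.
Qed.

(** Once 1/(u_j + v_0) is taken out of column j, row 0 consists of ones, and every other entry is 1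
    + (v_0 - v_i)/(u_j + v_i). *)
Lemma cauchy_of_cauchy1 (r : nat) (u v : 'I_r.+1 -> F) :
  (forall i j, u j + v i != 0) ->
  \det (cauchy u v)
    = (\prod_i (v ord0 - v (lift ord0 i))) * (\prod_j (u j + v ord0)^-1)
      * \det (cauchy1 u (fun i => v (lift ord0 i))).
Proof.
move=> uv0; pose d : 'rV[F]_r.+1 := \row_j (u j + v ord0)^-1.
pose c i := v ord0 - v (lift ord0 i).
have [N [N0 N0l Nl0 Nl] detN] : exists2 N : 'M[F]_r.+1,
    [/\ N ord0 ord0 = 1, forall k, N ord0 (lift ord0 k) = 0,
        forall i, N (lift ord0 i) ord0 = 1
      & forall i k, N (lift ord0 i) (lift ord0 k) = c i *+ (i == k)]
    & \det N = \prod_i c i.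
  have LE : @ord0 r = lshift r (@ord0 0) :> 'I_(1 + r) by apply: val_inj.
  have RE (k : 'I_r) : lift (@ord0 r) k = rshift 1 k :> 'I_(1 + r) by apply: val_inj.
  exists (block_mx 1%:M 0 (const_mx 1) (diag_mx (\row_i c i)) : 'M_(1 + r)).
    split=> [|k|i|i k]; rewrite ?RE ?LE.
    - by rewrite (@block_mxEul _ 1 r 1 r) mxE eqxx.
    - by rewrite (@block_mxEur _ 1 r 1 r) mxE.
    - by rewrite (@block_mxEdl _ 1 r 1 r) mxE.
    - by rewrite (@block_mxEdr _ 1 r 1 r) !mxE.
  rewrite (@det_lblock _ 1 r) det1 mul1r det_diag.
  by apply: eq_bigr => i _; rewrite mxE.
have -> : cauchy u v = N *m cauchy1 u (fun i => v (lift ord0 i)) *m diag_mx d.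
  apply/matrixP => i j; rewrite mul_mx_diag !mxE big_ord_recl !mxE unlift_none /=.
  rewrite (eq_bigr (fun k : 'I_r => N i (lift ord0 k) * (u j + v (lift ord0 k))^-1)); last first.
    by move=> k _; rewrite !mxE liftK.
  have [i'|] := unliftP ord0 i => ->; last first.
    rewrite N0 big1 => [|k _]; last by rewrite N0l mul0r.
    by rewrite addr0 !mul1r.
  rewrite Nl0 mul1r (bigD1 i') //= big1 => [|k ki]; last first.
    by rewrite Nl eq_sym (negbTE ki) mul0r.
  rewrite Nl eqxx mulr1n addr0 /c.
  have := uv0 (lift ord0 i') j; have := uv0 ord0 j.
  by move: (u _) (v _) (v _) => a b w *; field; apply/andP.
rewrite !det_mulmx detN det_diag mulrAC; congr (_ * _ * _).
by apply: eq_bigr => i _; rewrite mxE.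
Qed.

(** One inductive step is the composite of the two reductions above, through the bordered matrix. *)
Lemma det_cauchy_rvdm (r : nat) (u v : 'I_r -> F) :
  (forall i j, u j + v i != 0) ->
  \det (cauchy u v) = rvdm u * rvdm v / cauchy_den u v.
Proof.
elim: r u v => [|r IH] u v uv0.
  by rewrite det_mx00 /rvdm /cauchy_den !big_ord0 invr1 !mulr1.
rewrite cauchy_of_cauchy1 // cauchy1_of_cauchy // IH // !rvdm_recl.
have -> : cauchy_den u v = (\prod_j (u j + v ord0))
    * ((\prod_i (u ord0 + v (lift ord0 i)))
       * cauchy_den (fun j => u (lift ord0 j)) (fun i => v (lift ord0 i))).
  rewrite /cauchy_den big_ord_recl -big_split /=; congr (_ * _).
  by apply: eq_bigr => i _; rewrite big_ord_recl.
rewrite !prodfV !invfM; move: (rvdm _) (rvdm _) (cauchy_den _ _)^-1 => a b c.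
by move: (\prod_i _) (\prod_j _)^-1 (\prod_j _) (\prod_i _)^-1 => *; ring.
Qed.

(** Rows and columns undergo the same permutation, whose sign therefore appears squared. *)
Lemma det_rev (r : nat) (M : 'M[F]_r) :
  \det (\matrix_(i, j) M (rev_ord i) (rev_ord j)) = \det M.
Proof.
pose s := perm (@rev_ord_inj r).
have -> : \matrix_(i, j) M (rev_ord i) (rev_ord j) = row_perm s (col_perm s M).
  by apply/matrixP => i j; rewrite !mxE !permE.
rewrite row_permE col_permE !det_mulmx !det_perm mulrA mulrAC.
by rewrite odd_permV -expr2 sqrr_sign mul1r.
Qed.

Lemma rvdm_rev (r : nat) (u : 'I_r -> F) : rvdm (fun i => u (rev_ord i)) = vdm u.
Proof.
rewrite /rvdm /vdm pair_big_dep [RHS]pair_big_dep /=.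
rewrite (reindex (fun p : 'I_r * 'I_r => (rev_ord p.2, rev_ord p.1))) /=.
  apply: eq_big => [[i j]|[i j] _] /=; last by rewrite !rev_ordK.
  by have := ltn_ord i; have := ltn_ord j; lia.
by exists (fun p : 'I_r * 'I_r => (rev_ord p.2, rev_ord p.1)) => [[i j] _|[i j] _] /=;
  rewrite !rev_ordK.
Qed.

Lemma cauchy_den_rev (r s : nat) (u : 'I_r -> F) (v : 'I_s -> F) :
  cauchy_den (fun i => u (rev_ord i)) (fun j => v (rev_ord j)) = cauchy_den u v.
Proof.
rewrite /cauchy_den [RHS](reindex_inj rev_ord_inj); apply: eq_bigr => i _.
by rewrite [RHS](reindex_inj rev_ord_inj).
Qed.

Lemma det_cauchy (r : nat) (u v : 'I_r -> F) :
  (forall i j, u j + v i != 0) ->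
  \det (\matrix_(i, j) (u j + v i)^-1) = vdm u * vdm v / cauchy_den u v.
Proof.
move=> uv0; rewrite -det_rev -!rvdm_rev -cauchy_den_rev -det_cauchy_rvdm //.
by congr (\det _); apply/matrixP => i j; rewrite !mxE.
Qed.

(** The row of ones comes last because the tail is numbered from the end of the list of the eps, so
    that the unpaired eps has the largest number. *)
Lemma det_cauchy_ones (r : nat) (u : 'I_r.+1 -> F) (v : 'I_r -> F) :
  (forall i j, u j + v i != 0) ->
  \det (\matrix_(i, j) oapp (fun k => (u j + v k)^-1) 1 (unlift ord_max i))
    = vdm u * vdm v / cauchy_den u v.
Proof.
have unlift_rev (i : 'I_r.+1) :
    unlift ord_max (rev_ord i) = omap (@rev_ord r) (unlift ord0 i).
  have [i'|] := unliftP ord0 i => ->.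
    have -> : rev_ord (lift ord0 i') = lift ord_max (rev_ord i').
      by apply: val_inj; have := ltn_ord i'; rewrite /= /bump; lia.
    by rewrite liftK.
  have -> : rev_ord ord0 = ord_max :> 'I_r.+1.
    by apply: val_inj; rewrite /= subn1.
  by rewrite unlift_none.
move=> uv0; rewrite -det_rev -!rvdm_rev -cauchy_den_rev.
rewrite (rvdm_recl (fun i => u (rev_ord i))).
have E : \matrix_(i < r.+1, j < r.+1) (\matrix_(i < r.+1, j < r.+1)
       oapp (fun k => (u j + v k)^-1) 1 (unlift ord_max i)) (rev_ord i) (rev_ord j)
    = cauchy1 (fun j => u (rev_ord j)) (fun i => v (rev_ord i)).
  by apply/matrixP => i j; rewrite !mxE unlift_rev; case: (unlift ord0 i).
rewrite E cauchy1_of_cauchy // det_cauchy_rvdm //.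
set U := fun j => u (rev_ord j); set V := fun i => v (rev_ord i).
have -> : cauchy_den U V
    = (\prod_i (U ord0 + V i)) * cauchy_den (fun j => U (lift ord0 j)) V.
  by rewrite /cauchy_den -big_split; apply: eq_bigr => i _; rewrite big_ord_recl.
rewrite prodfV !invfM; move: (rvdm _) (rvdm _) (cauchy_den _ _)^-1 => a b c.
by move: (\prod_j _) (\prod_i _)^-1 => *; ring.
Qed.

Lemma vdm_recl (r : nat) (u : 'I_r.+1 -> F) :
  vdm u = (\prod_(j < r) (u (lift ord0 j) - u ord0)) * vdm (fun j => u (lift ord0 j)).
Proof.
rewrite /vdm big_ord_recl; congr (_ * _).
  by rewrite big_mkcond big_ord_recl /= mul1r.
apply: eq_bigr => i _.
by rewrite big_mkcond [RHS]big_mkcond big_ord_recl /= mul1r.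
Qed.

(** Since 1/b - 1/a = -(b - a)/(a b), there is one sign for each pair of indices, and r(r-1)/2 has
    the parity of [r/2]. *)
Lemma vdm_inv (r : nat) (u : 'I_r -> F) : (forall i, u i != 0) ->
  vdm (fun i => (u i)^-1) = (-1) ^+ (r %/ 2) * vdm u * \prod_i (u i) ^- r.-1.
Proof.
elim: r u => [|r IH] u u0; first by rewrite /vdm !big_ord0 !mulr1.
rewrite !vdm_recl IH // big_ord_recl /=.
have -> : \prod_(j < r) ((u (lift ord0 j))^-1 - (u ord0)^-1)
    = (-1) ^+ r * (\prod_(j < r) (u (lift ord0 j) - u ord0))
      * (\prod_(j < r) (u (lift ord0 j))^-1) * u ord0 ^- r.
  have Ec (c : F) : c ^+ r = \prod_(j < r) c by rewrite prodr_const card_ord.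
  rewrite !Ec -prodfV -!big_split; apply: eq_bigr => j _ /=.
  by field; rewrite !u0.
have -> : \prod_(j < r) (u (lift ord0 j)) ^- r
    = (\prod_(j < r) (u (lift ord0 j))^-1) * \prod_(j < r) (u (lift ord0 j)) ^- r.-1.
  rewrite -big_split; apply: eq_bigr => j _ /=.
  by case: r j {IH u u0} (u _) => [[]//|r] _ z; rewrite exprS invfM.
have -> : (-1) ^+ (r.+1 %/ 2) = (-1) ^+ r * (-1) ^+ (r %/ 2) :> F.
  rewrite -exprD -signr_odd -[RHS]signr_odd; congr (_ ^+ nat_of_bool _).
  by rewrite !divn2 -[r.+1./2]/(uphalf r) uphalf_half !oddD oddb.
by ring.
Qed.

End Determinants.

(** * Signed permutations acting on rational functions *)

Section SignedPermutations.

Variables m n : nat.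
Implicit Types w : signed_perm m n.

Definition wperm w (k : 'I_(m + n)) : 'I_(m + n) :=
  let: (s, t, A, B) := w in
  match split k with inl i => lshift n (s i) | inr j => rshift m (t j) end.

Definition wneg w (k : 'I_(m + n)) : bool :=
  let: (s, t, A, B) := w in
  match split k with inl i => i \in A | inr j => j \in B end.

(* [wmul w w'] acts as [w] after [w']. *)
Definition wmul w w' : signed_perm m n :=
  let: (s, t, A, B) := w in let: (s', t', A', B') := w' in
  ((s' * s)%g, (t' * t)%g, [set i | (i \in A') (+) (s' i \in A)],
   [set j | (j \in B') (+) (t' j \in B)]).

Definition winv w : signed_perm m n :=
  let: (s, t, A, B) := w in
  ((s^-1)%g, (t^-1)%g, [set i | (s^-1)%g i \in A], [set j | (t^-1)%g j \in B]).

Lemma split_lshift p q (i : 'I_p) : split (lshift q i) = inl i.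
Proof. exact: (unsplitK (inl i)). Qed.

Lemma split_rshift p q (j : 'I_q) : split (rshift p j) = inr j.
Proof. exact: (unsplitK (inr j)). Qed.

Lemma wpermM w w' k : wperm (wmul w w') k = wperm w (wperm w' k).
Proof.
case: w w' => [[[s t] A] B] [[[s' t'] A'] B'] /=.
by case: (split k) => i; rewrite permM ?split_lshift ?split_rshift.
Qed.

Lemma wnegM w w' k : wneg (wmul w w') k = wneg w' k (+) wneg w (wperm w' k).
Proof.
case: w w' => [[[s t] A] B] [[[s' t'] A'] B'] /=.
by case: (split k) => i; rewrite ?split_lshift ?split_rshift inE.
Qed.

Lemma wmulVw w : wmul (winv w) w = (1%g, 1%g, set0, set0).
Proof.
case: w => [[[s t] A] B] /=; rewrite !mulgV; congr (_, _, _, _);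
  by apply/setP => i; rewrite !inE permK addbb.
Qed.

Lemma wmulK w : cancel (wmul^~ w) (wmul^~ (winv w)).
Proof.
case: w => [[[s t] A] B] [[[s' t'] A'] B'] /=.
rewrite !mulgA !mulVg !mul1g; congr (_, _, _, _);
  by apply/setP => i; rewrite !inE permKV addbA addbb.
Qed.

Lemma wmulKV w : cancel (wmul^~ (winv w)) (wmul^~ w).
Proof.
case: w => [[[s t] A] B] [[[s' t'] A'] B'] /=.
rewrite !mulgA !mulgV !mul1g; congr (_, _, _, _);
  by apply/setP => i; rewrite !inE permK addbA addbb.
Qed.

Lemma wpermK w : cancel (wperm w) (wperm (winv w)).
Proof.
move=> k; rewrite -wpermM wmulVw /=.
by rewrite -[RHS](splitK k); case: (split k) => i; rewrite perm1.
Qed.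

Lemma wnegK w k : wneg (winv w) (wperm w k) = wneg w k.
Proof.
have := wnegM (winv w) w k; rewrite wmulVw /=.
by case: (split k) => i; rewrite inE; case: (wneg w k); case: (wneg _ _).
Qed.

Lemma wperm_inj w : injective (wperm w).
Proof. exact: can_inj (wpermK w). Qed.

Lemma wact_wperm w mu k : wact w mu 0 (wperm w k) = (-1) ^+ wneg w k * mu 0 k.
Proof.
case: w => [[[s t] A] B] /=; rewrite -[in mu 0 k](splitK k).
by case: (split k) => i /=; rewrite mxE ?split_lshift ?split_rshift mxE permK mxE.
Qed.

(** The set is the symmetric difference of [A'] and the preimage of [A] under [s], and the parity of
    the cardinality is additive on symmetric differences. *)
Lemma odd_card_addb p (s : 'S_p) (A A' : {set 'I_p}) :
  odd #|[set i | (i \in A') (+) (s i \in A)]| = odd #|A'| (+) odd #|A|.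
Proof.
have oddE (D : {set 'I_p}) : odd #|D| = \big[addb/false]_i (i \in D).
  rewrite -sum1_card (big_morph odd oddD (erefl _)) big_mkcond /=.
  by apply: eq_bigr => i _; case: (i \in D).
rewrite !oddE [X in _ (+) X](reindex_inj (@perm_inj _ s)) -big_split /=.
by apply: eq_bigr => i _; rewrite inE.
Qed.

Lemma wsgnM w w' : wsgn (wmul w w') = wsgn w * wsgn w'.
Proof.
case: w w' => [[[s t] A] B] [[[s' t'] A'] B'] /=.
rewrite -exprD -signr_odd -[RHS]signr_odd !oddD !odd_card_addb !odd_permM !oddb; congr (_ ^+ nat_of_bool _); move: (odd #|A|) (odd #|B|) (odd #|A'|) (odd #|B'|) => [] [] [] [];
  by do 4!case: (odd_perm _).
Qed.

Lemma wsgn_sqr w : wsgn w * wsgn w = 1.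
Proof. by case: w => [[[s t] A] B] /=; rewrite -expr2 sqrr_sign. Qed.

(** Closure of the group, as an equality of membership tests so that it can reindex the sum in
    [JW]. *)
Lemma Weyl_mul g w w' : w' \in Weyl g m n -> (wmul w w' \in Weyl g m n) = (w \in Weyl g m n).
Proof.
case: w w' => [[[s t] A] B] [[[s' t'] A'] B'] /=; rewrite !inE; case: g => //.
  move=> /andP[/eqP-> /eqP->].
  have E p (u : 'S_p) (D : {set 'I_p}) :
      ([set i | (i \in set0) (+) (u i \in D)] == set0) = (D == set0).
    apply/eqP/eqP => [/setP H|->]; last by apply/setP => i; rewrite !inE.
    by apply/setP => i; have := H ((u^-1)%g i); rewrite !inE permKV.
  by rewrite !E.
by rewrite odd_card_addb => /negbTE ->.
Qed.

End SignedPermutations.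

(** * Signed permutations as automorphisms of the fraction field; antisymmetry of J_W *)

Section Substitution.

Variables m n : nat.
Local Notation K := (charField m n).
Local Notation P := {mpoly rat[m + n]}.
Implicit Types w : signed_perm m n.

Definition XK (k : 'I_(m + n)) : K := @FracField.tofrac P 'X_k.

Lemma XK_neq0 k : XK k != 0.
Proof. rewrite tofrac_eq0; apply/eqP => /(congr1 (fun q => q@_U_(k)%MM))/eqP.
by rewrite mcoeffX eqxx mcoeff0 oner_eq0. Qed.

Lemma charField_natr_neq0 d : (0 < d)%N -> d%:R != 0 :> K.
Proof.
move=> d0; rewrite -(rmorph_nat (@FracField.tofrac P)) tofrac_eq0.
rewrite -(rmorph_nat (@mpolyC (m + n) rat)) mpolyC_eq0 pnatr_eq0; lia.
Qed.

Lemma ExpE mu : Exp mu = \prod_k XK k ^ numq (2 * mu 0 k).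
Proof. by []. Qed.

Lemma Exp_neq0 mu : Exp mu != 0 :> K.
Proof. by apply/prodf_neq0 => k _; rewrite expfz_neq0 ?XK_neq0. Qed.

Definition sgnz (b : bool) : int := if b then -1 else 1.

Lemma Exp_wact w mu :
  Exp (wact w mu) = \prod_k (XK (wperm w k) ^ sgnz (wneg w k)) ^ numq (2 * mu 0 k) :> K.
Proof.
rewrite ExpE (reindex_inj (@wperm_inj _ _ w)); apply: eq_bigr => k _.
rewrite wact_wperm exprz_exp; congr (_ ^ _); case: (wneg w k) => /=.
  by rewrite expr1 mulN1r mulrN numqN mulN1r.
by rewrite expr0 !mul1r.
Qed.

Lemma Exp_wact_delta w k :
  Exp (wact w (2^-1 *: delta_mx 0 k)) = XK (wperm w k) ^ sgnz (wneg w k) :> K.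
Proof.
rewrite Exp_wact (bigD1 k) //= big1 => [|l lk]; rewrite !mxE !eqxx /=.
  by rewrite mulr1 mulr1 expr1z.
by rewrite (negbTE lk) !mulr0.
Qed.

Definition ratK (c : rat) : K := @FracField.tofrac P c%:MP.

Lemma ratK_zmod : zmod_morphism ratK.
Proof. by move=> a b; rewrite /ratK !rmorphB. Qed.

Lemma ratK_monoid : monoid_morphism ratK.
Proof. by split=> [|a b]; rewrite /ratK ?rmorph1 ?rmorphM. Qed.

HB.instance Definition _ := GRing.isZmodMorphism.Build rat K ratK ratK_zmod.
HB.instance Definition _ := GRing.isMonoidMorphism.Build rat K ratK ratK_monoid.

Lemma wsubstE w Q :
  wsubst w Q = mmap ratK (fun k => Exp (wact w (2^-1 *: delta_mx 0 k))) Q.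
Proof. by []. Qed.

Lemma wsubst_zmod w : zmod_morphism (wsubst w).
Proof. by move=> Q Q'; rewrite !wsubstE rmorphB. Qed.

Lemma wsubst_monoid w : monoid_morphism (wsubst w).
Proof. by split=> [|Q Q']; rewrite !wsubstE ?rmorph1 ?rmorphM. Qed.

HB.instance Definition _ w := GRing.isZmodMorphism.Build P K (wsubst w) (wsubst_zmod w).
HB.instance Definition _ w :=
  GRing.isMonoidMorphism.Build P K (wsubst w) (wsubst_monoid w).

Lemma wsubstC w c : wsubst w c%:MP = ratK c.
Proof. by rewrite wsubstE mmapC. Qed.

Lemma wsubstX w k : wsubst w 'X_k = XK (wperm w k) ^ sgnz (wneg w k).
Proof. by rewrite wsubstE mmapX mmap1U Exp_wact_delta. Qed.

Lemma mpoly_gen_ind (Z : P -> Prop) :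
  (forall c, Z c%:MP) -> (forall k, Z 'X_k) ->
  (forall p q, Z p -> Z q -> Z (p + q)) -> (forall p q, Z p -> Z q -> Z (p * q)) ->
  forall p, Z p.
Proof.
move=> ZC ZX ZD ZM; elim/mpolyind => [|c mm p _ _ Zp]; first by rewrite -mpolyC0.
apply: (ZD _ _ _ Zp); rewrite -mul_mpolyC; apply: (ZM _ _ (ZC c)).
rewrite (mpolyXE _ 1%g); apply: (@big_ind _ Z) => //; first by rewrite -mpolyC1; apply: ZC.
move=> k _; rewrite perm1; elim: (mm k) => [|d IH]; first by rewrite expr0 -mpolyC1; apply: ZC.
by rewrite exprS; apply: ZM.
Qed.

(* The inverse substitution recovers [p] from [wsubst w p], after clearing a *)
(* monomial denominator.                                                     *)
Lemma wsubst_inv w p : exists Q M,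
  [/\ wsubst w p * FracField.tofrac M = FracField.tofrac Q,
      wsubst (winv w) Q = FracField.tofrac p * wsubst (winv w) M
    & wsubst (winv w) M != 0].
Proof.
elim/mpoly_gen_ind: p => [c|k|p q [Q [M [e1 e2 e3]]] [Q' [M' [e1' e2' e3']]]
                         |p q [Q [M [e1 e2 e3]]] [Q' [M' [e1' e2' e3']]]].
- by exists c%:MP, 1; rewrite wsubstC !rmorph1 !mulr1 wsubstC oner_eq0.
- case: (boolP (wneg w k)) => neg.
    exists 1, 'X_(wperm w k).
    rewrite !wsubstX !rmorph1 wnegK wpermK neg /= -/(XK _) -/(XK _) exprN1.
    by rewrite mulVf ?mulfV ?invr_eq0 ?XK_neq0.
  exists 'X_(wperm w k), 1.
  rewrite !wsubstX !rmorph1 wnegK wpermK (negbTE neg) /= !mulr1.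
  by rewrite oner_neq0.
- exists (Q * M' + Q' * M), (M * M'); split.
  + rewrite rmorphD /= mulrDl !rmorphD !rmorphM /= -e1 -e1'; ring.
  + rewrite !rmorphD !rmorphM /= e2 e2'; ring.
  + rewrite rmorphM; exact: mulf_neq0 e3 e3'.
- exists (Q * Q'), (M * M'); split.
  + by rewrite !rmorphM /= -e1 -e1'; ring.
  + by rewrite !rmorphM /= e2 e2'; ring.
  + rewrite rmorphM; exact: mulf_neq0 e3 e3'.
Qed.

(** Injectivity is what allows the substitution to extend to fractions. *)
Lemma wsubst_eq0 w p : (wsubst w p == 0) = (p == 0).
Proof.
apply/eqP/eqP => [p0|->]; last by rewrite rmorph0.
have [Q [M [e1 e2 e3]]] := wsubst_inv w p.
move: e1; rewrite p0 mul0r => /esym/eqP; rewrite tofrac_eq0 => /eqP Q0.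
move: e2; rewrite Q0 rmorph0 => /esym/eqP; rewrite mulf_eq0 (negbTE e3) orbF.
by rewrite tofrac_eq0 => /eqP.
Qed.

Lemma fraction_repr (f : K) :
  f = FracField.tofrac \n_(generic_quotient.repr f)
    / FracField.tofrac \d_(generic_quotient.repr f).
Proof.
have d0 : FracField.tofrac \d_(generic_quotient.repr f) != 0 :> K.
  by rewrite tofrac_eq0 denom_ratioP.
apply: (canRL (mulfK d0)); move: d0 => _.
rewrite -{1}[f]generic_quotient.reprK; unlock FracField.tofrac.
rewrite -[LHS]FracField.pi_mul /=; apply/generic_quotient.eqmodP.
rewrite /= FracField.equivfE /FracField.mulf !numden_Ratio ?oner_neq0 ?mulr1 //.
  by rewrite mulrC.
all: exact: denom_ratioP.
Qed.

Local Notation tofrac := (@FracField.tofrac P).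

Lemma fraction_ind (Z : K -> Prop) :
  (forall p q, q != 0 -> Z (tofrac p / tofrac q)) -> forall f, Z f.
Proof. by move=> Zpq f; rewrite (fraction_repr f); apply/Zpq/denom_ratioP. Qed.

(** [wfrac] is defined through a chosen representative n'/d'. Independence of the choice: p d' = n'
    q is an equation between polynomials, which the substitution preserves. *)
Lemma wfrac_div w p q : q != 0 ->
  wfrac w (tofrac p / tofrac q) = wsubst w p / wsubst w q.
Proof.
move=> q0; set f := tofrac p / tofrac q.
have fE := fraction_repr f; rewrite /wfrac.
set n' := \n_ _ in fE *; set d' := \d_ _ in fE *.
have d0 : d' != 0 by apply: denom_ratioP.
have E : p * d' = n' * q.
  apply/eqP; rewrite -(tofrac_eq (p * d')) !rmorphM /=; apply/eqP.
  move: fE; rewrite /f => /(congr1 (fun z => z * (tofrac q * tofrac d'))).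
  rewrite mulrA divfK ?tofrac_eq0 // => ->.
  by rewrite [tofrac q * _]mulrC mulrA divfK ?tofrac_eq0.
have w0 (a : P) : a != 0 -> wsubst w a != 0 by rewrite wsubst_eq0.
apply/eqP; rewrite eqr_div ?w0 // -!rmorphM E; apply/eqP.
by [].
Qed.

Lemma wfrac_tofrac w p : wfrac w (tofrac p) = wsubst w p.
Proof.
rewrite -[tofrac p]divr1 -(rmorph1 tofrac) wfrac_div ?oner_neq0 //.
by rewrite rmorph1 divr1.
Qed.

Lemma wfrac_zmod w : zmod_morphism (wfrac w).
Proof.
move=> f f'; elim/fraction_ind: f => p q q0; elim/fraction_ind: f' => p' q' q0'.
have t0 (a : P) : a != 0 -> tofrac a != 0 by rewrite tofrac_eq0.
have w0 (a : P) : a != 0 -> wsubst w a != 0 by rewrite wsubst_eq0.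
rewrite -mulNr addf_div ?t0 // mulNr -!rmorphM -rmorphB.
rewrite !wfrac_div ?mulf_neq0 // rmorphB !rmorphM /=.
by rewrite -[in RHS]mulNr addf_div ?w0 // mulNr.
Qed.

Lemma wfrac_monoid w : monoid_morphism (wfrac w).
Proof.
split=> [|f f']; first by rewrite -(rmorph1 tofrac) wfrac_tofrac !rmorph1.
elim/fraction_ind: f => p q q0; elim/fraction_ind: f' => p' q' q0'.
rewrite mulf_div -!rmorphM !wfrac_div ?mulf_neq0 // !rmorphM /=.
by rewrite mulf_div.
Qed.

HB.instance Definition _ w := GRing.isZmodMorphism.Build K K (wfrac w) (wfrac_zmod w).
HB.instance Definition _ w :=
  GRing.isMonoidMorphism.Build K K (wfrac w) (wfrac_monoid w).

Lemma wfracX w k : wfrac w (XK k) = XK (wperm w k) ^ sgnz (wneg w k).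
Proof. by rewrite wfrac_tofrac wsubstX. Qed.

Lemma wfrac_wmul w w' f : wfrac (wmul w w') f = wfrac w (wfrac w' f).
Proof.
have E p : wsubst (wmul w w') p = wfrac w (wsubst w' p).
  elim/mpoly_gen_ind: p => [c|k|p q Ep Eq|p q Ep Eq].
  - by rewrite !wsubstC wfrac_tofrac wsubstC.
  - rewrite !wsubstX fmorphXz /= wfracX wpermM wnegM exprz_exp; congr (_ ^ _).
    by case: (wneg w' k); case: (wneg w _).
  - by rewrite !rmorphD /= Ep Eq.
  - by rewrite !rmorphM /= Ep Eq.
elim/fraction_ind: f => p q q0.
by rewrite !wfrac_div // fmorph_div /= !E.
Qed.

Variable g : superType.

Lemma JWZ c f : (forall w, wfrac w c = c) -> JW g (c * f) = c * JW g f.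
Proof.
move=> cE; rewrite /JW mulr_sumr; apply: eq_bigr => w _.
by rewrite rmorphM /= cE mulrCA.
Qed.

Lemma JW_sum (I : finType) (F : I -> K) : JW g (\sum_i F i) = \sum_i JW g (F i).
Proof.
rewrite /JW exchange_big /=; apply: eq_bigr => w _.
by rewrite raddf_sum mulr_sumr.
Qed.

(** Right translation by [w] permutes the group and multiplies all signs by that of [w]. *)
Lemma JW_wfrac w f : w \in Weyl g m n -> JW g (wfrac w f) = wsgn w * JW g f.
Proof.
move=> wW; rewrite /JW mulr_sumr [RHS](reindex (fun v => wmul v w)) /=; last first.
  by exists (fun v => wmul v (winv w)) => v _; rewrite ?wmulK ?wmulKV.
apply: eq_big => [v|v _]; first by rewrite Weyl_mul.
rewrite wsgnM wfrac_wmul; move: (wfrac v _) => X.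
by rewrite mulrA [wsgn v * wsgn w]mulrC mulrA wsgn_sqr mul1r.
Qed.

End Substitution.

(* Otherwise rewriting unfolds these through the big operators. *)
#[local] Opaque JW wfrac wsubst Exp.

(** * Permutations of the tail as permutations of all indices *)

Section ExtendPermutation.

Variables (r m : nat) (h : 'I_r -> 'I_m).
Hypothesis h_inj : injective h.

Definition pext_fun (s : 'S_r) (k : 'I_m) : 'I_m :=
  if [pick i | h i == k] is Some i then h (s i) else k.

Lemma pext_fun_h s i : pext_fun s (h i) = h (s i).
Proof.
rewrite /pext_fun; case: pickP => [j /eqP/h_inj -> //|/(_ i)].
by rewrite eqxx.
Qed.

Lemma pext_fun_out s k : k \notin codom h -> pext_fun s k = k.
Proof.
move=> kh; rewrite /pext_fun; case: pickP => // i /eqP hi.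
by rewrite -hi codom_f in kh.
Qed.

Lemma pext_fun_inj s : injective (pext_fun s).
Proof.
apply: (can_inj (g := pext_fun s^-1)) => k.
have [/codomP[i ->]|kh] := boolP (k \in codom h).
  by rewrite !pext_fun_h permK.
by rewrite !pext_fun_out.
Qed.

Definition pext (s : 'S_r) : 'S_m := perm (@pext_fun_inj s).

Lemma pext_h s i : pext s (h i) = h (s i).
Proof. by rewrite permE pext_fun_h. Qed.

Lemma pext_out s k : k \notin codom h -> pext s k = k.
Proof. by move=> kh; rewrite permE pext_fun_out. Qed.

Lemma pextM s t : pext (s * t) = (pext s * pext t)%g.
Proof.
apply/permP => k; rewrite permM; have [/codomP[i ->]|kh] := boolP (k \in codom h).
  by rewrite !pext_h permM.
by rewrite !pext_out.
Qed.

Lemma pext_tperm a b : pext (tperm a b) = tperm (h a) (h b).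
Proof.
apply/permP => k; have [/codomP[i ->]|kh] := boolP (k \in codom h).
  by rewrite pext_h inj_tperm.
rewrite pext_out // tpermD //; apply: contraNneq kh => <-; exact: codom_f.
Qed.

(** Extension is multiplicative and sends transpositions to transpositions. *)
Lemma odd_pext s : odd_perm (pext s) = odd_perm s.
Proof.
have [ts -> _] := prod_tpermP s; elim: ts => [|[a b] ts IH].
  rewrite big_nil odd_perm1 (_ : pext 1 = 1%g) ?odd_perm1 //.
  by apply: (mulgI (pext 1)); rewrite -pextM !mulg1.
by rewrite big_cons pextM !odd_permM IH pext_tperm !odd_tperm (inj_eq h_inj).
Qed.

End ExtendPermutation.

(** * Symmetrising over permutations and sign changes of some coordinates *)

Section Symmetrisation.

Variables m n : nat.
Local Notation K := (charField m n).

Definition xe (i : 'I_m) : K := XK (lshift n i).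
Definition xd (j : 'I_n) : K := XK (rshift m j).

Lemma xe_neq0 i : xe i != 0. Proof. exact: XK_neq0. Qed.
Lemma xd_neq0 j : xd j != 0. Proof. exact: XK_neq0. Qed.

Lemma wfrac_xe s t A B i : wfrac (s, t, A, B) (xe i) = xe (s i) ^ sgnz (i \in A).
Proof. by rewrite [LHS]wfracX /= split_lshift. Qed.

Lemma wfrac_xd s t A B j : wfrac (s, t, A, B) (xd j) = xd (t j) ^ sgnz (j \in B).
Proof. by rewrite [LHS]wfracX /= split_rshift. Qed.

Section Permutations.

Variables (g : superType) (r : nat) (M : 'M[K]_r) (E : K).

Definition eperm (h : 'I_r -> 'I_m) (h_inj : injective h) (s : 'S_r) : signed_perm m n :=
  (pext h_inj s, 1%g, set0, set0).

Definition dperm (h : 'I_r -> 'I_n) (h_inj : injective h) (s : 'S_r) : signed_perm m n :=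
  (1%g, pext h_inj s, set0, set0).

(** Each term of the Leibniz expansion of the determinant is the image of the diagonal term under
    [w s], with matching sign; by antisymmetry all r! terms have the same [JW]. *)
Lemma JW_det (w : 'S_r -> signed_perm m n) :
  (forall s, w s \in Weyl g m n) -> (forall s, wsgn (w s) = (-1) ^+ s) ->
  (forall s, wfrac (w s) (E * \prod_i M i i) = E * \prod_i M i (s i)) ->
  r`!%:R * JW g (E * \prod_i M i i) = JW g (E * \det M).
Proof.
move=> wW ws wM.
have -> : JW g (E * \det M)
    = \sum_(s : 'S_r) JW g (E * ((-1) ^+ s * \prod_i M i (s i))).
  by rewrite -JW_sum -mulr_sumr.
have JWs (s : 'S_r) : JW g (E * ((-1) ^+ s * \prod_i M i (s i))) = JW g (E * \prod_i M i i).
  rewrite mulrCA -wM [LHS]JWZ; last by move=> v; rewrite rmorph_sign.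
  by rewrite JW_wfrac // ws mulrA -expr2 sqrr_sign mul1r.
rewrite (eq_bigr _ (fun s _ => JWs s)) sumr_const -[RHS]mulr_natl.
by congr (_%:R * _); rewrite -card_Sn; apply: eq_card => s; rewrite !inE.
Qed.

Lemma JW_eperm (h : 'I_r -> 'I_m) (h_inj : injective h) :
  (forall s, wfrac (eperm h_inj s) (E * \prod_i M i i) = E * \prod_i M i (s i)) ->
  r`!%:R * JW g (E * \prod_i M i i) = JW g (E * \det M).
Proof.
apply: JW_det => s; last first.
  by rewrite /= odd_pext odd_perm1 !cards0 !addn0.
by rewrite inE /=; case: (g) => //; rewrite ?eqxx ?cards0.
Qed.

Lemma JW_dperm (h : 'I_r -> 'I_n) (h_inj : injective h) :
  (forall s, wfrac (dperm h_inj s) (E * \prod_i M i i) = E * \prod_i M i (s i)) ->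
  r`!%:R * JW g (E * \prod_i M i i) = JW g (E * \det M).
Proof.
apply: JW_det => s; last first.
  by rewrite /= odd_pext odd_perm1 !cards0 !addn0.
by rewrite inE /=; case: (g) => //; rewrite ?eqxx ?cards0.
Qed.

End Permutations.

Section Flips.

Variables (g : superType) (r : nat) (f f' : 'I_r -> K) (E : K).

Definition eflip (h : 'I_r -> 'I_m) (A : {set 'I_r}) : signed_perm m n :=
  (1%g, 1%g, h @: A, set0).

Definition dflip (h : 'I_r -> 'I_n) (B : {set 'I_r}) : signed_perm m n :=
  (1%g, 1%g, set0, h @: B).

(** Expanding the product over the set of flipped indices gives 2^r terms with the same [JW]. The
    flag [eps] is true when every single flip has sign -1, and false when the flips are completed to
    even ones. *)
Lemma JW_flip (eps : bool) (w : {set 'I_r} -> signed_perm m n) :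
  (forall B, w B \in Weyl g m n) ->
  (forall B, wsgn (w B) = (-1) ^+ (eps * #|B|)) ->
  (forall B, wfrac (w B) (E * \prod_i f i)
             = E * \prod_i (if i \in B then f' i else f i)) ->
  (2 ^ r)%:R * JW g (E * \prod_i f i) = JW g (E * \prod_i (f i + (-1) ^+ eps * f' i)).
Proof.
move=> wW ws wM.
have -> : JW g (E * \prod_i (f i + (-1) ^+ eps * f' i))
    = \sum_(B : {set 'I_r}) JW g (E * ((-1) ^+ (eps * #|B|)
        * \prod_i (if i \in B then f' i else f i))).
  rewrite -JW_sum -mulr_sumr; congr (JW g (E * _)).
  under eq_bigr do rewrite addrC.
  rewrite bigA_distr; apply: eq_bigr => B _.
  rewrite exprM -prodr_const [X in _ = X * _]big_mkcond -big_split /=.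
  by apply: eq_bigr => i _; case: (i \in B); rewrite ?mul1r.
have JWB (B : {set 'I_r}) : JW g (E * ((-1) ^+ (eps * #|B|)
    * \prod_i (if i \in B then f' i else f i))) = JW g (E * \prod_i f i).
  rewrite mulrCA -wM [LHS]JWZ; last by move=> v; rewrite rmorphXn rmorphN1.
  by rewrite JW_wfrac // ws mulrA -expr2 exprAC sqrrN !expr1n mul1r.
rewrite (eq_bigr _ (fun B _ => JWB B)) sumr_const -[RHS]mulr_natl; congr (_%:R * _).
by rewrite -[LHS](card_ord (2 ^ r)) card_ord -cardsT -powersetT card_powerset cardsT card_ord.
Qed.

Lemma JW_dflip (h : 'I_r -> 'I_n) : injective h -> ~~ is_gl g ->
  (forall B, wfrac (dflip h B) (E * \prod_i f i)
             = E * \prod_i (if i \in B then f' i else f i)) ->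
  (2 ^ r)%:R * JW g (E * \prod_i f i) = JW g (E * \prod_i (f i - f' i)).
Proof.
move=> h_inj gl H; rewrite (@JW_flip true (dflip h)) // => [|B|B].
- by congr (JW _ (_ * _)); apply: eq_bigr => i _; rewrite expr1 mulN1r.
- by rewrite inE /=; case: (g) gl => //; rewrite cards0.
- by rewrite /= !odd_perm1 cards0 mul1n card_imset.
Qed.

Lemma JW_eflip (h : 'I_r -> 'I_m) : injective h -> g = OSPodd ->
  (forall A, wfrac (eflip h A) (E * \prod_i f i)
             = E * \prod_i (if i \in A then f' i else f i)) ->
  (2 ^ r)%:R * JW g (E * \prod_i f i) = JW g (E * \prod_i (f i - f' i)).
Proof.
move=> h_inj gE H; rewrite (@JW_flip true (eflip h)) // => [|A|A].
- by congr (JW _ (_ * _)); apply: eq_bigr => i _; rewrite expr1 mulN1r.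
- by rewrite gE inE.
- by rewrite /= !odd_perm1 cards0 addn0 mul1n card_imset.
Qed.

(* The Weyl group of type D only contains even sign changes: a sign change   *)
(* is made even by composing it with that of [i0], which fixes the function. *)
Lemma JW_eflip_even (h : 'I_r -> 'I_m) (i0 : 'I_r) : injective h -> g = OSPeven ->
  f' i0 = f i0 ->
  (forall A, wfrac (eflip h A) (E * \prod_i f i)
             = E * \prod_i (if i \in A then f' i else f i)) ->
  (2 ^ r)%:R * JW g (E * \prod_i f i) = JW g (E * \prod_i (f i + f' i)).
Proof.
move=> h_inj gE fi0 H.
pose ev (A : {set 'I_r}) := if odd #|A| then (if i0 \in A then A :\ i0 else i0 |: A) else A.
have evE A : ~~ odd #|ev A|.
  rewrite /ev; case: (boolP (odd #|A|)) => // oA; case: (boolP (i0 \in A)) => iA.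
    by move: oA; rewrite (cardsD1 i0 A) iA add1n /=.
  by rewrite cardsU1 iA add1n /= negbK.
rewrite (@JW_flip false (fun A => eflip h (ev A))) => [|A|A|A].
- by congr (JW _ (_ * _)); apply: eq_bigr => i _; rewrite mul1r.
- by rewrite gE inE /= card_imset.
- by rewrite /= !odd_perm1 cards0 addn0 mul0n card_imset // -signr_odd (negbTE (evE A)).
- rewrite H; congr (_ * _); apply: eq_bigr => i _; rewrite /ev.
  have [->|ii0] := eqVneq i i0; first by rewrite fi0 !if_same.
  by case: (odd #|A|) => //; case: (i0 \in A); rewrite !inE ?ii0 ?(negbTE ii0).
Qed.

End Flips.

End Symmetrisation.

(** * Symmetrising over the tail *)

Section FieldIdentities.

Variable F : fieldType.
Implicit Types x y z : F.

(** For z = e^(eps/2) this is e^eps + e^-eps, an invariant of the sign change of eps. *)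
Definition uu z : F := z ^+ 2 + z ^- 2.

Lemma uuV z : uu z^-1 = uu z.
Proof. by rewrite /uu exprVn invrK addrC. Qed.

Lemma uuD x y : x != 0 -> y != 0 ->
  uu x + uu y = (x ^+ 2 + y ^+ 2) * (1 + x ^+ 2 * y ^+ 2) / (x ^+ 2 * y ^+ 2).
Proof. by move=> x0 y0; rewrite /uu; field; rewrite x0 y0. Qed.

Lemma uuD_neq0 x y : x != 0 -> y != 0 -> x ^+ 2 + y ^+ 2 != 0 ->
  1 + x ^+ 2 * y ^+ 2 != 0 -> uu x + uu y != 0.
Proof.
move=> x0 y0 a b; rewrite uuD //.
by rewrite mulf_neq0 ?invr_neq0 ?mulf_neq0 ?expf_neq0.
Qed.

Lemma uu_sub_rec z k : z != 0 ->
  z ^+ (k + 4) - z ^- (k + 4) = uu z * (z ^+ (k + 2) - z ^- (k + 2)) - (z ^+ k - z ^- k).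
Proof.
by move=> z0; rewrite !exprD /uu; field; rewrite expf_neq0.
Qed.

Lemma uu_add_rec z k : z != 0 ->
  z ^+ (k + 4) + z ^- (k + 4) = uu z * (z ^+ (k + 2) + z ^- (k + 2)) - (z ^+ k + z ^- k).
Proof.
by move=> z0; rewrite !exprD /uu; field; rewrite expf_neq0.
Qed.

Lemma uu_sub4 z : z != 0 -> z ^+ 4 - z ^- 4 = uu z * (z ^+ 2 - z ^- 2).
Proof. by move=> z0; rewrite /uu; field. Qed.

Lemma uu_sub3 z : z != 0 -> z ^+ 3 - z ^- 3 = (uu z + 1) * (z - z^-1).
Proof. by move=> z0; rewrite /uu; field. Qed.

(** For the isotropic root beta = del - eps this is the difference of 1/(1 + e^-beta) and its image
    under del -> -del; it produces the diagonal entries of the Cauchy matrix. *)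
Lemma flip_even x y : x != 0 -> y != 0 -> x ^+ 2 + y ^+ 2 != 0 ->
  1 + x ^+ 2 * y ^+ 2 != 0 ->
  (1 + x ^+ 2 * y ^- 2)^-1 - (1 + x ^+ 2 * y^-1 ^- 2)^-1 = (y ^+ 2 - y ^- 2) / (uu x + uu y).
Proof.
move=> x0 y0 a b; rewrite uuD // exprVn invrK.
have -> : 1 + x ^+ 2 * y ^- 2 = (x ^+ 2 + y ^+ 2) / y ^+ 2 by field.
by field; rewrite x0 y0 a exprMn b.
Qed.

(** The analogue for beta = eps - del. The factor x^-1 y comes from the coordinates -1/2 and 1/2 of
    lambda + rho on the tail. *)
Lemma flip_odd x y : x != 0 -> y != 0 -> x ^+ 2 + y ^+ 2 != 0 ->
  1 + x ^+ 2 * y ^+ 2 != 0 ->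
  x^-1 * y / (1 + y ^+ 2 * x ^- 2) - x^-1 * y^-1 / (1 + y^-1 ^+ 2 * x ^- 2)
    = (x - x^-1) * (y - y^-1) / (uu x + uu y).
Proof.
move=> x0 y0 a b; rewrite uuD //.
have -> : 1 + y ^+ 2 * x ^- 2 = (x ^+ 2 + y ^+ 2) / x ^+ 2 by field.
have -> : 1 + y^-1 ^+ 2 * x ^- 2 = (1 + x ^+ 2 * y ^+ 2) / (x ^+ 2 * y ^+ 2).
  by field; rewrite x0 y0.
by field; rewrite x0 y0 a exprMn b.
Qed.

Lemma addV_eq z : z != 0 -> z + z^-1 = (1 + z ^+ 2) / z.
Proof. by move=> z0; field. Qed.

Lemma sub2_div z : z != 0 -> 1 + z ^+ 2 != 0 ->
  (z ^+ 2 - z ^- 2) / (z + z^-1) = z - z^-1.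
Proof. by move=> z0 z1; rewrite addV_eq //; field; rewrite z0 z1. Qed.

End FieldIdentities.

Lemma mul2S3 k : (2 * k.+3 = 2 * k.+1 + 4)%N. Proof. lia. Qed.
Lemma mul2S2 k : (2 * k.+2 = 2 * k.+1 + 2)%N. Proof. lia. Qed.
Lemma mul2SS k : (2 * k.+2 = 2 * k + 4)%N. Proof. lia. Qed.
Lemma mul2S k : (2 * k.+1 = 2 * k + 2)%N. Proof. lia. Qed.

(** * Both sides of the osp identities as determinants *)

Section CoreIdentities.

Variables m n : nat.
Local Notation K := (charField m n).

(** Denominators are shown to be nonzero by evaluation at a rational point, below the point with all
    coordinates 1. *)
Lemma tofrac_meval_neq0 (p : {mpoly rat[m + n]}) (v : 'I_(m + n) -> rat) :
  p.@[v] != 0 -> FracField.tofrac p != 0 :> K.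
Proof. by rewrite tofrac_eq0; apply: contraNneq => ->; rewrite meval0. Qed.

Lemma wfrac_uu w (z : K) : wfrac w (uu z) = uu (wfrac w z).
Proof. by rewrite /uu rmorphD fmorphV rmorphXn. Qed.

Variables (r s : nat) (he : 'I_r -> 'I_m) (hd : 'I_s -> 'I_n).
Hypotheses (he_inj : injective he) (hd_inj : injective hd).

Let x (i : 'I_r) : K := xe n (he i).
Let y (j : 'I_s) : K := xd m (hd j).
Let U i := uu (x i).
Let V j := uu (y j).

Lemma x0 i : x i != 0. Proof. exact: xe_neq0. Qed.
Lemma y0 j : y j != 0. Proof. exact: xd_neq0. Qed.

Lemma xy_neq0 i j : x i ^+ 2 + y j ^+ 2 != 0.
Proof.
rewrite /x /y /xe /xd /XK -!rmorphXn -rmorphD /=.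
apply: (@tofrac_meval_neq0 _ (fun=> 1)).
by rewrite mevalD !rmorphXn /= !mevalXU expr1n.
Qed.

Lemma xy1_neq0 i j : 1 + x i ^+ 2 * y j ^+ 2 != 0.
Proof.
rewrite /x /y /xe /xd /XK -!rmorphXn -rmorphM -(rmorph1 (@FracField.tofrac _)) -rmorphD /=.
apply: (@tofrac_meval_neq0 _ (fun=> 1)).
by rewrite mevalD meval1 mevalM !rmorphXn /= !mevalXU !expr1n.
Qed.

Lemma UV_neq0 i j : U j + V i != 0.
Proof. exact: uuD_neq0 (x0 j) (y0 i) (xy_neq0 j i) (xy1_neq0 j i). Qed.

Lemma y21_neq0 j : 1 + y j ^+ 2 != 0.
Proof.
rewrite /y /xd /XK -rmorphXn -(rmorph1 (@FracField.tofrac _)) -rmorphD /=.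
apply: (@tofrac_meval_neq0 _ (fun=> 1)).
by rewrite mevalD meval1 rmorphXn /= mevalXU expr1n.
Qed.

(** Invariance under every signed permutation that moves only the tail, so that one hypothesis
    serves all the flips and permutations used below. *)
Definition tail_free (E : K) : Prop :=
  forall (s : 'S_m) (t : 'S_n) (A : {set 'I_m}) (B : {set 'I_n}),
  (forall i, i \notin codom he -> s i = i /\ i \notin A) ->
  (forall j, j \notin codom hd -> t j = j /\ j \notin B) ->
  wfrac (s, t, A, B) E = E.

Variable E : K.
Hypothesis E_free : tail_free E.

Lemma eperm_x w i : wfrac (eperm n he_inj w) (x i) = x (w i).
Proof. by rewrite /x wfrac_xe pext_h in_set0. Qed.

Lemma eperm_y w j : wfrac (eperm n he_inj w) (y j) = y j.
Proof. by rewrite /y wfrac_xd perm1 in_set0. Qed.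

Lemma eperm_E w : wfrac (eperm n he_inj w) E = E.
Proof. by apply: E_free => k kh; rewrite ?pext_out ?perm1 ?in_set0. Qed.

Lemma dperm_x w i : wfrac (dperm m hd_inj w) (x i) = x i.
Proof. by rewrite /x wfrac_xe perm1 in_set0. Qed.

Lemma dperm_y w j : wfrac (dperm m hd_inj w) (y j) = y (w j).
Proof. by rewrite /y wfrac_xd pext_h in_set0. Qed.

Lemma dperm_E w : wfrac (dperm m hd_inj w) E = E.
Proof. by apply: E_free => k kh; rewrite ?pext_out ?perm1 ?in_set0. Qed.

Lemma eflip_x A i : wfrac (eflip n he A) (x i) = if i \in A then (x i)^-1 else x i.
Proof. by rewrite /x wfrac_xe perm1 mem_imset //; case: (i \in A). Qed.

Lemma eflip_y A j : wfrac (eflip n he A) (y j) = y j.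
Proof. by rewrite /y wfrac_xd perm1 in_set0. Qed.

Lemma eflip_E A : wfrac (eflip n he A) E = E.
Proof.
apply: E_free => k kh; rewrite perm1 ?in_set0; split=> //.
by apply: contra kh => /imsetP[i _ ->]; apply: codom_f.
Qed.

Lemma dflip_x B i : wfrac (dflip m hd B) (x i) = x i.
Proof. by rewrite /x wfrac_xe perm1 in_set0. Qed.

Lemma dflip_y B j : wfrac (dflip m hd B) (y j) = if j \in B then (y j)^-1 else y j.
Proof. by rewrite /y wfrac_xd perm1 mem_imset //; case: (j \in B). Qed.

Lemma dflip_E B : wfrac (dflip m hd B) E = E.
Proof.
apply: E_free => k kh; rewrite perm1 ?in_set0; split=> //.
by apply: contra kh => /imsetP[i _ ->]; apply: codom_f.
Qed.

Definition den : K := cauchy_den U V.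

Lemma wfrac_den w : (forall i, wfrac w (U i) = U i) -> (forall j, wfrac w (V j) = V j) ->
  wfrac w den = den.
Proof.
move=> wU wV; rewrite /den /cauchy_den rmorph_prod; apply: eq_bigr => j _.
by rewrite rmorph_prod; apply: eq_bigr => i _; rewrite rmorphD /= wU wV.
Qed.

Lemma eperm_den w : wfrac (eperm n he_inj w) den = den.
Proof.
rewrite /den /cauchy_den rmorph_prod; apply: eq_bigr => j _.
rewrite rmorph_prod [RHS](reindex_inj (@perm_inj _ w)); apply: eq_bigr => i _.
by rewrite rmorphD /= !wfrac_uu eperm_x eperm_y.
Qed.

Lemma dperm_den w : wfrac (dperm m hd_inj w) den = den.
Proof.
rewrite /den /cauchy_den rmorph_prod [RHS](reindex_inj (@perm_inj _ w)).
apply: eq_bigr => j _; rewrite rmorph_prod; apply: eq_bigr => i _.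
by rewrite rmorphD /= !wfrac_uu dperm_x dperm_y.
Qed.

Lemma dflip_den B : wfrac (dflip m hd B) den = den.
Proof.
by apply: wfrac_den => k; rewrite wfrac_uu ?dflip_x ?dflip_y //; case: ifP; rewrite ?uuV.
Qed.

Lemma eflip_den A : wfrac (eflip n he A) den = den.
Proof.
by apply: wfrac_den => k; rewrite wfrac_uu ?eflip_x ?eflip_y //; case: ifP; rewrite ?uuV.
Qed.

Variable g : superType.
Hypothesis gl : ~~ is_gl g.

(** Type C: the flips give y^(2k) - y^(-2k), the permutations the determinant of these, which
    [det_cheb] evaluates with common factor y^2 - y^-2. *)
Lemma JW_dmonomial (G : K) :
  (forall B, wfrac (dflip m hd B) G = G) -> (forall w, wfrac (dperm m hd_inj w) G = G) ->
  (0 < s)%N ->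
  (2 ^ s * s`!)%:R * JW g (G * \prod_j y j ^+ (2 * j.+1))
    = JW g (G * (\prod_j (y j ^+ 2 - y j ^- 2)) * vdm V).
Proof.
move=> Gflip Gperm s0.
rewrite mulnC natrM -mulrA (@JW_dflip _ _ _ _ _ (fun j => y j ^- (2 * j.+1)) G hd) //; last first.
  move=> B; rewrite rmorphM /= Gflip rmorph_prod; congr (_ * _).
  apply: eq_bigr => j _; rewrite rmorphXn /= dflip_y; case: ifP => // _.
  by rewrite exprVn.
pose M : 'M[K]_s := \matrix_(i, j) (y j ^+ (2 * i.+1) - y j ^- (2 * i.+1)).
rewrite (eq_bigr (fun i => M i i)) => [|i _]; last by rewrite mxE.
rewrite (@JW_dperm _ _ _ _ M G hd hd_inj) => [|w]; last first.
  rewrite rmorphM /= Gperm rmorph_prod; congr (_ * _); apply: eq_bigr => j _.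
  by rewrite !mxE rmorphB fmorphV rmorphXn /= dperm_y.
congr (JW g _); rewrite -mulrA; congr (_ * _).
pose a k (j : 'I_s) : K := y j ^+ (2 * k.+1) - y j ^- (2 * k.+1).
have := @det_cheb _ s a V (fun j => y j ^+ 2 - y j ^- 2) 1 'X.
rewrite size_polyX coefX mul1r; apply=> // j => [k||].
- rewrite /a mul2S3 mul2S2.
  exact: uu_sub_rec (y0 j).
- by rewrite mul1r.
- by rewrite hornerX; apply: uu_sub4 (y0 j).
Qed.

(** Type D: the exponent 0 at the first index supplies the flip-invariant factor required by
    [JW_eflip_even]. It also makes row 0 of the determinant a row of twos, hence the factor 2. *)
Lemma JW_emonomial_even (G : K) : g = OSPeven ->
  (forall A, wfrac (eflip n he A) G = G) -> (forall w, wfrac (eperm n he_inj w) G = G) ->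
  (0 < r)%N ->
  (2 ^ r * r`!)%:R * JW g (G * \prod_i x i ^+ (2 * i)) = JW g (2 * (G * vdm U)).
Proof.
move=> gE Gflip Gperm r0.
rewrite mulnC natrM -mulrA.
rewrite (@JW_eflip_even _ _ _ _ _ (fun i => x i ^- (2 * i)) G he (Ordinal r0)) //; first last.
- move=> A; rewrite rmorphM /= Gflip rmorph_prod; congr (_ * _).
  apply: eq_bigr => i _; rewrite rmorphXn /= eflip_x; case: ifP => // _.
  by rewrite exprVn.
- by rewrite expr0 invr1.
pose M : 'M[K]_r := \matrix_(i, j) (x j ^+ (2 * i) + x j ^- (2 * i)).
rewrite (eq_bigr (fun i => M i i)) => [|i _]; last by rewrite mxE.
rewrite (@JW_eperm _ _ _ _ M G he he_inj) => [|w]; last first.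
  rewrite rmorphM /= Gperm rmorph_prod; congr (_ * _); apply: eq_bigr => j _.
  by rewrite !mxE rmorphD fmorphV rmorphXn /= eperm_x.
congr (JW g _); rewrite mulrCA; congr (_ * _).
pose a k (j : 'I_r) : K := x j ^+ (2 * k) + x j ^- (2 * k).
have := @det_cheb _ r a U (fun=> 1) 2 'X.
rewrite size_polyX coefX big1 // mulr1; apply=> // j => [k||].
- rewrite /a mul2SS mul2S.
  exact: uu_add_rec (x0 j).
- by rewrite /a muln0 expr0 invr1.
- by rewrite hornerX ?mulr1.
Qed.

(** Type B: the exponents are odd and the common factor of the rows is x - x^-1. *)
Lemma JW_emonomial_odd (G : K) : g = OSPodd ->
  (forall A, wfrac (eflip n he A) G = G) -> (forall w, wfrac (eperm n he_inj w) G = G) ->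
  (0 < r)%N ->
  (2 ^ r * r`!)%:R * JW g (G * \prod_i x i ^+ (2 * i).+1)
    = JW g (G * (\prod_i (x i - (x i)^-1)) * vdm U).
Proof.
move=> gE Gflip Gperm r0.
rewrite mulnC natrM -mulrA.
rewrite (@JW_eflip _ _ _ _ _ (fun i => x i ^- (2 * i).+1) G he) //; last first.
  move=> A; rewrite rmorphM /= Gflip rmorph_prod; congr (_ * _).
  apply: eq_bigr => i _; rewrite rmorphXn /= eflip_x; case: ifP => // _.
  by rewrite exprVn.
pose M : 'M[K]_r := \matrix_(i, j) (x j ^+ (2 * i).+1 - x j ^- (2 * i).+1).
rewrite (eq_bigr (fun i => M i i)) => [|i _]; last by rewrite mxE.
rewrite (@JW_eperm _ _ _ _ M G he he_inj) => [|w]; last first.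
  rewrite rmorphM /= Gperm rmorph_prod; congr (_ * _); apply: eq_bigr => j _.
  by rewrite !mxE rmorphB fmorphV rmorphXn /= eperm_x.
congr (JW g _); rewrite -mulrA; congr (_ * _).
pose a k (j : 'I_r) : K := x j ^+ (2 * k).+1 - x j ^- (2 * k).+1.
have := @det_cheb _ r a U (fun j => x j - (x j)^-1) 1 ('X + 1).
rewrite mul1r; apply=> // [||j k|j|j].
- by rewrite -(rmorph1 (@polyC _)) size_XaddC.
- by rewrite coefD coefX coef1 addr0.
- rewrite /a mul2SS mul2S -!addSn.
  exact: uu_sub_rec (x0 j).
- by rewrite mul1r /a !expr1.
- by rewrite hornerD hornerX hornerC; apply: uu_sub3 (x0 j).
Qed.

Lemma wfrac_vdm (k : nat) w (u : 'I_k -> K) : (forall i, wfrac w (u i) = u i) ->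
  wfrac w (vdm u) = vdm u.
Proof.
move=> wu; rewrite /vdm rmorph_prod; apply: eq_bigr => i _.
by rewrite rmorph_prod; apply: eq_bigr => j _; rewrite rmorphB /= !wu.
Qed.

Lemma JW_even_euler : g = OSPeven -> (0 < r)%N -> (0 < s)%N ->
  (2 ^ s * s`! * (2 ^ r * r`!))%:R
    * JW g (E * (\prod_i x i ^+ (2 * i)) * (\prod_j y j ^+ (2 * j.+1)) / den)
  = 2 * JW g (E * (\prod_j (y j ^+ 2 - y j ^- 2)) * (vdm U * vdm V / den)).
Proof.
move=> gE r0 s0; rewrite mulnC natrM -mulrA [_ / den]mulrAC JW_dmonomial //; first last.
- move=> w; rewrite !rmorphM /= fmorphV /= dperm_E dperm_den; congr (_ * _ / _).
  by rewrite rmorph_prod; apply: eq_bigr => i _; rewrite rmorphXn /= dperm_x.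
- move=> B; rewrite !rmorphM /= fmorphV /= dflip_E dflip_den; congr (_ * _ / _).
  by rewrite rmorph_prod; apply: eq_bigr => i _; rewrite rmorphXn /= dflip_x.
set P := \prod_j (y j ^+ 2 - _); set Q := \prod_i _.
have -> : E * Q / den * P * vdm V = E * P * vdm V / den * Q by ring.
rewrite JW_emonomial_even //; first last.
- move=> w; rewrite !rmorphM /= fmorphV /= eperm_E eperm_den wfrac_vdm => [|j].
    congr (_ * _ * _ / _); rewrite rmorph_prod; apply: eq_bigr => j _.
    by rewrite rmorphB fmorphV rmorphXn /= eperm_y.
  by rewrite wfrac_uu eperm_y.
- move=> A; rewrite !rmorphM /= fmorphV /= eflip_E eflip_den wfrac_vdm => [|j].
    congr (_ * _ * _ / _); rewrite rmorph_prod; apply: eq_bigr => j _.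
    by rewrite rmorphB fmorphV rmorphXn /= eflip_y.
  by rewrite wfrac_uu eflip_y.
rewrite JWZ; last by move=> w; rewrite rmorph_nat.
by congr (_ * JW g _); ring.
Qed.

(** [iota] pairs each del with an eps. [M] will be a Cauchy matrix, bordered by a row of ones when r
    = s + 1; only its diagonal product and its behaviour under permutations of the eps enter. *)
Lemma JW_even_kw (iota : 'I_s -> 'I_r) (M : 'M[K]_r) :
  \prod_i M i i = \prod_j (U (iota j) + V j)^-1 ->
  (forall w i k, wfrac (eperm n he_inj w) (M i k) = M i (w k)) ->
  (2 ^ s * r`!)%:R * JW g (E * \prod_j (1 + x (iota j) ^+ 2 * y j ^- 2)^-1)
    = JW g (E * (\prod_j (y j ^+ 2 - y j ^- 2)) * \det M).
Proof.
move=> Mdiag wM; rewrite mulnC natrM -mulrA.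
rewrite (@JW_dflip _ _ _ _ _ (fun j => (1 + x (iota j) ^+ 2 * (y j)^-1 ^- 2)^-1) E hd) //.
  rewrite (eq_bigr (fun j => (y j ^+ 2 - y j ^- 2) * (U (iota j) + V j)^-1)); last first.
    by move=> j _; apply: flip_even; [exact: x0|exact: y0|exact: xy_neq0|exact: xy1_neq0].
  rewrite big_split /= -Mdiag mulrA (@JW_eperm _ _ _ _ M _ he he_inj) // => w.
  rewrite !rmorphM /= eperm_E !rmorph_prod; congr (_ * _ * _).
    by apply: eq_bigr => j _; rewrite rmorphB fmorphV rmorphXn /= eperm_y.
  by apply: eq_bigr => i _; rewrite /= wM.
move=> B; rewrite rmorphM /= dflip_E rmorph_prod; congr (_ * _).
apply: eq_bigr => j _.
rewrite fmorphV rmorphD rmorph1 rmorphM fmorphV !rmorphXn /= dflip_x dflip_y.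
by case: ifP.
Qed.

Lemma JW_odd_euler : g = OSPodd -> (0 < r)%N -> (0 < s)%N ->
  (2 ^ s * s`! * (2 ^ r * r`!))%:R
    * JW g (E * (\prod_i x i ^+ (2 * i).+1) * (\prod_j y j ^+ (2 * j.+1))
              / ((\prod_j (y j + (y j)^-1)) * den))
  = JW g (E * (\prod_i (x i - (x i)^-1)) * (\prod_j (y j - (y j)^-1))
          * (vdm U * vdm V / den)).
Proof.
move=> gE r0 s0; rewrite mulnC natrM -mulrA.
set P := \prod_j (y j + _); set Q := \prod_i x i ^+ _; set P1 := \prod_j (y j - _).
rewrite [_ / (P * den)]mulrAC JW_dmonomial //; first last.
- move=> w; rewrite rmorphM /= fmorphV rmorphM /= dperm_E rmorphM /= dperm_den; congr (_ * _ / (_ * _)).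
    by rewrite rmorph_prod; apply: eq_bigr => i _; rewrite rmorphXn /= dperm_x.
  rewrite rmorph_prod [RHS](reindex_inj (@perm_inj _ w)); apply: eq_bigr => i _.
  by rewrite rmorphD fmorphV /= dperm_y.
- move=> B; rewrite rmorphM /= fmorphV rmorphM /= dflip_E rmorphM /= dflip_den; congr (_ * _ / (_ * _)).
    by rewrite rmorph_prod; apply: eq_bigr => i _; rewrite rmorphXn /= dflip_x.
  rewrite rmorph_prod; apply: eq_bigr => i _.
  rewrite rmorphD fmorphV /= dflip_y; case: ifP => // _.
  by rewrite invrK addrC.
(* The nonisotropic odd roots del contribute y + y^-1 to the denominator, which reduces the type C
   factor y^2 - y^-2 to y - y^-1. *)
have PE : (\prod_j (y j ^+ 2 - y j ^- 2)) / P = P1.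
  rewrite /P -prodfV -big_split; apply: eq_bigr => j _.
  exact: sub2_div (y0 j) (y21_neq0 j).
set P2 := \prod_j (y j ^+ 2 - _) in PE *.
have -> : E * Q / (P * den) * P2 * vdm V = E * P1 * vdm V / den * Q.
  by rewrite -PE invfM; ring.
rewrite JW_emonomial_odd //; first last.
- move=> w; rewrite !rmorphM /= fmorphV /= eperm_E eperm_den wfrac_vdm => [|j].
    congr (_ * _ * _ / _); rewrite rmorph_prod; apply: eq_bigr => j _.
    by rewrite rmorphB fmorphV /= eperm_y.
  by rewrite wfrac_uu eperm_y.
- move=> A; rewrite !rmorphM /= fmorphV /= eflip_E eflip_den wfrac_vdm => [|j].
    congr (_ * _ * _ / _); rewrite rmorph_prod; apply: eq_bigr => j _.
    by rewrite rmorphB fmorphV /= eflip_y.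
  by rewrite wfrac_uu eflip_y.
by congr (JW g _); ring.
Qed.

Lemma JW_odd_kw (iota : 'I_s -> 'I_r) (M : 'M[K]_r) : bijective iota ->
  \prod_i M i i = \prod_j (U (iota j) + V j)^-1 ->
  (forall w i k, wfrac (eperm n he_inj w) (M i k) = M i (w k)) ->
  (2 ^ s * r`!)%:R
    * JW g (E * \prod_j ((x (iota j))^-1 * y j / (1 + y j ^+ 2 * x (iota j) ^- 2)))
  = JW g (E * (\prod_i (x i - (x i)^-1)) * (\prod_j (y j - (y j)^-1)) * \det M).
Proof.
move=> iota_bij Mdiag wM; rewrite mulnC natrM -mulrA.
rewrite (@JW_dflip _ _ _ _ _ (fun j => (x (iota j))^-1 * (y j)^-1
           / (1 + (y j)^-1 ^+ 2 * x (iota j) ^- 2)) E hd) //.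
  rewrite (eq_bigr (fun j => (x (iota j) - (x (iota j))^-1) * (y j - (y j)^-1)
             * (U (iota j) + V j)^-1)); last first.
    by move=> j _; apply: flip_odd; [exact: x0|exact: y0|exact: xy_neq0|exact: xy1_neq0].
  have PE : \prod_j (x (iota j) - (x (iota j))^-1) = \prod_i (x i - (x i)^-1).
    by rewrite [RHS](reindex iota) //; apply: onW_bij.
  rewrite big_split big_split /= -Mdiag PE 2!mulrA.
  rewrite (@JW_eperm _ _ _ _ M _ he he_inj) // => w.
  rewrite !rmorphM /= eperm_E !rmorph_prod; congr (_ * _ * _ * _).
  - rewrite [RHS](reindex_inj (@perm_inj _ w)); apply: eq_bigr => i _.
    by rewrite rmorphB fmorphV /= eperm_x.
  - by apply: eq_bigr => j _; rewrite rmorphB fmorphV /= eperm_y.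
  - by apply: eq_bigr => i _; rewrite /= wM.
move=> B; rewrite rmorphM /= dflip_E rmorph_prod; congr (_ * _).
apply: eq_bigr => j _.
rewrite rmorphM rmorphM fmorphV fmorphV rmorphD rmorph1 rmorphM fmorphV !rmorphXn /=.
by rewrite dflip_x dflip_y; case: ifP.
Qed.

End CoreIdentities.

(** * Both sides of the gl identity as determinants *)

Section CoreLinear.

Variables (m n : nat) (g : superType) (r s : nat).
Local Notation K := (charField m n).
Variables (he : 'I_r -> 'I_m) (hd : 'I_s -> 'I_n).
Hypotheses (he_inj : injective he) (hd_inj : injective hd).
Let x (i : 'I_r) : K := xe n (he i).
Let y (j : 'I_s) : K := xd m (hd j).
Let X i := x i ^+ 2.
Let Y j := y j ^+ 2.

Lemma XY_neq0 i j : X j + Y i != 0. Proof. exact: xy_neq0. Qed.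

Lemma det_powers (F : fieldType) (k : nat) (u : 'I_k -> F) :
  \det (\matrix_(i, j) u j ^+ i) = vdm u.
Proof.
rewrite (_ : \matrix_(i, j) _ = Vandermonde k (\row_j u j)).
  rewrite det_Vandermonde; apply: eq_bigr => i _; apply: eq_bigr => j _.
  by rewrite !mxE.
by apply/matrixP => i j; rewrite !mxE.
Qed.

Variable G : K.
Hypothesis G_eperm : forall w, wfrac (eperm n he_inj w) G = G.
Hypothesis G_dperm : forall w, wfrac (dperm m hd_inj w) G = G.

(** The Cauchy denominator is symmetric in the eps and in the del separately, so the two staircases
    become ordinary Vandermonde determinants, in the X_i and in the 1/Y_j. *)
Lemma JW_gl_euler :
  (s`! * r`!)%:R
    * JW g (G * (\prod_i X i ^+ i) * (\prod_j (Y j)^-1 ^+ j) / cauchy_den X Y)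
  = JW g (G * (vdm X * vdm (fun j => (Y j)^-1) / cauchy_den X Y)).
Proof.
rewrite mulnC natrM -mulrA.
set d := cauchy_den X Y; set Q := \prod_i _.
have dE w : wfrac (dperm m hd_inj w) d = d.
  rewrite /d /cauchy_den rmorph_prod [RHS](reindex_inj (@perm_inj _ w)).
  apply: eq_bigr => j _; rewrite rmorph_prod; apply: eq_bigr => i _.
  by rewrite rmorphD /X /Y !rmorphXn /= dperm_x dperm_y.
have eE w : wfrac (eperm n he_inj w) d = d.
  rewrite /d /cauchy_den rmorph_prod; apply: eq_bigr => j _.
  rewrite rmorph_prod [RHS](reindex_inj (@perm_inj _ w)); apply: eq_bigr => i _.
  by rewrite rmorphD /X /Y !rmorphXn /= eperm_x eperm_y.
pose N : 'M[K]_s := \matrix_(i, j) (Y j)^-1 ^+ i.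
rewrite (eq_bigr (fun i => N i i)) => [|i _]; last by rewrite mxE.
rewrite [_ / d]mulrAC (@JW_dperm _ _ _ _ N _ hd hd_inj) => [|w]; last first.
  rewrite rmorphM rmorphM rmorphM /= fmorphV /= G_dperm dE !rmorph_prod.
  congr (_ * _ / _ * _); apply: eq_bigr => i _.
    by rewrite /X !rmorphXn /= dperm_x.
  by rewrite !mxE rmorphXn fmorphV /Y rmorphXn /= dperm_y.
rewrite det_powers.
have -> : G * Q / d * vdm (fun j => (Y j)^-1) = G * vdm (fun j => (Y j)^-1) / d * Q by ring.
pose M : 'M[K]_r := \matrix_(i, j) X j ^+ i.
rewrite /Q (eq_bigr (fun i => M i i)) => [|i _]; last by rewrite mxE.
rewrite (@JW_eperm _ _ _ _ M _ he he_inj) => [|w]; last first.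
  rewrite rmorphM rmorphM rmorphM /= fmorphV /= G_eperm eE wfrac_vdm => [|j].
    rewrite rmorph_prod; congr (_ * _); apply: eq_bigr => i _.
    by rewrite !mxE /X !rmorphXn /= eperm_x.
  by rewrite fmorphV /Y rmorphXn /= eperm_y.
by rewrite det_powers; congr (JW g _); ring.
Qed.

Lemma JW_gl_kw (iota : 'I_s -> 'I_r) (M : 'M[K]_r) :
  \prod_i M i i = \prod_j (X (iota j) + Y j)^-1 ->
  (forall w i k, wfrac (eperm n he_inj w) (M i k) = M i (w k)) ->
  r`!%:R * JW g (G * \prod_j (X (iota j) + Y j)^-1) = JW g (G * \det M).
Proof.
move=> Mdiag wM; rewrite -Mdiag (@JW_eperm _ _ _ _ M _ he he_inj) // => w.
rewrite rmorphM /= G_eperm rmorph_prod; congr (_ * _).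
by apply: eq_bigr => i _; rewrite /= wM.
Qed.

End CoreLinear.

(** * Comparison of the two sides and the constants j_s *)

Section CoreTheorems.

Variables (m n : nat).
Local Notation K := (charField m n).

(** [c] and [d] count the group elements used on the Euler and KW sides, and [e] is the factor left
    by the determinant; in characteristic 0 the quotient c/(de) is the constant sought. *)
Lemma cancel_natr (c d e k : nat) (a b f : K) : (0 < d)%N -> (0 < e)%N ->
  c%:R * a = e%:R * f -> d%:R * b = f -> c = (d * e * k)%N -> k%:R * a = b.
Proof.
move=> d0 e0 ca db cE.
have de : (d * e)%:R != 0 :> K by apply: charField_natr_neq0; rewrite muln_gt0 d0.
by apply: (mulfI de); rewrite mulrA -natrM -cE ca -db mulrA -natrM mulnC.
Qed.

(** The Euler side uses (2^s s!)^2 elements and the other side 2^s s!. The factor 2 of type D lowers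
    the exponent of 2 to s - 1. *)
Lemma core_even (s : nat) (he : 'I_s -> 'I_m) (hd : 'I_s -> 'I_n) (E : K) :
  injective he -> injective hd -> tail_free he hd E -> (0 < s)%N ->
  (2 ^ (s - 1) * s`!)%:R
    * JW OSPeven (E * (\prod_i xe n (he i) ^+ (2 * i)) * (\prod_j xd m (hd j) ^+ (2 * j.+1))
                  / den he hd)
  = JW OSPeven (E * \prod_j (1 + xe n (he j) ^+ 2 * xd m (hd j) ^- 2)^-1).
Proof.
move=> he_inj hd_inj Ef s0.
pose M : 'M[K]_s := \matrix_(i, j) (uu (xe n (he j)) + uu (xd m (hd i)))^-1.
have Mdiag : \prod_i M i i = \prod_j (uu (xe n (he (id j))) + uu (xd m (hd j)))^-1.
  by apply: eq_bigr => i _; rewrite mxE.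
have wM w i k : wfrac (eperm n he_inj w) (M i k) = M i (w k).
  by rewrite !mxE fmorphV rmorphD /= !wfrac_uu eperm_x eperm_y.
have L := JW_even_euler he_inj hd_inj Ef (g := OSPeven) erefl erefl s0 s0.
have Rk := JW_even_kw hd_inj Ef (g := OSPeven) erefl Mdiag wM.
rewrite det_cauchy in Rk; last by move=> i j; apply: UV_neq0.
apply: (cancel_natr _ _ L Rk) => //; first by rewrite muln_gt0 expn_gt0 fact_gt0.
by case: s s0 {he hd he_inj hd_inj Ef M Mdiag wM L Rk} => // s _;
  rewrite subn1 /= expnS; lia.
Qed.

(** With s + 1 eps the counts are 2^s s! 2^(s+1) (s+1)! and 2^s (s+1)!; the factor 2 of type D
    cancels the additional 2. *)
Lemma core_even_ones (s : nat) (he : 'I_s.+1 -> 'I_m) (hd : 'I_s -> 'I_n) (E : K) :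
  injective he -> injective hd -> tail_free he hd E -> (0 < s)%N ->
  (2 ^ s * s`!)%:R
    * JW OSPeven (E * (\prod_i xe n (he i) ^+ (2 * i)) * (\prod_j xd m (hd j) ^+ (2 * j.+1))
                  / den he hd)
  = JW OSPeven (E * \prod_j (1 + xe n (he (lift ord_max j)) ^+ 2 * xd m (hd j) ^- 2)^-1).
Proof.
move=> he_inj hd_inj Ef s0.
pose M : 'M[K]_s.+1 := \matrix_(i, j)
  oapp (fun k => (uu (xe n (he j)) + uu (xd m (hd k)))^-1) 1 (unlift ord_max i).
have Mdiag : \prod_i M i i
    = \prod_j (uu (xe n (he (lift ord_max j))) + uu (xd m (hd j)))^-1.
  rewrite big_ord_recr /= mxE unlift_none mulr1; apply: eq_bigr => i _.
  have -> : widen_ord (leqnSn s) i = lift ord_max i by apply: val_inj; rewrite /= /bump leqNgt ltn_ord.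
  by rewrite mxE liftK.
have wM w i k : wfrac (eperm n he_inj w) (M i k) = M i (w k).
  rewrite !mxE; case: (unlift _ _) => [j|] /=; last by rewrite rmorph1.
  by rewrite fmorphV rmorphD /= !wfrac_uu eperm_x eperm_y.
have L := JW_even_euler he_inj hd_inj Ef (g := OSPeven) erefl erefl isT s0.
have Rk := JW_even_kw hd_inj Ef (g := OSPeven) erefl Mdiag wM.
rewrite det_cauchy_ones in Rk; last by move=> i j; apply: UV_neq0.
apply: (cancel_natr _ _ L Rk) => //; first by rewrite muln_gt0 expn_gt0 fact_gt0.
by rewrite expnS; lia.
Qed.

Lemma core_odd (s : nat) (he : 'I_s -> 'I_m) (hd : 'I_s -> 'I_n) (E : K) :
  injective he -> injective hd -> tail_free he hd E -> (0 < s)%N ->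
  (2 ^ s * s`!)%:R
    * JW OSPodd (E * (\prod_i xe n (he i) ^+ (2 * i).+1) * (\prod_j xd m (hd j) ^+ (2 * j.+1))
                 / ((\prod_j (xd m (hd j) + (xd m (hd j))^-1)) * den he hd))
  = JW OSPodd (E * \prod_j ((xe n (he j))^-1 * xd m (hd j)
                            / (1 + xd m (hd j) ^+ 2 * xe n (he j) ^- 2))).
Proof.
move=> he_inj hd_inj Ef s0.
pose M : 'M[K]_s := \matrix_(i, j) (uu (xe n (he j)) + uu (xd m (hd i)))^-1.
have Mdiag : \prod_i M i i = \prod_j (uu (xe n (he (id j))) + uu (xd m (hd j)))^-1.
  by apply: eq_bigr => i _; rewrite mxE.
have wM w i k : wfrac (eperm n he_inj w) (M i k) = M i (w k).
  by rewrite !mxE fmorphV rmorphD /= !wfrac_uu eperm_x eperm_y.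
have L := JW_odd_euler he_inj hd_inj Ef (g := OSPodd) erefl erefl s0 s0.
have id_bij : bijective (@id 'I_s) by exists id.
have Rk := JW_odd_kw hd_inj Ef (g := OSPodd) erefl id_bij Mdiag wM.
rewrite det_cauchy in Rk; last by move=> i j; apply: UV_neq0.
have L1 := etrans L (esym (mul1r _)).
apply: (cancel_natr (e := 1) _ _ L1 Rk) => //; first by rewrite muln_gt0 expn_gt0 fact_gt0.
by rewrite muln1.
Qed.

(** The counts s!^2 and s! leave s!. Passing from the 1/Y_j to the Y_j by [vdm_inv] gives the sign
    and the powers Y_j^-(s-1), which the weight rho_L accounts for. *)
Lemma core_gl (s : nat) (he : 'I_s -> 'I_m) (hd : 'I_s -> 'I_n)
    (he_inj : injective he) (hd_inj : injective hd) (G : K) :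
  (forall w, wfrac (eperm n he_inj w) G = G) ->
  (forall w, wfrac (dperm m hd_inj w) G = G) ->
  ((-1) ^+ (s %/ 2) * (s`!)%:Z)%:~R
    * JW GL (G * (\prod_i (xe n (he i) ^+ 2) ^+ i) * (\prod_j (xd m (hd j) ^- 2) ^+ j)
             / cauchy_den (fun i => xe n (he i) ^+ 2) (fun j => xd m (hd j) ^+ 2))
  = JW GL (G * (\prod_j (xd m (hd j) ^+ 2) ^- s.-1)
           * \prod_j (xe n (he j) ^+ 2 + xd m (hd j) ^+ 2)^-1).
Proof.
move=> Ge Gd.
have GYe w : wfrac (eperm n he_inj w) (G * (\prod_j (xd m (hd j) ^+ 2) ^- s.-1))
    = G * (\prod_j (xd m (hd j) ^+ 2) ^- s.-1).
  rewrite rmorphM /= Ge rmorph_prod; congr (_ * _); apply: eq_bigr => j _.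
  by rewrite fmorphV !rmorphXn /= eperm_y.
pose M : 'M[K]_s := \matrix_(i, j) (xe n (he j) ^+ 2 + xd m (hd i) ^+ 2)^-1.
have Mdiag : \prod_i M i i = \prod_j (xe n (he (id j)) ^+ 2 + xd m (hd j) ^+ 2)^-1.
  by apply: eq_bigr => i _; rewrite mxE.
have wM w i k : wfrac (eperm n he_inj w) (M i k) = M i (w k).
  by rewrite !mxE fmorphV rmorphD !rmorphXn /= eperm_x eperm_y.
have L := JW_gl_euler GL Ge Gd.
have Rk := JW_gl_kw GL GYe Mdiag wM.
rewrite det_cauchy in Rk; last by move=> i j; apply: XY_neq0.
have s0 : s`!%:R != 0 :> K by apply: charField_natr_neq0; apply: fact_gt0.
apply: (mulfI s0); rewrite [RHS]Rk.
rewrite vdm_inv in L; last by move=> i; rewrite expf_neq0 ?xd_neq0.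
have -> : ((-1) ^+ (s %/ 2) * (s`!)%:Z)%:~R = (-1) ^+ (s %/ 2) * s`!%:R :> K.
  by rewrite rmorphM /= rmorphXn rmorphN1.
set a := JW GL _ in L *.
have -> : s`!%:R * ((-1) ^+ (s %/ 2) * s`!%:R * a) = (-1) ^+ (s %/ 2) * ((s`! * s`!)%:R * a).
  by rewrite natrM; ring.
rewrite L.
rewrite -JWZ; last by move=> w; rewrite rmorph_sign.
congr (JW GL _).
set S := (-1) ^+ _.
have SS : S * S = 1 by rewrite -expr2 sqrr_sign.
set v := vdm _; set v' := vdm _; set P := \prod_j _; set d := cauchy_den _ _.
have -> : S * (G * (v * (S * v' * P) / d)) = (S * S) * (G * (v * (v' * P) / d)) by ring.
by rewrite SS mul1r; ring.
Qed.

End CoreTheorems.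

(** * Positive roots and Weyl vectors *)

Section WordOrder.

Fixpoint widx (w : seq letter) (i j : nat) : seq (bool * nat) :=
  match w with
  | [::] => [::]
  | Leps :: w' => (true, i) :: widx w' i.+1 j
  | Ldel :: w' => (false, j) :: widx w' i j.+1
  end.

Lemma word_coords_widx w a b i j :
  word_coords w (drop i a) (drop j b)
    = [seq nth 0 (if p.1 then a else b) p.2 | p <- widx w i j].
Proof.
have headE (s : seq rat) k : head 0 (drop k s) = nth 0 s k.
  by rewrite -nth0 nth_drop addn0.
have beheadE (s : seq rat) k : behead (drop k s) = drop k.+1 s.
  by rewrite -drop1 drop_drop add1n.
by elim: w i j => [//|[] w IH] i j /=; rewrite beheadE IH headE.
Qed.

Lemma mem_widx w i j p : (p \in widx w i j)
  = if p.1 then (i <= p.2 < i + num_eps w)%N else (j <= p.2 < j + num_del w)%N.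
Proof.
case: p => b k; elim: w i j => [|l w IH] i j /=.
  by rewrite in_nil /num_eps /num_del /= !addn0; case: b; lia.
by case: l; rewrite in_cons IH /num_eps /num_del /= xpair_eqE;
  case: b {IH}; rewrite /= ?addnS ?add0n ?add1n; lia.
Qed.

Variable key : bool * nat -> nat.

(** The successor makes [c] a non-strict lower bound of the keys, so that consecutive pieces of the
    word can be glued. *)
Definition key_path c w i j := path ltn c [seq (key p).+1 | p <- widx w i j].

Lemma key_pathW c c' w i j : (c' <= c)%N -> key_path c w i j -> key_path c' w i j.
Proof.
rewrite /key_path; case: (map _ _) => //= a s cc /andP[ca ->].
by rewrite andbT (leq_ltn_trans cc).
Qed.

Lemma key_path_eps (cE : nat -> nat) k v i j :
  (forall i, cE i <= key (true, i) < cE i.+1)%N ->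
  key_path (cE (i + k)%N) v (i + k) j -> key_path (cE i) (wpow k [:: Leps] ++ v) i j.
Proof.
move=> cEP; elim: k i => [|k IH] i; first by rewrite addn0.
rewrite addnS -addSn => /IH P; have /andP[c1 c2] := cEP i.
rewrite /key_path /= ltnS c1; exact: key_pathW P.
Qed.

Lemma key_path_del (cD : nat -> nat) k v i j :
  (forall j, cD j <= key (false, j) < cD j.+1)%N ->
  key_path (cD (j + k)%N) v i (j + k) -> key_path (cD j) (wpow k [:: Ldel] ++ v) i j.
Proof.
move=> cDP; elim: k j => [|k IH] j; first by rewrite addn0.
rewrite addnS -addSn => /IH P; have /andP[c1 c2] := cDP j.
rewrite /key_path /= ltnS c1; exact: key_pathW P.
Qed.

Lemma key_path_pairs l1 l2 (c : nat -> nat) k i j :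
  (l1 = Leps /\ l2 = Ldel \/ l1 = Ldel /\ l2 = Leps) ->
  (forall t, c t <= key (if l1 is Leps then (true, i + t)%N else (false, j + t)%N)
             < key (if l1 is Leps then (false, j + t)%N else (true, i + t)%N)
             /\ key (if l1 is Leps then (false, j + t)%N else (true, i + t)%N) < c t.+1)%N ->
  key_path (c 0%N) (wpow k [:: l1; l2]) i j.
Proof.
move=> l12 H.
suff Ht t : key_path (c t) (wpow k [:: l1; l2]) (i + t) (j + t).
  by have := Ht 0%N; rewrite !addn0.
elim: k t => [|k IH] t //.
have [/andP[H1 H2] H3] := H t; have := key_pathW H3 (IH t.+1).
by case: l12 H1 H2 => -[-> ->] /= H1 H2; rewrite !addnS /key_path /= !ltnS H1 H2.
Qed.

Lemma head_nonzero_min (f : bool * nat -> rat) l c q :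
  path ltn c [seq (key p).+1 | p <- l] -> q \in l -> f q != 0 ->
  (forall p, p \in l -> (key p < key q)%N -> f p = 0) ->
  head 0 [seq x <- map f l | x != 0] = f q.
Proof.
elim: l c => [//|p l IH] c /= /andP[cp pl]; rewrite in_cons => /orP[/eqP->|ql] fq Hm.
  by rewrite fq.
have pq : (key p < key q)%N.
  rewrite (path_sortedE ltn_trans) in pl; case/andP: pl => /allP + _.
  by move=> /(_ (key q).+1); apply; apply: map_f ql.
rewrite (Hm p (mem_head _ _) pq) eqxx.
by apply: IH pl ql fq _ => p' p'l; apply: Hm; rewrite in_cons p'l orbT.
Qed.

End WordOrder.

Section Positivity.

Variables (g : superType) (m n : nat).
Implicit Types (alpha : weight m n) (p q : bool * nat).

(* The pairs [(true, i)] and [(false, j)] stand for eps_(i+1) and del_(j+1);  *)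
(* [key] increases along the word [Sigma].                                   *)
Definition key p : nat :=
  match g with
  | GL => if p.1 then p.2 else (m + p.2)%N
  | OSPeven => if p.1 then ((p.2 + n).*2).+1 else (p.2 + m).*2
  | OSPodd => if p.1 then (p.2 + n).*2 else ((p.2 + m).*2).+1
  end.

Definition valid p : bool := (p.2 < if p.1 then m else n)%N.

Definition coord alpha p : rat :=
  nth 0 (if p.1 then [seq lsubmx alpha 0 i | i <- enum 'I_m]
         else [seq rsubmx alpha 0 j | j <- enum 'I_n]) p.2.

Lemma num_Sigma : num_eps (Sigma g m n) = m /\ num_del (Sigma g m n) = n.
Proof.
rewrite /Sigma; case: g; try case: leqP => mn;
  by rewrite num_eps_cat num_del_cat !(num_wpow _ _).1 !(num_wpow _ _).2;
    rewrite /num_eps /num_del /= ?muln0 ?muln1; lia.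
Qed.

Lemma mem_widx_Sigma p : (p \in widx (Sigma g m n) 0 0) = valid p.
Proof.
by rewrite mem_widx num_Sigma.1 num_Sigma.2 /valid; case: p => -[].
Qed.

(** For osp the same formula covers m <= n and n < m: the interleaved letters get consecutive keys,
    and the initial block of equal letters continues backwards with keys of one parity. *)
Lemma key_path_Sigma : exists c, key_path key c (Sigma g m n) 0 0.
Proof.
rewrite /Sigma /key; case: g.
- exists 0%N; apply: (key_path_eps (cE := id)) => /= [i|]; first by rewrite leqnn ltnSn.
  have P : key_path (fun p => if p.1 then p.2 else (m + p.2)%N) (m + 0)
             (wpow n [:: Ldel] ++ [::]) m 0.
    by apply: (key_path_del (cD := addn m)) => //= j; lia.
  by move: P; rewrite addn0 cats0.
- case: leqP => mn.
    exists (0 + m).*2; apply: (key_path_del (cD := fun j => (j + m).*2)) => /= [j|]; first by lia.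
    apply: (key_path_pairs (c := fun t => (t + (0 + (n - m) + m)).*2)); first by right.
    by move=> t /=; lia.
  exists (0 + n).*2; apply: (key_path_eps (cE := fun i => (i + n).*2)) => /= [i|]; first by lia.
  apply: (@key_path_pairs _ _ _ (fun t => (t + (0 + (m - n) + n)).*2)); first by right.
  by move=> t /=; lia.
- case: leqP => mn.
    exists (0 + m).*2; apply: (key_path_del (cD := fun j => (j + m).*2)) => /= [j|]; first by lia.
    apply: (key_path_pairs (c := fun t => (t + (0 + (n - m) + m)).*2)); first by left.
    by move=> t /=; lia.
  exists (0 + n).*2; apply: (key_path_eps (cE := fun i => (i + n).*2)) => /= [i|]; first by lia.
  apply: (@key_path_pairs _ _ _ (fun t => (t + (0 + (m - n) + n)).*2)); first by left.
  by move=> t /=; lia.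
Qed.

Lemma positive_lead alpha q : valid q -> coord alpha q != 0 ->
  (forall p, valid p -> (key p < key q)%N -> coord alpha p = 0) ->
  positive (Sigma g m n) alpha = (0 < coord alpha q).
Proof.
move=> vq aq aP; have [c cP] := key_path_Sigma.
rewrite /positive -[X in word_coords _ X]drop0 -[X in word_coords _ _ X]drop0.
rewrite word_coords_widx; congr (0 < _).
apply: (@head_nonzero_min key (coord alpha) _ c q cP) => //.
  by rewrite mem_widx_Sigma.
by move=> p; rewrite mem_widx_Sigma; apply: aP.
Qed.

Lemma coordE (i : 'I_m) alpha : coord alpha (true, i : nat) = lsubmx alpha 0 i.
Proof. by rewrite /coord /= (nth_map i) ?nth_ord_enum // size_enum_ord. Qed.

Lemma coordD (j : 'I_n) alpha : coord alpha (false, j : nat) = rsubmx alpha 0 j.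
Proof. by rewrite /coord /= (nth_map j) ?nth_ord_enum // size_enum_ord. Qed.

Definition bvec p : weight m n := if p.1 then eps m n p.2.+1 else del m n p.2.+1.

Lemma coord_comb p q r (a b : rat) : valid r ->
  coord (a *: bvec p + b *: bvec q) r = a * (r == p)%:R + b * (r == q)%:R.
Proof.
case: r => -[] k; rewrite /valid /= => kl.
  rewrite (coordE (Ordinal kl)) /bvec !mxE.
  rewrite -/(lshift n _) /eps /del; case: p q => -[] p [[] q] /=;
  by rewrite ?row_mxEl !mxE /= ?eqSS ?xpair_eqE.
rewrite (coordD (Ordinal kl)) /bvec !mxE.
rewrite -/(rshift m _) /eps /del; case: p q => -[] p [[] q] /=;
by rewrite ?row_mxEr !mxE /= ?eqSS ?xpair_eqE.
Qed.

Lemma positive_comb p q (a b : rat) : valid p -> (key p < key q)%N -> a != 0 ->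
  positive (Sigma g m n) (a *: bvec p + b *: bvec q) = (0 < a).
Proof.
move=> vp pq a0.
have pq' : (p == q) = false by apply: contraTF pq => /eqP->; rewrite ltnn.
have E : coord (a *: bvec p + b *: bvec q) p = a.
  by rewrite coord_comb // eqxx pq' mulr1 mulr0 addr0.
rewrite (positive_lead vp) ?E // => r vr rp; rewrite coord_comb //.
have -> : (r == p) = false by apply: contraTF rp => /eqP->; rewrite ltnn.
have -> : (r == q) = false by apply: contraTF (ltn_trans rp pq) => /eqP->; rewrite ltnn.
by rewrite !mulr0 addr0.
Qed.

Lemma positive_bvec p (a : rat) : valid p -> a != 0 ->
  positive (Sigma g m n) (a *: bvec p) = (0 < a).
Proof.
move=> vp a0; have E : a *: bvec p = a *: bvec p + 0 *: bvec p by rewrite scale0r addr0.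
have E2 : coord (a *: bvec p) p = a by rewrite E coord_comb // eqxx mulr1 mul0r addr0.
rewrite (positive_lead vp) ?E2 // => r vr rp; rewrite E coord_comb //.
have -> : (r == p) = false by apply: contraTF rp => /eqP->; rewrite ltnn.
by rewrite !mulr0 addr0.
Qed.

Lemma key_inj_valid p q : valid p -> valid q -> key p = key q -> p = q.
Proof.
rewrite /valid /key; case: p q => -[] i [[] j] /= vi vj; case: g => H; congr (_, _); lia.
Qed.

(** The sum of the two letters is always positive; for their difference, the letter that comes first
    in [Sigma] decides. *)
Lemma filter_pm p q : valid p -> valid q -> p != q ->
  [seq a <- pm (bvec p) (bvec q) | positive (Sigma g m n) a]
    = [:: bvec p + bvec q; if (key p < key q)%N then bvec p - bvec q else - bvec p + bvec q].
Proof.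
move=> vp vq pq; set u := bvec p; set v := bvec q.
have N1 : - 1 != 0 :> rat by rewrite oppr_eq0 oner_eq0.
have P1 : 1 != 0 :> rat by rewrite oner_eq0.
rewrite /pm /=; case: ltngtP => kpq.
- have := positive_comb (1) vp kpq P1; rewrite !scale1r => ->.
  have := positive_comb (- 1) vp kpq P1; rewrite scaleN1r scale1r => ->.
  have := positive_comb (1) vp kpq N1; rewrite scaleN1r scale1r => ->.
  have := positive_comb (- 1) vp kpq N1; rewrite !scaleN1r => ->.
  by [].
- have := positive_comb (1) vq kpq P1; rewrite !scale1r addrC => ->.
  have := positive_comb (1) vq kpq N1; rewrite scaleN1r scale1r addrC => ->.
  have := positive_comb (- 1) vq kpq P1; rewrite scaleN1r scale1r addrC => ->.
  have := positive_comb (- 1) vq kpq N1; rewrite !scaleN1r addrC => ->.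
  by [].
by move: pq; rewrite (key_inj_valid vp vq kpq) eqxx.
Qed.

End Positivity.

(** * Products and sums over the positive roots *)

Section RootEnumeration.

Variables (m n : nat).

Lemma big_pairs (T : Type) (idx : T) (op : Monoid.com_law idx) k l (P : pred (nat * nat)) F :
  \big[op/idx]_(p <- pairs k l | P p) F p
    = \big[op/idx]_(i < k) \big[op/idx]_(j < l | P (i.+1, j.+1)) F (i.+1, j.+1).
Proof.
have iotaE (d : nat) : iota 1 d = map S (index_iota 0 d).
  by rewrite /index_iota subn0 -[1%N]/(1 + 0)%N iotaDl.
rewrite /pairs !iotaE big_mkcond /= big_allpairs big_map big_mkord.
apply: eq_bigr => i _; rewrite big_map big_mkord [RHS]big_mkcond.
by [].
Qed.

Lemma big_iota1 (T : Type) (idx : T) (op : Monoid.com_law idx) k F :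
  \big[op/idx]_(j <- iota 1 k) F j = \big[op/idx]_(j < k) F j.+1.
Proof.
rewrite -[1%N]/(1 + 0)%N iotaDl big_map -[X in iota _ X]subn0 -/(index_iota 0 k).
by rewrite big_mkord.
Qed.

Lemma valid_eps (i : 'I_m) : valid m n (true, i : nat). Proof. exact: ltn_ord. Qed.
Lemma valid_del (j : 'I_n) : valid m n (false, j : nat). Proof. exact: ltn_ord. Qed.

Lemma filter_pm_eps_del g (i : 'I_m) (j : 'I_n) :
  [seq a <- pm (eps m n i.+1) (del m n j.+1) | positive (Sigma g m n) a]
    = [:: eps m n i.+1 + del m n j.+1;
          if (key g m n (true, i : nat) < key g m n (false, j : nat))%N
          then eps m n i.+1 - del m n j.+1 else - eps m n i.+1 + del m n j.+1].
Proof. exact: (@filter_pm g m n _ _ (valid_eps i) (valid_del j) isT). Qed.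

Lemma filter_pm_eps g (i k : 'I_m) : (i < k)%N ->
  [seq a <- pm (eps m n i.+1) (eps m n k.+1) | positive (Sigma g m n) a]
    = [:: eps m n i.+1 + eps m n k.+1; eps m n i.+1 - eps m n k.+1].
Proof.
move=> ik; have := @filter_pm g m n _ _ (valid_eps i) (valid_eps k).
rewrite xpair_eqE eqxx /= neq_ltn ik => ->//.
by rewrite ifT // /key; case: g => //=; lia.
Qed.

Lemma filter_pm_del g (j k : 'I_n) : (j < k)%N ->
  [seq a <- pm (del m n j.+1) (del m n k.+1) | positive (Sigma g m n) a]
    = [:: del m n j.+1 + del m n k.+1; del m n j.+1 - del m n k.+1].
Proof.
move=> jk; have := @filter_pm g m n _ _ (valid_del j) (valid_del k).
rewrite xpair_eqE eqxx /= neq_ltn jk => ->//.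
by rewrite ifT // /key; case: g => //=; lia.
Qed.

Lemma filter_double g (p : bool * nat) a : valid m n p -> 0 < a ->
  [seq b <- [:: a *: bvec m n p; - (a *: bvec m n p)] | positive (Sigma g m n) b]
    = [:: a *: bvec m n p].
Proof.
move=> vp a0; rewrite /= -scaleNr !positive_bvec // ?oppr_eq0 ?gt_eqF //.
by rewrite a0 oppr_gt0 lt_gtF.
Qed.

Lemma filter_del g (j : 'I_n) :
  [seq b <- [:: del m n j.+1; - del m n j.+1] | positive (Sigma g m n) b] = [:: del m n j.+1].
Proof. by have := @filter_double g _ 1 (valid_del j) isT; rewrite scale1r. Qed.

Lemma filter_eps g (i : 'I_m) :
  [seq b <- [:: eps m n i.+1; - eps m n i.+1] | positive (Sigma g m n) b] = [:: eps m n i.+1].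
Proof. by have := @filter_double g _ 1 (valid_eps i) isT; rewrite scale1r. Qed.

Lemma filter_del2 g (j : 'I_n) :
  [seq b <- [:: del m n j.+1 *+ 2; - (del m n j.+1 *+ 2)] | positive (Sigma g m n) b]
    = [:: del m n j.+1 *+ 2].
Proof. by have := @filter_double g _ 2 (valid_del j) isT; rewrite scaler_nat. Qed.

Section Big.

Variables (T : Type) (idx : T) (op : Monoid.com_law idx) (F : weight m n -> T).

(** The condition on i and j compares keys. In case of a tie i + n = j + m the del comes first here,
    whereas the eps does in [big_odd_pos_odd]. *)
Lemma big_odd_pos_even :
  \big[op/idx]_(a <- odd_pos OSPeven m n) F a
    = \big[op/idx]_(i < m) \big[op/idx]_(j < n)
        op (F (eps m n i.+1 + del m n j.+1))
           (F (if (i + n < j + m)%N then eps m n i.+1 - del m n j.+1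
               else - eps m n i.+1 + del m n j.+1)).
Proof.
rewrite /odd_pos filter_flatten big_flatten -map_comp big_map big_pairs.
apply: eq_bigr => i _; apply: eq_bigr => j _; rewrite /comp.
rewrite filter_pm_eps_del 2!big_cons big_nil Monoid.mulm1.
by rewrite (_ : (key _ _ _ _ < _)%N = (i + n < j + m)%N) // /key /=; lia.
Qed.

Lemma big_odd_pos_odd :
  \big[op/idx]_(a <- odd_pos OSPodd m n) F a
    = op (\big[op/idx]_(i < m) \big[op/idx]_(j < n)
        op (F (eps m n i.+1 + del m n j.+1))
           (F (if (i + n <= j + m)%N then eps m n i.+1 - del m n j.+1
               else - eps m n i.+1 + del m n j.+1)))
      (\big[op/idx]_(j < n) F (del m n j.+1)).
Proof.
rewrite /odd_pos filter_cat big_cat; congr (op _ _).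
  rewrite filter_flatten big_flatten -map_comp big_map big_pairs.
  apply: eq_bigr => i _; apply: eq_bigr => j _; rewrite /comp.
  rewrite filter_pm_eps_del 2!big_cons big_nil Monoid.mulm1.
  by rewrite (_ : (key _ _ _ _ < _)%N = (i + n <= j + m)%N) // /key /=; lia.
rewrite filter_flatten big_flatten -map_comp big_map big_iota1.
by apply: eq_bigr => j _; rewrite /comp filter_del big_cons big_nil Monoid.mulm1.
Qed.

Lemma big_odd_pos_gl :
  \big[op/idx]_(a <- odd_pos GL m n) F a
    = \big[op/idx]_(i < m) \big[op/idx]_(j < n) F (eps m n i.+1 - del m n j.+1).
Proof.
rewrite /odd_pos filter_flatten big_flatten -map_comp big_map big_pairs.
apply: eq_bigr => i _; apply: eq_bigr => j _.
have k : (key GL m n (true, i : nat) < key GL m n (false, j : nat))%N.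
  by rewrite /key /=; have := ltn_ord i; lia.
have := @positive_comb GL m n _ _ 1 (- 1) (valid_eps i) k (oner_neq0 _).
have := @positive_comb GL m n _ _ (- 1) 1 (valid_eps i) k.
rewrite oppr_eq0 oner_eq0 !scaleN1r !scale1r /bvec /= addrC => -> // ->.
by rewrite big_cons big_nil Monoid.mulm1.
Qed.

End Big.

Lemma sum_even_pos_even :
  \sum_(a <- even_pos OSPeven m n) a
    = \sum_(i < m) \sum_(k < m | (i < k)%N) eps m n i.+1 *+ 2
    + \sum_(j < n) \sum_(k < n | (j < k)%N) del m n j.+1 *+ 2
    + \sum_(j < n) del m n j.+1 *+ 2.
Proof.
rewrite /even_pos !filter_cat !big_cat -[RHS]addrA; congr (_ + (_ + _)).
- rewrite filter_flatten big_flatten -map_comp big_map big_filter big_pairs.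
  apply: eq_bigr => i _; apply: eq_big => [k|k ik]; first by rewrite /= ltnS.
  rewrite /comp (filter_pm_eps _ (ik : (i < k)%N)) 2!big_cons big_nil /= addr0.
  by rewrite addrACA subrr addr0 mulr2n.
- rewrite filter_flatten big_flatten -map_comp big_map big_filter big_pairs.
  apply: eq_bigr => i _; apply: eq_big => [k|k ik]; first by rewrite /= ltnS.
  rewrite /comp (filter_pm_del _ (ik : (i < k)%N)) 2!big_cons big_nil /= addr0.
  by rewrite addrACA subrr addr0 mulr2n.
rewrite filter_flatten big_flatten -map_comp big_map big_iota1.
by apply: eq_bigr => j _; rewrite /comp filter_del2 big_cons big_nil /= addr0.
Qed.

Lemma sum_even_pos_odd :
  \sum_(a <- even_pos OSPodd m n) a
    = \sum_(i < m) \sum_(k < m | (i < k)%N) eps m n i.+1 *+ 2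
    + \sum_(i < m) eps m n i.+1
    + \sum_(j < n) \sum_(k < n | (j < k)%N) del m n j.+1 *+ 2
    + \sum_(j < n) del m n j.+1 *+ 2.
Proof.
rewrite /even_pos !filter_cat !big_cat -2![RHS]addrA; congr (_ + (_ + (_ + _))).
- rewrite filter_flatten big_flatten -map_comp big_map big_filter big_pairs.
  apply: eq_bigr => i _; apply: eq_big => [k|k ik]; first by rewrite /= ltnS.
  rewrite /comp (filter_pm_eps _ (ik : (i < k)%N)) 2!big_cons big_nil /= addr0.
  by rewrite addrACA subrr addr0 mulr2n.
- rewrite filter_flatten big_flatten -map_comp big_map big_iota1.
  by apply: eq_bigr => j _; rewrite /comp filter_eps big_cons big_nil /= addr0.
- rewrite filter_flatten big_flatten -map_comp big_map big_filter big_pairs.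
  apply: eq_bigr => i _; apply: eq_big => [k|k ik]; first by rewrite /= ltnS.
  rewrite /comp (filter_pm_del _ (ik : (i < k)%N)) 2!big_cons big_nil /= addr0.
  by rewrite addrACA subrr addr0 mulr2n.
rewrite filter_flatten big_flatten -map_comp big_map big_iota1.
by apply: eq_bigr => j _; rewrite /comp filter_del2 big_cons big_nil /= addr0.
Qed.

End RootEnumeration.

(** * The coordinates of rho *)

Section RhoCoordinates.

Variables (m n : nat).

Lemma eps_lshift k (i : 'I_m) : eps m n k.+1 0 (lshift n i) = (i == k :> nat)%:R.
Proof. by rewrite /eps row_mxEl mxE eqSS. Qed.

Lemma eps_rshift k (j : 'I_n) : eps m n k 0 (rshift m j) = 0.
Proof. by rewrite /eps row_mxEr mxE. Qed.

Lemma del_lshift k (i : 'I_m) : del m n k 0 (lshift n i) = 0.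
Proof. by rewrite /del row_mxEl mxE. Qed.

Lemma del_rshift k (j : 'I_n) : del m n k.+1 0 (rshift m j) = (j == k :> nat)%:R.
Proof. by rewrite /del row_mxEr mxE eqSS. Qed.

Lemma sum_eps_lshift (f : 'I_m -> rat) i :
  (\sum_(a < m) f a *: eps m n a.+1) 0 (lshift n i) = f i.
Proof.
rewrite summxE (bigD1 i) //= mxE eps_lshift eqxx mulr1 big1 ?addr0 // => a ai.
by rewrite mxE eps_lshift eq_sym (inj_eq val_inj) (negbTE ai) mulr0.
Qed.

Lemma sum_eps_rshift (f : 'I_m -> rat) j :
  (\sum_(a < m) f a *: eps m n a.+1) 0 (rshift m j) = 0.
Proof. by rewrite summxE big1 // => a _; rewrite mxE eps_rshift mulr0. Qed.

Lemma sum_del_rshift (f : 'I_n -> rat) j :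
  (\sum_(b < n) f b *: del m n b.+1) 0 (rshift m j) = f j.
Proof.
rewrite summxE (bigD1 j) //= mxE del_rshift eqxx mulr1 big1 ?addr0 // => b bj.
by rewrite mxE del_rshift eq_sym (inj_eq val_inj) (negbTE bj) mulr0.
Qed.

Lemma sum_del_lshift (f : 'I_n -> rat) i :
  (\sum_(b < n) f b *: del m n b.+1) 0 (lshift n i) = 0.
Proof. by rewrite summxE big1 // => b _; rewrite mxE del_lshift mulr0. Qed.

Lemma sum_const_geq (V : lmodType rat) (k a : nat) (v : V) :
  \sum_(j < k | (a <= j)%N) v = (k - a)%:R *: v.
Proof.
rewrite -(big_geq_mkord a k xpredT (fun=> v)) big_const_nat iter_addr_0.
by rewrite scaler_nat.
Qed.

Lemma sum_gt_double (k : nat) (v : 'I_k -> weight m n) :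
  \sum_(a < k) \sum_(b < k | (a < b)%N) v a *+ 2
    = \sum_(a < k) ((k - a.+1)%:R * 2) *: v a.
Proof.
apply: eq_bigr => a _; rewrite (sum_const_geq k a.+1 (v a *+ 2)).
by rewrite -scaler_nat scalerA.
Qed.

Lemma sum_double (k : nat) (v : 'I_k -> weight m n) :
  \sum_(a < k) v a *+ 2 = \sum_(a < k) 2 *: v a.
Proof. by apply: eq_bigr => a _; rewrite scaler_nat. Qed.

Lemma sum_scale1 (k : nat) (v : 'I_k -> weight m n) : \sum_(a < k) v a = \sum_(a < k) 1 *: v a.
Proof. by apply: eq_bigr => a _; rewrite scale1r. Qed.

(* [c] and its complement describe which of the letters eps_i, del_j comes   *)
(* first.                                                                    *)
Lemma sum_odd_pairs (c : 'I_m -> 'I_n -> bool) (f : 'I_m -> nat) (h : 'I_n -> nat) :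
  (forall i j, c i j = (f i <= j)%N) -> (forall i j, ~~ c i j = (h j <= i)%N) ->
  \sum_(i < m) \sum_(j < n)
     ((eps m n i.+1 + del m n j.+1)
      + if c i j then eps m n i.+1 - del m n j.+1 else - eps m n i.+1 + del m n j.+1)
  = \sum_(i < m) ((n - f i)%:R * 2) *: eps m n i.+1
    + \sum_(j < n) ((m - h j)%:R * 2) *: del m n j.+1.
Proof.
move=> cf ch.
transitivity (\sum_(i < m) \sum_(j < n) (if c i j then eps m n i.+1 *+ 2 else 0)
    + \sum_(i < m) \sum_(j < n) (if ~~ c i j then del m n j.+1 *+ 2 else 0)).
  rewrite -big_split; apply: eq_bigr => i _; rewrite -big_split; apply: eq_bigr => j _.
  case: (c i j) => /=; first by rewrite addrACA subrr !addr0 ?mulr2n.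
  by rewrite addrACA subrr !add0r ?mulr2n.
rewrite [X in _ + X]exchange_big; congr (_ + _); apply: eq_bigr => k _ /=.
  under eq_bigr do rewrite cf.
  by rewrite -big_mkcond sum_const_geq -scaler_nat scalerA.
under eq_bigr do rewrite ch.
by rewrite -big_mkcond sum_const_geq -scaler_nat scalerA.
Qed.

(** Half-sums over even and odd roots are compared through natural numbers, so that truncated
    subtractions can be settled by integer arithmetic. *)
Lemma natr_half_sub (a b c d : nat) : (a + c = b + d)%N ->
  2^-1 * (a%:R * 2) - 2^-1 * (b%:R * 2) = d%:R - c%:R :> rat.
Proof.
move=> /(congr1 (fun k => k%:R : rat)); rewrite !natrD => E.
have -> : a%:R = b%:R + d%:R - c%:R :> rat by rewrite -E addrK.
by field.
Qed.

Lemma mulrSr_half (a : nat) : a.+1%:R * 2 = a%:R * 2 + 2 :> rat.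
Proof. by rewrite -natr1 mulrDl mul1r. Qed.

(** The truncation is meant: the coordinate is 0 throughout the interleaved part of [Sigma]. In
    [rho_even_del] likewise; in the odd case the values there are -1/2 and 1/2. *)
Lemma rho_even_eps (i : 'I_m) : rho OSPeven m n 0 (lshift n i) = (m - 1 - n - i)%:R.
Proof.
rewrite /rho sum_even_pos_even big_odd_pos_even /=.
rewrite (@sum_odd_pairs _ (fun i => (i + n).+1 - m)%N (fun j => j + m - n)%N);
  try by move=> i' j'; have := ltn_ord i'; have := ltn_ord j'; lia.
rewrite !sum_gt_double sum_double !mxE !sum_eps_lshift !sum_del_lshift !addr0.
rewrite (@natr_half_sub _ _ 0 (m - 1 - n - i)) ?subr0 //.
by have := ltn_ord i; lia.
Qed.

Lemma rho_even_del (j : 'I_n) : rho OSPeven m n 0 (rshift m j) = (n - m - j)%:R.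
Proof.
rewrite /rho sum_even_pos_even big_odd_pos_even /=.
rewrite (@sum_odd_pairs _ (fun i => (i + n).+1 - m)%N (fun j => j + m - n)%N);
  try by move=> i' j'; have := ltn_ord i'; have := ltn_ord j'; lia.
rewrite !sum_gt_double sum_double !mxE !sum_eps_rshift !sum_del_rshift !add0r.
rewrite -mulrSr_half (@natr_half_sub _ _ 0 (n - m - j)) ?subr0 //.
by have := ltn_ord j; lia.
Qed.

Lemma rho_odd_eps (i : 'I_m) :
  rho OSPodd m n 0 (lshift n i) = (m - n - i)%:R - 2^-1.
Proof.
rewrite /rho sum_even_pos_odd big_odd_pos_odd /=.
rewrite (@sum_odd_pairs _ (fun i => (i + n) - m)%N (fun j => (j + m).+1 - n)%N);
  try by move=> i' j'; have := ltn_ord i'; have := ltn_ord j'; lia.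
rewrite !sum_gt_double sum_double (sum_scale1 (fun i => eps m n i.+1))
  (sum_scale1 (fun j => del m n j.+1)) !mxE !sum_eps_lshift !sum_del_lshift !addr0.
rewrite [X in X - _]mulrDr mulr1 addrAC (@natr_half_sub _ _ 1 (m - n - i)).
  by field.
by have := ltn_ord i; lia.
Qed.

Lemma rho_odd_del (j : 'I_n) :
  rho OSPodd m n 0 (rshift m j) = (n - m - 1 - j)%:R + 2^-1.
Proof.
rewrite /rho sum_even_pos_odd big_odd_pos_odd /=.
rewrite (@sum_odd_pairs _ (fun i => (i + n) - m)%N (fun j => (j + m).+1 - n)%N);
  try by move=> i' j'; have := ltn_ord i'; have := ltn_ord j'; lia.
rewrite !sum_gt_double sum_double (sum_scale1 (fun i => eps m n i.+1))
  (sum_scale1 (fun j => del m n j.+1)) !mxE !sum_eps_rshift !sum_del_rshift !add0r.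
rewrite -mulrSr_half [X in _ - X]mulrDr opprD addrA mulr1 (@natr_half_sub _ _ 0 (n - m - 1 - j).+1).
  by rewrite -natr1; field.
by have := ltn_ord j; lia.
Qed.

Lemma rho_gl_eps (i : 'I_m) : rho GL m n 0 (lshift n i) = (m - i)%:R.
Proof.
rewrite /rho !big_add1 /= !big_mkord !mxE.
rewrite (sum_eps_lshift (fun i => (m + 1 - i.+1)%:R)).
rewrite (sum_del_lshift (fun i => i.+1%:R)) subr0; congr (_%:R); lia.
Qed.

Lemma rho_gl_del (j : 'I_n) : rho GL m n 0 (rshift m j) = - j.+1%:R.
Proof.
rewrite /rho !big_add1 /= !big_mkord !mxE.
rewrite (sum_eps_rshift (fun i => (m + 1 - i.+1)%:R)).
by rewrite (sum_del_rshift (fun i => i.+1%:R)) add0r.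
Qed.

End RhoCoordinates.

(** * Dominance of highest weights *)

Import passmx.

Section Sl2.

Variables (C : numClosedFieldType) (V : vectType C).

Lemma eigenvalues_bounded (h : 'End(V)) : exists d : nat, forall s : seq C,
  uniq s -> (forall a, a \in s -> exists2 u, u != 0 & h u = a *: u) -> (size s < d)%N.
Proof.
pose e := vbasis {:V}; have eb : basis_of {:V} e := vbasisP _.
pose M := mxof e e h.
exists (size (char_poly M)) => s us sP; apply: max_poly_roots => //.
  by rewrite monic_neq0 ?char_poly_monic.
apply/allP => a /sP[u u0 hu]; rewrite -eigenvalue_root_char.
apply/eigenvalueP; exists (rVof e u).
  by rewrite /M -rVof_app // hu linearZ.
by rewrite rVof_eq0.
Qed.

(** The vectors f^k v have distinct eigenvalues c - k t, so one of them vanishes. If f^k v is the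
    last nonzero one, applying e to f^(k+1) v = 0 gives c = k t / 2. The scale [t] is free so that
    short and long roots need no renormalisation. *)
Lemma sl2_primitive (e f h : 'End(V)) (t c : C) (v : V) :
  0 < t -> v != 0 ->
  (forall u, e (f u) = f (e u) + h u) -> (forall u, h (f u) = f (h u) - t *: f u) ->
  e v = 0 -> h v = c *: v -> 0 <= c /\ (c = 0 -> f v = 0).
Proof.
move=> t0 v0 ef hf ev hv.
pose u k := iter k f v.
have hu k : h (u k) = (c - k%:R * t) *: u k.
  elim: k => [|k IH]; first by rewrite mul0r subr0.
  rewrite /= hf -/(u k) IH linearZ -scalerBl; congr (_ *: _).
  by rewrite -natr1; ring.
have fZ k a : f (a *: u k) = a *: u k.+1 by rewrite linearZ.
have eu k : e (u k.+1) = (k.+1%:R * (c - k%:R * t / 2)) *: u k.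
  elim: k => [|k IH].
    by rewrite /= ef ev linear0 add0r hv; congr (_ *: _); rewrite mul0r mul0r subr0 mul1r.
  rewrite (ef (u k.+1) : e (u k.+2) = _) IH hu (fZ k) -scalerDl; congr (_ *: _).
  by rewrite -!natr1; field.
have [k uk] : exists k, u k == 0.
  have [d dP] := eigenvalues_bounded h.
  have [/existsP[k uk]|nu] := boolP [exists k : 'I_d, u k == 0]; first by exists k.
  have := dP [seq c - (k%:R) * t | k : nat <- iota 0 d].
  rewrite size_map size_iota ltnn => H; exfalso.
  suff : false by []; apply: H.
    rewrite map_inj_uniq ?iota_uniq // => a b /addrI/oppr_inj/(mulIf (lt0r_neq0 t0))/eqP.
    by rewrite eqr_nat => /eqP.
  move=> a /mapP[k]; rewrite mem_iota add0n => /andP[_ kd] ->.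
  exists (u k); last exact: hu.
  by move: nu; rewrite negb_exists => /forallP/(_ (Ordinal kd)).
have [k' [uk' uk0]] : exists k, u k != 0 /\ u k.+1 = 0.
  elim: k uk => [|k IH] uk; first by rewrite (negbTE v0) in uk.
  have [/IH //|uk1] := boolP (u k == 0).
  by exists k; split=> //; apply/eqP.
have /eqP := eu k'; rewrite uk0 linear0 eq_sym scaler_eq0 (negbTE uk') orbF mulf_eq0.
rewrite pnatr_eq0 /= subr_eq0 => /eqP cE; split.
  by rewrite cE divr_ge0 ?mulr_ge0 ?ler0n // ltW.
move=> c0; suff k0 : k' = 0%N by move: uk0; rewrite k0.
apply/eqP; move: cE; rewrite c0 => /esym/eqP.
by rewrite !mulf_eq0 invr_eq0 !pnatr_eq0 (gt_eqF t0) !orbF.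
Qed.

End Sl2.

Lemma sub_lfunE (K : fieldType) (U V : vectType K) (f h : 'Hom(U, V)) u :
  (f - h) u = f u - h u.
Proof. by rewrite add_lfunE opp_lfunE. Qed.

(** * Root vectors of osp and their action on a module *)

Section RootVectors.

Variables (C : numClosedFieldType) (g : superType) (m n : nat).

Local Notation I := 'I_(evdim g m + odddim g n).
Local Notation smx := 'M[C]_(evdim g m + odddim g n).

Definition parity (a : I) : bool := (evdim g m <= a)%N.

Lemma homogeneous_entries (b : bool) (X : smx) :
  (forall a c, X a c != 0 -> parity a (+) parity c = b) -> homogeneous b X.
Proof.
move=> XP.
have pl i : parity (lshift (odddim g n) i) = false.
  by rewrite /parity /= leqNgt ltn_ord.
have pr i : parity (rshift (evdim g m) i) by rewrite /parity /= leq_addr.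
have X0 a c : parity a (+) parity c = ~~ b -> X a c = 0.
  by move=> ac; apply/eqP; apply: contraT => /XP; rewrite ac; case: (b).
by case: b X0 {XP} => /= X0; split; apply/matrixP => i j; rewrite !mxE X0 // ?pl ?pr.
Qed.

Lemma sum_weight_eval (mu nu : weight m n) (x : 'rV[C]_(m + n)) :
  weight_eval (mu + nu) x = weight_eval mu x + weight_eval nu x.
Proof.
rewrite /weight_eval -big_split; apply: eq_bigr => k _.
by rewrite mxE rmorphD mulrDl.
Qed.

Lemma weight_evalN (mu : weight m n) (x : 'rV[C]_(m + n)) :
  weight_eval (- mu) x = - weight_eval mu x.
Proof.
by rewrite /weight_eval -sumrN; apply: eq_bigr => k _; rewrite mxE rmorphN mulNr.
Qed.

(* A basis of weight vectors of the natural module, with the involution      *)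
(* pairing [a] with the vector of opposite weight, and Gram matrix           *)
(* [(a, b) |-> (-1)^(sg a) [b = star a]].                                    *)
Record weight_basis := WeightBasis {
  star : I -> I;
  sg : I -> bool;
  wt : I -> weight m n;
  coweight : I -> 'rV[C]_(m + n);
  starK : involutive star;
  parity_star : forall a, parity (star a) = parity a;
  sg_star : forall a, sg (star a) = sg a (+) parity a;
  gramE : forall a b, gram C g m n a b = (-1) ^+ sg a *+ (b == star a);
  cartanE : forall x : 'rV[C]_(m + n), cartan g x = diag_mx (\row_a weight_eval (wt a) x);
  wt_star : forall a, wt (star a) = - wt a;
  coweightE : forall a b,
    weight_eval (wt b) (coweight a) = (b == a)%:R - (b == star a)%:R;
  coweight_star : forall a, coweight (star a) = - coweight a
}.

Variable B : weight_basis.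
Hypothesis osp : ~~ is_gl g.
Local Notation st := (star B).

Lemma star_eq a b : (st a == st b) = (a == b).
Proof. exact: inj_eq (can_inj (starK B)) _ _. Qed.

Lemma eq_star a b : (st a == b) = (a == st b).
Proof. by rewrite -(inj_eq (can_inj (starK B))) starK. Qed.

(** The exponent of the sign that invariance of the form forces on the second matrix unit of
    [rv]. *)
Definition kap a b : bool := ~~ (parity b && ~~ parity a (+) sg B a (+) sg B b).

Definition rv a b : smx :=
  delta_mx a b + (-1) ^+ kap a b *: delta_mx (st b) (st a).

Definition pp a b : bool := parity a (+) parity b.

Lemma rv_in_g a b : in_g (pp a b) (rv a b).
Proof.
split.
  apply: homogeneous_entries => c d; rewrite !mxE.
  have [/andP[/eqP-> /eqP->] //|_] := boolP ((c == a) && (d == b)).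
  have [/andP[/eqP-> /eqP->] _|_] := boolP ((c == st b) && (d == st a)).
    by rewrite !parity_star addbC.
  by rewrite mulr0 addr0 eqxx.
rewrite (negbTE osp).
move=> i j; rewrite !mxE.
rewrite (bigD1 (st j)) //= big1 => [|k kj]; last first.
  by rewrite (gramE B) -eq_star eq_sym (negbTE kj) mulr0n mulr0.
rewrite (bigD1 (st i)) //= big1 => [|k ki]; last by rewrite (gramE B) (negbTE ki) mulr0n mul0r.
rewrite !(gramE B) starK !eqxx !mulr1n !addr0 !mxE -/(parity i).
rewrite !star_eq (eq_star j a) (eq_star i a).
have -> : (i == st a) && (j == b) = (j == b) && (i == st a) by rewrite andbC.
have -> : (j == st a) && (i == b) = (i == b) && (j == st a) by rewrite andbC.
have [/andP[/eqP ib /eqP ja]|_] := boolP ((i == b) && (j == st a)).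
  have [/andP[/eqP jb /eqP ia]|_] := boolP ((j == b) && (i == st a)).
    rewrite ib ja starK mulr1 /kap /pp.
    have ab : b = st a by rewrite -ia ib.
    rewrite ab sg_star !parity_star.
    by case: (parity a) (sg B a) => [] []; rewrite /= ?expr0 ?expr1; ring.
  rewrite ib ja starK /kap /pp.
  by case: (parity a) (parity b) (sg B a) (sg B b) => [] [] [] []; rewrite /= ?expr0 ?expr1; ring.
have [/andP[/eqP jb /eqP ia]|_] := boolP ((j == b) && (i == st a)); last by rewrite /=; ring.
rewrite jb ia /kap /pp !sg_star !parity_star.
by case: (parity a) (parity b) (sg B a) (sg B b) => [] [] [] []; rewrite /= ?expr0 ?expr1; ring.
Qed.

Lemma cartan_rv (x : 'rV[C]_(m + n)) a b :
  cartan g x *m rv a b - rv a b *m cartan g x = weight_eval (wt B a - wt B b) x *: rv a b.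
Proof.
rewrite (cartanE B) mul_diag_mx mul_mx_diag.
apply/matrixP => c d; rewrite !mxE sum_weight_eval weight_evalN.
have [/andP[/eqP-> /eqP->]|_] := boolP ((c == a) && (d == b)).
  have [/andP[/eqP ab /eqP ba]|_] := boolP ((a == st b) && (b == st a)); last by rewrite /= !mulr0; ring.
  by ring.
have [/andP[/eqP-> /eqP->]|_] := boolP ((c == st b) && (d == st a)); last by rewrite /= !mulr0; ring.
by rewrite !wt_star !weight_evalN; ring.
Qed.

Lemma rv_root_vector a b : root_vector (wt B a - wt B b) (rv a b).
Proof. by move=> x; apply: cartan_rv. Qed.

Lemma cartan_in_g (x : 'rV[C]_(m + n)) : in_g false (cartan g x : smx).
Proof.
split.
  apply: homogeneous_entries => c d; rewrite (cartanE B) !mxE.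
  by have [->|] := eqVneq c d; rewrite ?addbb // mulr0n eqxx.
rewrite (negbTE osp).
move=> i j; rewrite andFb expr0 mul1r (cartanE B).
move: (gramE B); move: (gram C g m n) => G GE.
rewrite tr_diag_mx mul_diag_mx mul_mx_diag !mxE GE.
have [->|_] := eqVneq j (st i); last by rewrite !mulr0 mul0r addr0.
by rewrite wt_star weight_evalN; ring.
Qed.

Lemma delta_mul0 (a b c d : I) : b != c -> delta_mx a b *m delta_mx c d = 0 :> smx.
Proof. by move=> bc; rewrite mul_delta_mx_cond (negbTE bc). Qed.

Lemma delta_mul (a b d : I) : delta_mx a b *m delta_mx b d = delta_mx a d :> smx.
Proof. by rewrite mul_delta_mx_cond eqxx. Qed.

Lemma kap_chain a b d : (-1) ^+ (pp a b && pp b d) * ((-1) ^+ kap a b * (-1) ^+ kap b d)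
  = - (-1) ^+ kap a d :> C.
Proof.
rewrite /pp /kap; case: (parity a) (parity b) (parity d) => [] [] [];
  case: (sg B a) (sg B b) (sg B d) => [] [] []; rewrite /= ?expr0 ?expr1; ring.
Qed.

(** The inequalities exclude the further products of matrix units that occur when indices coincide
    or are opposite. *)
Lemma sbracket_chain a b d : a != d -> d != st b -> st a != b ->
  sbracket (pp a b) (pp b d) (rv a b) (rv b d) = rv a d.
Proof.
move=> ad db ab; rewrite /sbracket /rv !(mulmxDl, mulmxDr) -!(scalemxAl, scalemxAr).
have da : d != a by rewrite eq_sym.
have bsd : b != st d by rewrite -eq_star eq_sym.
have sda : st a != st d by rewrite star_eq.
have sba : st b != a by rewrite eq_star eq_sym.
rewrite !delta_mul (delta_mul0 _ _ db) (delta_mul0 _ _ ab) (delta_mul0 _ _ bsd).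
rewrite (delta_mul0 _ _ sda) (delta_mul0 _ _ da) (delta_mul0 _ _ sba).
rewrite !scaler0 !addr0 !add0r !scalerA -scaleNr; congr (_ + _ *: _).
by rewrite -[RHS]opprK -(kap_chain a b d); ring.
Qed.

Lemma sbracket_zero a b c d : b != c -> d != a -> b != st d -> st a != c ->
  sbracket (pp a b) (pp c d) (rv a b) (rv c d) = 0.
Proof.
move=> bc da bd ac; rewrite /sbracket /rv !(mulmxDl, mulmxDr) -!(scalemxAl, scalemxAr).
have sad : st a != st d by rewrite star_eq eq_sym.
have dsb : d != st b by rewrite -eq_star eq_sym.
have sca : st c != a by rewrite eq_star eq_sym.
have scb : st c != st b by rewrite star_eq eq_sym.
rewrite (delta_mul0 _ _ bc) (delta_mul0 _ _ bd) (delta_mul0 _ _ ac) (delta_mul0 _ _ da).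
rewrite (delta_mul0 _ _ sad) (delta_mul0 _ _ dsb) (delta_mul0 _ _ sca) (delta_mul0 _ _ scb).
by rewrite !scaler0 !addr0 !scaler0 subr0.
Qed.

Lemma cartan_coweight a :
  cartan g (coweight B a) = delta_mx a a - delta_mx (st a) (st a) :> smx.
Proof.
rewrite (cartanE B); apply/matrixP => c d; rewrite !mxE coweightE.
have [->|cd] := eqVneq c d; first by rewrite !andbb mulr1n.
rewrite mulr0n; have -> : (c == a) && (d == a) = false.
  by apply/negbTE; apply: contra cd => /andP[/eqP-> /eqP->].
have -> : (c == st a) && (d == st a) = false.
  by apply/negbTE; apply: contra cd => /andP[/eqP-> /eqP->].
by rewrite subr0.
Qed.

Lemma kap_swap a b : (-1) ^+ kap a b * (-1) ^+ kap b a = (-1) ^+ pp a b :> C.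
Proof.
rewrite /pp /kap; case: (parity a) (parity b) (sg B a) (sg B b) => [] [] [] [];
  rewrite /= ?expr0 ?expr1; ring.
Qed.

Lemma sbracket_cartan a b : a != b -> a != st b ->
  sbracket (pp a b) (pp b a) (rv a b) (rv b a)
    = cartan g (coweight B a) - (-1) ^+ pp a b *: cartan g (coweight B b).
Proof.
move=> ab asb; have ppC : pp b a = pp a b by rewrite /pp addbC.
have ba : b != a by rewrite eq_sym.
have bsa : b != st a by rewrite -eq_star eq_sym.
have sba : st b != a by rewrite eq_sym.
have sab : st a != b by rewrite eq_sym.
rewrite /sbracket ppC andbb /rv !(mulmxDl, mulmxDr) -!(scalemxAl, scalemxAr) !delta_mul.
rewrite (delta_mul0 _ _ bsa) (delta_mul0 _ _ sab) (delta_mul0 _ _ asb) (delta_mul0 _ _ sba).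
rewrite !scaler0 !addr0 !add0r !scalerA kap_swap (mulrC _ ((-1) ^+ kap a b)) kap_swap.
rewrite !cartan_coweight; apply/matrixP => c d; rewrite !mxE.
by case: (pp a b); rewrite /= ?expr0 ?expr1; ring.
Qed.

(** For odd [a] the two matrix units coincide and have equal signs, so they do not cancel: this is
    the root vector of a long root 2 del or -2 del. *)
Lemma rv_long a : parity a -> rv a (st a) = 2 *: delta_mx a (st a).
Proof.
move=> pa; rewrite /rv starK /kap parity_star pa sg_star pa andbF addFb.
by case: (sg B a); rewrite /= expr0 scale1r -mulr2n -scaler_nat.
Qed.

Lemma rv_long_star a : parity a -> rv (st a) a = 2 *: delta_mx (st a) a.
Proof. by move=> pa; have := @rv_long (st a); rewrite starK parity_star; apply. Qed.

Lemma sbracket_long a : parity a ->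
  sbracket false false (rv a (st a)) (rv (st a) a) = 4 *: cartan g (coweight B a).
Proof.
move=> pa; rewrite rv_long // rv_long_star //.
rewrite /sbracket -!(scalemxAl, scalemxAr) !delta_mul expr0 scale1r -!scalerBr scalerA.
by rewrite cartan_coweight -natrM.
Qed.

Lemma sbracket_long_odd a b : parity a -> ~~ parity b ->
  sbracket false true (rv (st a) a) (rv a b) = 2 *: rv (st a) b.
Proof.
move=> pa pb.
have sab : st a != b by apply: contraNneq pb => <-; rewrite parity_star.
have ba : b != st a by rewrite eq_sym.
rewrite rv_long_star //.
rewrite /sbracket /rv !(mulmxDl, mulmxDr) -!(scalemxAl, scalemxAr) !delta_mul.
have aa : (a == st a) = false.
  apply/negbTE; apply: contraT; rewrite negbK => /eqP aa.
  by have := sg_star B a; rewrite -aa pa; case: (sg B a).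
have asb : a != st b by rewrite -eq_star.
have aa' : st a != a by rewrite eq_sym aa.
rewrite (delta_mul0 _ _ asb) (delta_mul0 _ _ ba).
rewrite !scaler0 addr0 add0r expr0 scale1r starK.
rewrite scalerDr -scalerN !scalerA; congr (_ + _).
rewrite scalerN scalerA -scaleNr; congr (_ *: _).
rewrite /kap !parity_star sg_star pa (negbTE pb).
by case: (sg B a) (sg B b) => [] []; rewrite /= ?expr0 ?expr1; ring.
Qed.

Lemma rv_star a b : rv (st b) (st a) = (-1) ^+ kap (st b) (st a) *: rv a b.
Proof.
rewrite /rv !starK scalerDr scalerA addrC; congr (_ + _).
rewrite /kap !parity_star !sg_star.
by case: (parity a) (parity b) (sg B a) (sg B b) => [] [] [] []; rewrite /= ?expr0 ?expr1 ?mul1r ?mulrNN ?mulr1 ?scale1r.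
Qed.

Lemma sbracketC b c (X Y : smx) :
  sbracket c b Y X = - (-1) ^+ (b && c) *: sbracket b c X Y.
Proof.
rewrite /sbracket andbC scalerBr !scaleNr scalerA -expr2 sqrr_sign scale1r opprK.
by rewrite addrC.
Qed.

Section Module.

Variables (V : vectType C) (V_ : bool -> {vspace V}) (r : smx -> 'End(V)).
Hypothesis Mod : @is_module C g m n V V_ r.

Lemma in_g0 b : in_g b (0 : smx).
Proof.
split; first by apply: homogeneous_entries => i j; rewrite mxE eqxx.
case: (is_gl g) => // i j.
by rewrite linear0 mul0mx mulmx0 !mxE mulr0 addr0.
Qed.

Lemma act0 : r 0 = 0.
Proof.
have := mod_linear Mod 1 (in_g0 false) (in_g0 false).
by rewrite scaler0 addr0 scale1r => /eqP; rewrite -subr_eq0 opprD addrA subrr add0r oppr_eq0 => /eqP.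
Qed.

Lemma actZ b c X : in_g b X -> r (c *: X) = c *: r X.
Proof.
by move=> XP; have := mod_linear Mod c XP (in_g0 b); rewrite addr0 act0 addr0.
Qed.

Lemma act_swap b c X Y v : in_g b X -> in_g c Y ->
  r X (r Y v) = (-1) ^+ (b && c) *: r Y (r X v) + r (sbracket b c X Y) v.
Proof.
move=> XP YP; rewrite (mod_bracket Mod XP YP) sub_lfunE scale_lfunE !comp_lfunE /=.
by rewrite addrC subrK.
Qed.

Local Notation act a b := (r (rv a b)).
Local Notation H a := (r (cartan g (coweight B a))).

(** The three [kill] lemmas carry annihilation by one root vector across the action of another:
    after the swap only the bracket remains, and it vanishes or annihilates [v] itself. *)
Lemma kill_chain a b d v : a != d -> d != st b -> st a != b ->
  act a b v = 0 -> act a d v = 0 -> act a b (act b d v) = 0.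
Proof.
move=> ad db ab va vad; rewrite (act_swap v (rv_in_g a b) (rv_in_g b d)).
by rewrite sbracket_chain // va linear0 scaler0 add0r.
Qed.

Lemma kill_chain_rev a b d v : a != d -> d != st b -> st a != b ->
  act b d v = 0 -> act a d v = 0 -> act b d (act a b v) = 0.
Proof.
move=> ad db ab va vad; rewrite (act_swap v (rv_in_g b d) (rv_in_g a b)).
rewrite sbracketC sbracket_chain // (actZ _ (rv_in_g a d)) scale_lfunE va vad.
by rewrite linear0 !scaler0 addr0.
Qed.

Lemma kill_zero a b c d v : b != c -> d != a -> b != st d -> st a != c ->
  act a b v = 0 -> act a b (act c d v) = 0.
Proof.
move=> bc da bd ac va; rewrite (act_swap v (rv_in_g a b) (rv_in_g c d)).
by rewrite sbracket_zero // act0 va linear0 scaler0 add0r zero_lfunE.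
Qed.

Lemma act_cartan a b v : a != b -> a != st b ->
  act a b (act b a v)
    = (-1) ^+ pp a b *: act b a (act a b v) + (H a v - (-1) ^+ pp a b *: H b v).
Proof.
move=> ab asb; rewrite (act_swap v (rv_in_g a b) (rv_in_g b a)).
rewrite sbracket_cartan // {2}/pp addbC -/(pp a b) andbb; congr (_ + _).
rewrite addrC -scaleNr (mod_linear Mod _ (cartan_in_g _) (cartan_in_g _)).
by rewrite add_lfunE scale_lfunE scaleNr addrC.
Qed.

Definition weight_vector (mu : weight m n) (v : V) : Prop :=
  forall x, r (cartan g x) v = weight_eval mu x *: v.

Lemma act_weight mu v a b : weight_vector mu v ->
  weight_vector (mu + (wt B a - wt B b)) (act a b v).
Proof.
move=> vmu x; rewrite (act_swap v (cartan_in_g x) (rv_in_g a b)) vmu andFb expr0 scale1r.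
rewrite /sbracket andFb expr0 scale1r cartan_rv (actZ _ (rv_in_g a b)) scale_lfunE linearZ.
by rewrite [in RHS]sum_weight_eval scalerDl.
Qed.

(* The value of [mu] on the coroot-like element [E_aa - E_{a*a*}]. *)
Definition pairing (mu : weight m n) a : C := weight_eval mu (coweight B a).

Lemma pairingD mu nu a : pairing (mu + nu) a = pairing mu a + pairing nu a.
Proof. exact: sum_weight_eval. Qed.

Lemma pairing_wt b a : pairing (wt B b) a = (b == a)%:R - (b == st a)%:R.
Proof. exact: coweightE. Qed.

Lemma pairing_wtB b c a : pairing (wt B b - wt B c) a
  = (b == a)%:R - (b == st a)%:R - ((c == a)%:R - (c == st a)%:R).
Proof. by rewrite pairingD !pairing_wt /pairing weight_evalN coweightE. Qed.

Lemma pairing_star mu a : pairing mu (st a) = - pairing mu a.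
Proof.
rewrite /pairing coweight_star /weight_eval -sumrN; apply: eq_bigr => k _.
by rewrite mxE mulrN.
Qed.

Lemma act_H mu v a : weight_vector mu v -> H a v = pairing mu a *: v.
Proof. by move=> vmu; apply: vmu. Qed.

Lemma H_act a b c u : H c (act a b u) = act a b (H c u) + pairing (wt B a - wt B b) c *: act a b u.
Proof.
rewrite (act_swap u (cartan_in_g _) (rv_in_g a b)) andFb expr0 scale1r; congr (_ + _).
by rewrite /sbracket andFb expr0 scale1r cartan_rv (actZ _ (rv_in_g a b)) scale_lfunE.
Qed.

Lemma even_primitive mu v a b : pp a b = false -> a != b -> a != st b -> a != st a ->
  v != 0 -> weight_vector mu v -> act a b v = 0 -> 0 <= pairing mu a - pairing mu b.
Proof.
move=> pab ab asb asa v0 vmu ev.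
(* The scale is 2, except when [b] is the self-dual vector of weight 0: the root is then short and
   the scale is 1. *)
pose t : C := 2 - (b == st b)%:R.
have t0 : 0 < t.
  by rewrite /t; case: (b == st b); rewrite ?subr0 ?ltr0n // -[2]/(1 + 1) addrK ltr01.
pose h : 'End(V) := H a - H b.
have ef u : act a b (act b a u) = act b a (act a b u) + h u.
  by rewrite act_cartan // pab expr0 !scale1r sub_lfunE.
have hf u : h (act b a u) = act b a (h u) - t *: act b a u.
  rewrite !sub_lfunE !H_act !pairing_wtB linearB /= eqxx (negbTE ab) (eq_sym b a) (negbTE ab).
  have -> : (b == st a) = false by rewrite -eq_star eq_sym (negbTE asb).
  rewrite (negbTE asb) (negbTE asa) eqxx /t.
  have aux (p q w : V) (c1 c2 c3 : C) : c1 - c2 = - c3 ->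
      p + c1 *: w - (q + c2 *: w) = p - q - c3 *: w.
    by move=> cE; rewrite opprD addrACA -scalerBl cE scaleNr.
  by apply: aux; case: (b == st b); rewrite /=; ring.
have hv : h v = (pairing mu a - pairing mu b) *: v.
  by rewrite sub_lfunE !(act_H _ vmu) scalerBl.
by have [] := sl2_primitive t0 v0 ef hf ev hv.
Qed.

(** The sl2-triple is formed by two long root vectors and 4 H_a. The 4 arises because each vector is
    twice a matrix unit; the scale is then 8. *)
Lemma long_primitive mu v a : parity a -> v != 0 -> weight_vector mu v ->
  act a (st a) v = 0 -> 0 <= pairing mu a /\ (pairing mu a = 0 -> act (st a) a v = 0).
Proof.
move=> pa v0 vmu ev.
have asa : (a == st a) = false.
  apply/negbTE; apply: contraT; rewrite negbK => /eqP aa.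
  by have := sg_star B a; rewrite -aa pa; case: (sg B a).
have P1 : pp a (st a) = false by rewrite /pp parity_star addbb.
have P2 : pp (st a) a = false by rewrite /pp parity_star addbb.
have I1 := rv_in_g a (st a); have I2 := rv_in_g (st a) a; rewrite P1 in I1; rewrite P2 in I2.
have ef u : act a (st a) (act (st a) a u)
    = act (st a) a (act a (st a) u) + (4 *: H a : 'End(V)) u.
  rewrite (act_swap u I1 I2) expr0 scale1r sbracket_long // (actZ _ (cartan_in_g _)).
  by [].
have hf u : (4 *: H a : 'End(V)) (act (st a) a u)
    = act (st a) a ((4 *: H a : 'End(V)) u) - 8 *: act (st a) a u.
  rewrite !scale_lfunE H_act pairing_wtB eqxx (eq_sym (st a)) asa eqxx linearZ scalerDr.
  congr (_ + _); rewrite scalerA -scaleNr; congr (_ *: _).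
  by rewrite /=; ring.
have hv : (4 *: H a : 'End(V)) v = (4 * pairing mu a) *: v.
  by rewrite scale_lfunE (act_H _ vmu) scalerA.
have [c0 cf] := sl2_primitive (ltr0n C 8) v0 ef hf ev hv.
split; first by rewrite -(pmulr_rge0 _ (ltr0n C 4)).
by move=> m0; apply: cf; rewrite m0 mulr0.
Qed.

(** If the weight vanishes on del, then sl2-theory shows that the vector of weight -2 del kills v.
    Its bracket with the vector of weight del - eps, which kills v too, has weight -del - eps. So
    both vectors of weights del + eps and -del - eps kill v, and their anticommutator forces the
    weight to vanish on eps. *)
Lemma long_trivial mu v a b : parity a -> ~~ parity b -> v != 0 -> weight_vector mu v ->
  act a (st a) v = 0 -> act a b v = 0 -> act a (st b) v = 0 ->
  pairing mu a = 0 -> pairing mu b = 0.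
Proof.
move=> pa pb v0 vmu ea eab easb ma0.
have [_ /(_ ma0) fa] := long_primitive pa v0 vmu ea.
have P2 : pp (st a) a = false by rewrite /pp parity_star addbb.
have P3 : pp a b = true by rewrite /pp pa (negbTE pb).
have I2 := rv_in_g (st a) a; have I3 := rv_in_g a b; rewrite P2 in I2; rewrite P3 in I3.
have := act_swap v I2 I3; rewrite sbracket_long_odd // (actZ _ (rv_in_g (st a) b)).
rewrite eab fa !linear0 ?scaler0 add0r scale_lfunE => /esym/eqP.
rewrite scaler_eq0 pnatr_eq0 /= => /eqP fab.
have ba : act (st b) a v = 0.
  by rewrite -[a in rv _ a](starK B) rv_star (actZ _ (rv_in_g _ _)) scale_lfunE fab scaler0.
have asb : a != st b by apply: contraNneq pb => aE; rewrite -(parity_star B) -aE.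
have ab : a != st (st b) by rewrite starK; apply: contraNneq pb => <-.
have := act_cartan v asb ab; rewrite ba easb !linear0 ?scaler0 add0r.
have -> : pp a (st b) by rewrite /pp parity_star pa (negbTE pb).
rewrite expr1 scaleN1r opprK !(act_H _ vmu) ma0 scale0r add0r pairing_star scaleNr.
by move=> /esym/eqP; rewrite oppr_eq0 scaler_eq0 (negbTE v0) orbF => /eqP.
Qed.

(** The anticommutator of the two opposite root vectors acts on [v] by the scalar assumed nonzero,
    but each of them kills [v]. *)
Lemma odd_primitive mu v a b : pp a b -> a != b -> a != st b -> weight_vector mu v ->
  act a b v = 0 -> act b a v = 0 -> pairing mu a + pairing mu b != 0 -> v = 0.
Proof.
move=> pab ab asb vmu va vb mu0; apply/eqP.
have := act_cartan v ab asb; rewrite va vb !linear0 ?scaler0 add0r pab expr1 scaleN1r opprK.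
rewrite !(act_H _ vmu) -scalerDl => /esym/eqP.
by rewrite scaler_eq0 (negbTE mu0).
Qed.

(* The product of the three odd root vectors of weights [d2 - e2], [d1 - e1] *)
(* and [d2 - e1] maps [v] to a vector of weight [-1] on [e1] killed by the   *)
(* short root vector of weight [e1]; it vanishes by sl2-theory, and the      *)
(* opposite root vectors then show [v = 0].                                  *)
Lemma no_repeated_half mu v e1 e2 d1 d2 o :
  uniq [:: e1; st e1; e2; st e2; d1; st d1; d2; st d2; o] -> st o = o ->
  ~~ parity e1 -> ~~ parity e2 -> parity d1 -> parity d2 -> ~~ parity o ->
  weight_vector mu v ->
  act e1 o v = 0 -> act d2 o v = 0 -> act d1 o v = 0 ->
  act e1 d2 v = 0 -> act d1 d2 v = 0 -> act d1 e2 v = 0 -> act e1 e2 v = 0 ->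
  act e1 d1 v = 0 -> act e2 d2 v = 0 ->
  pairing mu e1 = 1 -> pairing mu e2 = 1 -> pairing mu d2 = 0 -> 0 <= pairing mu d1 ->
  v = 0.
Proof.
move=> U oo pe1 pe2 pd1 pd2 po vmu e1o d2o d1o e1d2 d1d2 d1e2 e1e2 e1d1 e2d2 m1 m2 m3 m4.
have N (x y : I) : x != y -> (x == y = false) * (y == x = false).
  by move=> xy; rewrite [y == x]eq_sym (negbTE xy).
move: U; rewrite /= !inE !negb_or -!andbA andbT => U.
case/andP: U => /N neqs U.
(* Nine distinct indices give 36 inequalities: the first and the last are handled outside the loop.
   They are collected in one tuple usable by [rewrite]. *)
do 34 (case/andP: U => /N neq U; have {neq}neqs := (neqs, neq)).
have {neqs U}neqs := (neqs, N _ _ U).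
set w1 := act d2 e2 v; set w2 := act d1 e1 w1; set w3 := act d2 e1 w2.
pose mu1 := mu + (wt B d2 - wt B e2); pose mu2 := mu1 + (wt B d1 - wt B e1).
pose mu3 := mu2 + (wt B d2 - wt B e1).
have ww1 : weight_vector mu1 w1 by apply: act_weight.
have ww2 : weight_vector mu2 w2 by apply: act_weight.
have ww3 : weight_vector mu3 w3 by apply: act_weight.
have pede e d : ~~ parity e -> parity d -> pp e d by rewrite /pp => /negbTE-> ->.
have P1 : pairing mu1 e1 = 1 by rewrite /mu1 pairingD pairing_wtB m1 !neqs /=; ring.
have P2 : pairing mu1 d1 = pairing mu d1 by rewrite /mu1 pairingD pairing_wtB !neqs /=; ring.
have P3 : pairing mu2 e1 = 0.
  by rewrite /mu2 pairingD pairing_wtB P1 eqxx !neqs /=; ring.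
have P4 : pairing mu2 d2 = 1.
  have P4' : pairing mu1 d2 = 1.
    by rewrite /mu1 pairingD pairing_wtB m3 eqxx !neqs /=; ring.
  by rewrite /mu2 pairingD pairing_wtB P4' !neqs /=; ring.
have P5 : pairing mu3 e1 = -1.
  by rewrite /mu3 pairingD pairing_wtB P3 eqxx !neqs /=; ring.
have P6 : pairing mu3 o = 0.
  apply/eqP; have := pairing_star mu3 o; rewrite oo => /eqP.
  by rewrite -subr_eq0 opprK -mulr2n mulrn_eq0.
have w3_0 : w3 = 0.
  have ko1 : act e1 o w1 = 0 by apply: kill_zero; rewrite ?neqs.
  have ko2 : act d1 o w1 = 0 by apply: kill_zero; rewrite ?neqs.
  have ko3 : act d2 o w1 = 0 by apply: kill_zero; rewrite ?neqs.
  have ko4 : act e1 o w2 = 0 by apply: kill_chain_rev; rewrite ?neqs ?oo ?neqs.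
  have ko5 : act d2 o w2 = 0 by apply: kill_zero; rewrite ?neqs.
  have ko6 : act e1 o w3 = 0 by apply: kill_chain_rev; rewrite ?neqs ?oo ?neqs.
  apply/eqP; apply: contraT => w30.
  have pe1o : pp e1 o = false by rewrite /pp (negbTE pe1) (negbTE po).
  have e1o' : e1 != o by rewrite neqs.
  have e1so : e1 != st o by rewrite oo neqs.
  have e1s : e1 != st e1 by rewrite neqs.
  have := even_primitive pe1o e1o' e1so e1s w30 ww3 ko6.
  by rewrite P5 P6 subr0 oppr_ge0 ler10.
have kd1 : act e1 d2 w1 = 0 by apply: kill_chain; rewrite ?neqs.
have kd2 : act d1 d2 w1 = 0 by apply: kill_chain; rewrite ?neqs.
have kd3 : act e1 d2 w2 = 0 by apply: kill_chain_rev; rewrite ?neqs.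
have w2_0 : w2 = 0.
  apply: (odd_primitive (pede _ _ pe1 pd2) _ _ ww2 kd3 w3_0); rewrite ?neqs //.
  by rewrite P3 P4 add0r oner_eq0.
have kd4 : act e1 d1 w1 = 0 by apply: kill_zero; rewrite ?neqs.
have w1_0 : w1 = 0.
  apply: (odd_primitive (pede _ _ pe1 pd1) _ _ ww1 kd4 w2_0); rewrite ?neqs //.
  by rewrite P1 P2 gt_eqF // ltr_wpDr.
apply: (odd_primitive (pede _ _ pe2 pd2) _ _ vmu e2d2 w1_0); rewrite ?neqs //.
by rewrite m2 m3 addr0 oner_eq0.
Qed.

End Module.

End RootVectors.

Section PositiveRoots.

Variables (m n : nat).

Lemma mem_filter_flatten (T U : eqType) (P : pred T) (f : U -> seq T) l u x :
  u \in l -> x \in [seq a <- f u | P a] -> x \in [seq a <- flatten [seq f v | v <- l] | P a].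
Proof.
move=> ul; rewrite !mem_filter => /andP[-> xs] /=.
by apply/flattenP; exists (f u); rewrite ?map_f.
Qed.

Lemma mem_iota1 k (i : 'I_k) : i.+1 \in iota 1 k.
Proof. by rewrite mem_iota add1n !ltnS ltn_ord. Qed.

Lemma mem_pairs k l (i : 'I_k) (j : 'I_l) : (i.+1, j.+1) \in pairs k l.
Proof. by apply: allpairs_f; rewrite mem_iota add1n !ltnS ltn_ord. Qed.

Lemma mem_pairs_lt k (i j : 'I_k) : (i < j)%N ->
  (i.+1, j.+1) \in [seq p <- pairs k k | (p.1 < p.2)%N].
Proof. by move=> ij; rewrite mem_filter mem_pairs andbT. Qed.

Lemma pos_eps_eps (g : superType) (i k : 'I_m) a : ~~ is_gl g -> (i < k)%N ->
  a \in [:: eps m n i.+1 + eps m n k.+1; eps m n i.+1 - eps m n k.+1] ->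
  a \in even_pos g m n.
Proof.
move=> gl ik; rewrite -(filter_pm_eps n g ik) => aP.
have H := mem_filter_flatten (f := fun p => pm (eps m n p.1) (eps m n p.2)) (mem_pairs_lt ik) aP.
by case: g gl H {aP} => // _; rewrite /even_pos !filter_cat !mem_cat => ->; rewrite ?orbT.
Qed.

Lemma pos_del_del (g : superType) (j k : 'I_n) a : ~~ is_gl g -> (j < k)%N ->
  a \in [:: del m n j.+1 + del m n k.+1; del m n j.+1 - del m n k.+1] ->
  a \in even_pos g m n.
Proof.
move=> gl jk; rewrite -(filter_pm_del m g jk) => aP.
have H := mem_filter_flatten (f := fun p => pm (del m n p.1) (del m n p.2)) (mem_pairs_lt jk) aP.
by case: g gl H {aP} => // _; rewrite /even_pos !filter_cat !mem_cat => ->; rewrite ?orbT.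
Qed.

Lemma pos_del2 (g : superType) (j : 'I_n) : ~~ is_gl g ->
  del m n j.+1 *+ 2 \in even_pos g m n.
Proof.
move=> gl; have aP := mem_head (del m n j.+1 *+ 2) [::]; rewrite -(filter_del2 m g) in aP.
have H := mem_filter_flatten (f := fun k => [:: del m n k *+ 2; - (del m n k *+ 2)]) (mem_iota1 j) aP.
by case: g gl H {aP} => // _; rewrite /even_pos !filter_cat !mem_cat => ->; rewrite ?orbT.
Qed.

Lemma pos_eps (i : 'I_m) : eps m n i.+1 \in even_pos OSPodd m n.
Proof.
have aP := mem_head (eps m n i.+1) [::]; rewrite -(filter_eps n OSPodd) in aP.
have H := mem_filter_flatten (f := fun k => [:: eps m n k; - eps m n k]) (mem_iota1 i) aP.
by rewrite /even_pos !filter_cat !mem_cat H orbT.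
Qed.

Lemma pos_del (j : 'I_n) : del m n j.+1 \in odd_pos OSPodd m n.
Proof.
have aP := mem_head (del m n j.+1) [::]; rewrite -(filter_del m OSPodd) in aP.
have H := mem_filter_flatten (f := fun k => [:: del m n k; - del m n k]) (mem_iota1 j) aP.
by rewrite /odd_pos !filter_cat !mem_cat H orbT.
Qed.

Lemma pos_eps_del (g : superType) (i : 'I_m) (j : 'I_n) a : ~~ is_gl g ->
  a \in [:: eps m n i.+1 + del m n j.+1;
          if (key g m n (true, i : nat) < key g m n (false, j : nat))%N
          then eps m n i.+1 - del m n j.+1 else - eps m n i.+1 + del m n j.+1] ->
  a \in odd_pos g m n.
Proof.
move=> gl; rewrite -filter_pm_eps_del => aP.
have H := mem_filter_flatten (f := fun p => pm (eps m n p.1) (del m n p.2)) (mem_pairs i j) aP.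
by case: g gl H {aP} => // _; rewrite /odd_pos ?filter_cat ?mem_cat => ->.
Qed.

Lemma pos_gl_eps (i k : 'I_m) : (i < k)%N ->
  eps m n i.+1 - eps m n k.+1 \in even_pos GL m n.
Proof.
move=> ik; rewrite mem_filter; apply/andP; split.
  have := @positive_comb GL m n (true, i : nat) (true, k : nat) 1 (-1) (valid_eps n i) ik (oner_neq0 _).
  by rewrite scale1r scaleN1r => ->.
rewrite mem_cat; apply/orP; left; apply/mapP; exists (i.+1, k.+1) => //.
by rewrite mem_filter mem_pairs andbT /= eqSS neq_ltn ik.
Qed.

Lemma pos_gl_del (j k : 'I_n) : (j < k)%N ->
  del m n j.+1 - del m n k.+1 \in even_pos GL m n.
Proof.
move=> jk; rewrite mem_filter; apply/andP; split.
  have jk' : (key GL m n (false, j : nat) < key GL m n (false, k : nat))%N.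
    by rewrite /key /= ltn_add2l.
  have := @positive_comb GL m n _ _ 1 (-1) (valid_del m j) jk' (oner_neq0 _).
  by rewrite scale1r scaleN1r => ->.
rewrite mem_cat; apply/orP; right; apply/mapP; exists (j.+1, k.+1) => //.
by rewrite mem_filter mem_pairs andbT /= eqSS neq_ltn jk.
Qed.

End PositiveRoots.

(** * Weight bases of the natural modules of osp *)

Section WeightBases.

Variables (C : numClosedFieldType) (m n : nat).

Lemma weval_eps (i : 'I_m) (x : 'rV[C]_(m + n)) :
  weight_eval (eps m n i.+1) x = x 0 (lshift n i).
Proof.
rewrite /weight_eval big_split_ord /= [X in _ + X]big1 => [|j _]; last first.
  by rewrite eps_rshift rmorph0 mul0r.
rewrite addr0 (bigD1 i) //= eps_lshift eqxx rmorph1 mul1r big1 ?addr0 // => k ki.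
by rewrite eps_lshift (inj_eq val_inj) (negbTE ki) rmorph0 mul0r.
Qed.

Lemma weval_del (j : 'I_n) (x : 'rV[C]_(m + n)) :
  weight_eval (del m n j.+1) x = x 0 (rshift m j).
Proof.
rewrite /weight_eval big_split_ord /= [X in X + _]big1 => [|i _]; last first.
  by rewrite del_lshift rmorph0 mul0r.
rewrite add0r (bigD1 j) //= del_rshift eqxx rmorph1 mul1r big1 ?addr0 // => k kj.
by rewrite del_rshift (inj_eq val_inj) (negbTE kj) rmorph0 mul0r.
Qed.

Lemma weval0 (x : 'rV[C]_(m + n)) : weight_eval (0 : weight m n) x = 0.
Proof. by rewrite /weight_eval big1 // => k _; rewrite mxE rmorph0 mul0r. Qed.

Definition half_star k (a : 'I_(k + k)) : 'I_(k + k) :=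
  match split a with inl i => rshift k i | inr i => lshift k i end.

Lemma half_starK k : involutive (@half_star k).
Proof.
by move=> a; rewrite /half_star; case: (split_ordP a) => i ->;
  rewrite ?split_lshift ?split_rshift.
Qed.

Definition half_sign k (a : 'I_(k + k)) : bool := if split a is inr _ then true else false.

Lemma half_sign_star k (a : 'I_(k + k)) : half_sign (half_star a) = ~~ half_sign a.
Proof.
by rewrite /half_sign /half_star; case: (split a) => i;
  rewrite ?split_lshift ?split_rshift.
Qed.

Definition half_wt k (b : 'I_k -> weight m n) (a : 'I_(k + k)) : weight m n :=
  match split a with inl i => b i | inr i => - b i end.

Lemma half_wt_star k b (a : 'I_(k + k)) : half_wt b (half_star a) = - half_wt b a.
Proof.
by rewrite /half_wt /half_star; case: (split a) => i;
  rewrite ?split_lshift ?split_rshift ?opprK.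
Qed.

Definition half_cw k (c : 'I_k -> 'rV[C]_(m + n)) (a : 'I_(k + k)) : 'rV[C]_(m + n) :=
  match split a with inl i => c i | inr i => - c i end.

Lemma half_cw_star k c (a : 'I_(k + k)) : half_cw c (half_star a) = - half_cw c a.
Proof.
by rewrite /half_cw /half_star; case: (split a) => i;
  rewrite ?split_lshift ?split_rshift ?opprK.
Qed.

Definition weps (i : 'I_m) := eps m n i.+1.
Definition wdel (j : 'I_n) := del m n j.+1.
Definition ceps (i : 'I_m) : 'rV[C]_(m + n) := delta_mx 0 (lshift n i).
Definition cdel (j : 'I_n) : 'rV[C]_(m + n) := delta_mx 0 (rshift m j).

Lemma weight_evalNr (mu : weight m n) (x : 'rV[C]_(m + n)) :
  weight_eval mu (- x) = - weight_eval mu x.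
Proof.
by rewrite /weight_eval -sumrN; apply: eq_bigr => k _; rewrite mxE mulrN.
Qed.

Lemma half_pair k (b : 'I_k -> weight m n) c a a' :
  (forall i j, weight_eval (b i) (c j : 'rV[C]_(m + n)) = (i == j)%:R) ->
  weight_eval (half_wt b a') (half_cw c a) = (a' == a)%:R - (a' == half_star a)%:R.
Proof.
move=> bc; rewrite /half_wt /half_cw /half_star.
case: (split_ordP a) => i ->; case: (split_ordP a') => j ->;
  rewrite ?weight_evalN ?weight_evalNr bc ?eq_lshift ?eq_rshift ?eq_lrshift ?eq_rlshift /=;
  by rewrite ?subr0 ?sub0r ?opprK.
Qed.

Lemma half_pair0 k k' (b : 'I_k -> weight m n) (c : 'I_k' -> 'rV[C]_(m + n)) a a' :
  (forall i j, weight_eval (b i) (c j) = 0) ->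
  weight_eval (half_wt b a') (half_cw c a) = 0.
Proof.
move=> bc; rewrite /half_wt /half_cw.
by case: (split a) => i; case: (split a') => j;
  rewrite ?weight_evalN ?weight_evalNr bc ?oppr0.
Qed.

Lemma weps_ceps i j : weight_eval (weps i) (ceps j) = (i == j)%:R.
Proof. by rewrite weval_eps mxE eqxx eq_lshift. Qed.

Lemma wdel_cdel i j : weight_eval (wdel i) (cdel j) = (i == j)%:R.
Proof. by rewrite weval_del mxE eqxx eq_rshift. Qed.

Lemma weps_cdel i j : weight_eval (weps i) (cdel j) = 0.
Proof. by rewrite weval_eps mxE eqxx eq_lrshift. Qed.

Lemma wdel_ceps i j : weight_eval (wdel i) (ceps j) = 0.
Proof. by rewrite weval_del mxE eqxx eq_rlshift. Qed.

Lemma half_gram_even k (a b : 'I_(k + k)) :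
  block_mx 0 1%:M 1%:M 0 a b = (b == half_star a)%:R :> C.
Proof.
rewrite /half_star; case: (split_ordP a) => i ->; case: (split_ordP b) => j ->;
  rewrite ?block_mxEul ?block_mxEur ?block_mxEdl ?block_mxEdr !mxE
    ?eq_lshift ?eq_rshift ?eq_lrshift ?eq_rlshift //; by rewrite eq_sym.
Qed.

Lemma half_gram_odd k (a b : 'I_(k + k)) :
  block_mx 0 1%:M (- 1%:M) 0 a b = (-1) ^+ half_sign a *+ (b == half_star a) :> C.
Proof.
rewrite /half_star /half_sign; case: (split_ordP a) => i ->; case: (split_ordP b) => j ->;
  rewrite ?block_mxEul ?block_mxEur ?block_mxEdl ?block_mxEdr !mxE
    ?eq_lshift ?eq_rshift ?eq_lrshift ?eq_rlshift //= (eq_sym j);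
  by case: (i == j); rewrite ?oppr0.
Qed.

Lemma half_cartan_entry k (y : 'rV[C]_k) (b : 'I_k -> weight m n) x (a : 'I_(k + k)) :
  (forall i, y 0 i = weight_eval (b i) x) ->
  row_mx y (- y) 0 a = weight_eval (half_wt b a) (x : 'rV[C]_(m + n)).
Proof.
move=> yb; rewrite /half_wt; case: (split_ordP a) => i ->;
  by rewrite ?row_mxEl ?row_mxEr ?mxE yb ?weight_evalN.
Qed.

Lemma weight_eval_0r (mu : weight m n) : weight_eval mu (0 : 'rV[C]_(m + n)) = 0.
Proof. by rewrite /weight_eval big1 // => k _; rewrite mxE mulr0. Qed.

Section Block.

Variables (p : nat) (st : 'I_p -> 'I_p) (w : 'I_p -> weight m n) (c : 'I_p -> 'rV[C]_(m + n)).
Local Notation I := 'I_(p + (n + n)).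

(** The odd block is common to both orthosymplectic series, so only the data [st], [w], [c] of the
    even block are parameters. *)
Definition bstar (a : I) : I :=
  match split a with inl b => lshift (n + n) (st b) | inr d => rshift p (half_star d) end.

Definition bsg (a : I) : bool := if split a is inr d then half_sign d else false.

Definition bwt (a : I) : weight m n :=
  match split a with inl b => w b | inr d => half_wt wdel d end.

Definition bcw (a : I) : 'rV[C]_(m + n) :=
  match split a with inl b => c b | inr d => half_cw cdel d end.

Lemma bpar_lshift (b : 'I_p) : (p <= lshift (n + n) b)%N = false.
Proof. by rewrite /= leqNgt ltn_ord. Qed.

Lemma bstarK : involutive st -> involutive bstar.
Proof.
by move=> stK a; rewrite /bstar; case: (split_ordP a) => i ->;
  rewrite ?split_lshift ?split_rshift ?half_starK ?stK.
Qed.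

Lemma bpar_star a : (p <= bstar a)%N = (p <= a)%N.
Proof.
by rewrite /bstar; case: (split_ordP a) => i ->; rewrite ?bpar_lshift //= !leq_addr.
Qed.

Lemma bsg_star a : bsg (bstar a) = bsg a (+) (p <= a)%N.
Proof.
rewrite /bsg /bstar; case: (split_ordP a) => i ->; rewrite ?split_lshift ?split_rshift.
  by rewrite bpar_lshift.
by rewrite /= leq_addr half_sign_star addbT.
Qed.

Lemma bgram (G : 'M[C]_p) a b : (forall a b, G a b = (b == st a)%:R) ->
  block_mx G 0 0 (block_mx 0 1%:M (- 1%:M) 0) a b = (-1) ^+ bsg a *+ (b == bstar a).
Proof.
move=> GE; rewrite /bsg /bstar; case: (split_ordP a) => i ->; case: (split_ordP b) => j ->;
  rewrite ?block_mxEul ?block_mxEur ?block_mxEdl ?block_mxEdr ?split_lshift ?split_rshift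
    ?eq_lshift ?eq_rshift ?eq_lrshift ?eq_rlshift ?half_gram_odd ?GE ?mxE //.
Qed.

Lemma bcartan (x : 'rV[C]_(m + n)) (e : 'rV[C]_p) : (forall b, e 0 b = weight_eval (w b) x) ->
  diag_mx (row_mx e (row_mx (rsubmx x) (- rsubmx x))) = diag_mx (\row_a weight_eval (bwt a) x).
Proof.
move=> eE; congr diag_mx; apply/rowP => a; rewrite [RHS]mxE /bwt.
case: (split_ordP a) => i ->; rewrite ?row_mxEl ?row_mxEr //.
by apply: half_cartan_entry => k; rewrite mxE weval_del.
Qed.

Lemma bwt_star : (forall b, w (st b) = - w b) -> forall a, bwt (bstar a) = - bwt a.
Proof.
by move=> ws a; rewrite /bwt /bstar; case: (split a) => i;
  rewrite ?split_lshift ?split_rshift ?half_wt_star ?ws.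
Qed.

Lemma bcw_star : (forall b, c (st b) = - c b) -> forall a, bcw (bstar a) = - bcw a.
Proof.
by move=> cs a; rewrite /bcw /bstar; case: (split a) => i;
  rewrite ?split_lshift ?split_rshift ?half_cw_star ?cs.
Qed.

Lemma bpairing : (forall a b, weight_eval (w b) (c a) = (b == a)%:R - (b == st a)%:R) ->
  (forall d b, weight_eval (half_wt wdel d) (c b) = 0) ->
  (forall d b, weight_eval (w b) (half_cw cdel d) = 0) ->
  forall a b, weight_eval (bwt b) (bcw a) = (b == a)%:R - (b == bstar a)%:R.
Proof.
move=> wc dc wd a b; rewrite /bwt /bcw /bstar; case: (split_ordP a) => i ->;
  case: (split_ordP b) => j ->; rewrite ?eq_lshift ?eq_rshift ?eq_lrshift ?eq_rlshift
    ?wc ?dc ?wd ?subrr //.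
exact: half_pair wdel_cdel.
Qed.

End Block.

Lemma half_cartan_eps (x : 'rV[C]_(m + n)) b :
  row_mx (lsubmx x) (- lsubmx x) 0 b = weight_eval (half_wt weps b) x.
Proof. by apply: half_cartan_entry => k; rewrite mxE weval_eps. Qed.

Definition even_basis : weight_basis C OSPeven m n :=
  @WeightBasis C OSPeven m n (bstar (@half_star m)) (@bsg _)
    (bwt (half_wt weps)) (bcw (half_cw ceps))
    (bstarK (@half_starK m)) (bpar_star _) (bsg_star _)
    (fun a b => bgram a b (@half_gram_even m))
    (fun x => bcartan (half_cartan_eps x))
    (bwt_star (half_wt_star weps))
    (bpairing (fun a b => half_pair a b weps_ceps) (fun d b => half_pair0 _ _ wdel_ceps)
       (fun d b => half_pair0 _ _ weps_cdel))
    (bcw_star (half_cw_star ceps)).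

Section Odd.

(** The additional basis vector of the odd orthogonal space has weight 0 and is its own partner. *)
Definition o3star (b : 'I_(m + m + 1)) : 'I_(m + m + 1) :=
  match split b with inl c => lshift 1 (half_star c) | inr z => rshift (m + m) z end.

Definition o3wt (b : 'I_(m + m + 1)) : weight m n :=
  match split b with inl c => half_wt weps c | inr _ => 0 end.

Definition o3cw (b : 'I_(m + m + 1)) : 'rV[C]_(m + n) :=
  match split b with inl c => half_cw ceps c | inr _ => 0 end.

Lemma o3starK : involutive o3star.
Proof.
by move=> a; rewrite /o3star; case: (split_ordP a) => i ->;
  rewrite ?split_lshift ?split_rshift ?half_starK.
Qed.

Lemma o3gram i j : block_mx (block_mx 0 1%:M 1%:M 0) 0 0 1%:M i j = (j == o3star i)%:R :> C.
Proof.
rewrite /o3star; case: (split_ordP i) => k ->; case: (split_ordP j) => l ->;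
  rewrite ?block_mxEul ?block_mxEur ?block_mxEdl ?block_mxEdr
    ?eq_lshift ?eq_rshift ?eq_lrshift ?eq_rlshift ?half_gram_even ?mxE //.
by rewrite eq_sym.
Qed.

Lemma o3cartan (x : 'rV[C]_(m + n)) b :
  row_mx (row_mx (lsubmx x) (- lsubmx x)) 0 0 b = weight_eval (o3wt b) x.
Proof.
rewrite /o3wt; case: (split_ordP b) => k ->; rewrite ?row_mxEl ?row_mxEr.
  exact: half_cartan_eps.
by rewrite mxE weval0.
Qed.

Lemma o3wt_star b : o3wt (o3star b) = - o3wt b.
Proof.
by rewrite /o3wt /o3star; case: (split b) => k;
  rewrite ?split_lshift ?split_rshift ?half_wt_star ?oppr0.
Qed.

Lemma o3cw_star b : o3cw (o3star b) = - o3cw b.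
Proof.
by rewrite /o3cw /o3star; case: (split b) => k;
  rewrite ?split_lshift ?split_rshift ?half_cw_star ?oppr0.
Qed.

Lemma o3pairing a b : weight_eval (o3wt b) (o3cw a) = (b == a)%:R - (b == o3star a)%:R.
Proof.
rewrite /o3wt /o3cw /o3star; case: (split_ordP a) => i ->; case: (split_ordP b) => j ->;
  rewrite ?eq_lshift ?eq_rshift ?eq_lrshift ?eq_rlshift ?weval0 ?weight_eval_0r ?subrr //.
exact: half_pair weps_ceps.
Qed.

Lemma o3pair_del d b : weight_eval (half_wt wdel d) (o3cw b) = 0.
Proof.
rewrite /o3cw; case: (split b) => k; last exact: weight_eval_0r.
exact: half_pair0 wdel_ceps.
Qed.

Lemma o3pair_eps d b : weight_eval (o3wt b) (half_cw cdel d) = 0.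
Proof.
rewrite /o3wt; case: (split b) => k; last exact: weval0.
exact: half_pair0 weps_cdel.
Qed.

Definition odd_basis : weight_basis C OSPodd m n :=
  @WeightBasis C OSPodd m n (bstar o3star) (@bsg _) (bwt o3wt) (bcw o3cw)
    (bstarK o3starK) (bpar_star _) (bsg_star _) (fun a b => bgram a b o3gram)
    (fun x => bcartan (o3cartan x)) (bwt_star o3wt_star)
    (bpairing o3pairing o3pair_del o3pair_eps) (bcw_star o3cw_star).

End Odd.

End WeightBases.

(** * Inequalities for the highest weights of osp *)

Section Dominance.

Variables (C : numClosedFieldType) (g : superType) (m n : nat).
Hypothesis osp : ~~ is_gl g.
Variable B : weight_basis C g m n.
Local Notation I := 'I_(evdim g m + odddim g n).
Variables (E : 'I_m -> I) (D : 'I_n -> I).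
Hypotheses (wtE : forall i, wt B (E i) = eps m n i.+1)
           (wtD : forall j, wt B (D j) = del m n j.+1)
           (parE : forall i, ~~ parity (E i)) (parD : forall j, parity (D j))
           (cwE : forall i, coweight B (E i) = delta_mx 0 (lshift n i))
           (cwD : forall j, coweight B (D j) = delta_mx 0 (rshift m j)).

Lemma E_inj i k : (E i == E k) = (i == k).
Proof.
apply/eqP/eqP => [ik|->//]; have := wtE i; rewrite ik wtE => /rowP/(_ (lshift n k)).
rewrite !eps_lshift eqxx; have [/val_inj-> //|_ /eqP] := eqVneq (k : nat) i.
by rewrite oner_eq0.
Qed.

Lemma E_star i k : (E i == star B (E k)) = false.
Proof.
apply/eqP => ik; have := wtE i; rewrite ik wt_star wtE => /rowP/(_ (lshift n i)).
rewrite mxE !eps_lshift eqxx => /eqP; case: (i == k :> nat) => /=.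
all: by [].
Qed.

Lemma D_inj j k : (D j == D k) = (j == k).
Proof.
apply/eqP/eqP => [jk|->//]; have := wtD j; rewrite jk wtD => /rowP/(_ (rshift m k)).
rewrite !del_rshift eqxx; have [/val_inj-> //|_ /eqP] := eqVneq (k : nat) j.
by rewrite oner_eq0.
Qed.

Lemma D_star j k : (D j == star B (D k)) = false.
Proof.
apply/eqP => jk; have := wtD j; rewrite jk wt_star wtD => /rowP/(_ (rshift m j)).
rewrite mxE !del_rshift eqxx => /eqP; case: (j == k :> nat) => /=.
all: by [].
Qed.

Variable lam : 'rV[int]_(m + n).

Lemma pairing_E i : pairing B (int_weight lam) (E i) = (lam 0 (lshift n i))%:~R.
Proof.
rewrite /pairing cwE /weight_eval (bigD1 (lshift n i)) //= !mxE !eqxx mulr1 big1 => [|k ki].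
  by rewrite addr0 ratr_int.
by rewrite !mxE (negbTE ki) andbF mulr0.
Qed.

Lemma pairing_D j : pairing B (int_weight lam) (D j) = (lam 0 (rshift m j))%:~R.
Proof.
rewrite /pairing cwD /weight_eval (bigD1 (rshift m j)) //= !mxE !eqxx mulr1 big1 => [|k kj].
  by rewrite addr0 ratr_int.
by rewrite !mxE (negbTE kj) andbF mulr0.
Qed.

Variables (V : vectType C) (V_ : bool -> {vspace V})
  (r : 'M[C]_(evdim g m + odddim g n) -> 'End(V)) (v : V).
Hypothesis Mod : @is_module C g m n V V_ r.
Hypothesis hw : @highest_weight_vector C g m n V r (int_weight lam) v.

Lemma hw_neq0 : v != 0. Proof. by case: hw. Qed.

Lemma hw_weight : weight_vector r (int_weight lam) v. Proof. by case: hw. Qed.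

Lemma hw_kill a b : wt B a - wt B b \in even_pos g m n ++ odd_pos g m n ->
  r (rv B a b) v = 0.
Proof.
case: hw => _ _ H pos; apply: (H (pp a b) _ _ pos); first exact: rv_in_g.
exact: rv_root_vector.
Qed.

Lemma hw_kill_even a b : wt B a - wt B b \in even_pos g m n -> r (rv B a b) v = 0.
Proof. by move=> ab; apply: hw_kill; rewrite mem_cat ab. Qed.

Lemma hw_kill_odd a b : wt B a - wt B b \in odd_pos g m n -> r (rv B a b) v = 0.
Proof. by move=> ab; apply: hw_kill; rewrite mem_cat ab orbT. Qed.

Lemma ppEE i k : pp (E i) (E k) = false.
Proof. by rewrite /pp !(negbTE (parE _)). Qed.

Lemma ppDD j k : pp (D j) (D k) = false. Proof. by rewrite /pp !parD. Qed.

Lemma hw_eps_le (i k : 'I_m) : (i < k)%N -> lam 0 (lshift n k) <= lam 0 (lshift n i).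
Proof.
move=> ik; have ik' : (i == k) = false by rewrite -val_eqE /= ltn_eqF.
have e : r (rv B (E i) (E k)) v = 0.
  apply: hw_kill_even; rewrite !wtE; apply: pos_eps_eps osp ik _.
  by rewrite !inE eqxx orbT.
have := even_primitive osp Mod (ppEE i k) _ _ _ hw_neq0 hw_weight e.
rewrite E_inj !E_star ik' => /(_ isT isT isT).
by rewrite !pairing_E subr_ge0 ler_int.
Qed.

Lemma hw_eps_add (i k : 'I_m) : (i < k)%N -> 0 <= lam 0 (lshift n i) + lam 0 (lshift n k).
Proof.
move=> ik; have ik' : (i == k) = false by rewrite -val_eqE /= ltn_eqF.
have e : r (rv B (E i) (star B (E k))) v = 0.
  apply: hw_kill_even; rewrite wt_star !wtE opprK; apply: pos_eps_eps osp ik _.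
  by rewrite !inE eqxx.
have pik : pp (E i) (star B (E k)) = false by rewrite /pp parity_star -/(pp _ _) ppEE.
have := even_primitive osp Mod pik _ _ _ hw_neq0 hw_weight e.
rewrite starK E_inj !E_star ik' => /(_ isT isT isT).
by rewrite pairing_star opprK !pairing_E -intrD ler0z.
Qed.

Lemma hw_del_le (j k : 'I_n) : (j < k)%N -> lam 0 (rshift m k) <= lam 0 (rshift m j).
Proof.
move=> jk; have jk' : (j == k) = false by rewrite -val_eqE /= ltn_eqF.
have e : r (rv B (D j) (D k)) v = 0.
  apply: hw_kill_even; rewrite !wtD; apply: pos_del_del osp jk _.
  by rewrite !inE eqxx orbT.
have := even_primitive osp Mod (ppDD j k) _ _ _ hw_neq0 hw_weight e.
rewrite D_inj !D_star jk' => /(_ isT isT isT).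
by rewrite !pairing_D subr_ge0 ler_int.
Qed.

Lemma hw_long j : r (rv B (D j) (star B (D j))) v = 0.
Proof.
by apply: hw_kill_even; rewrite wt_star !wtD opprK -mulr2n; apply: pos_del2.
Qed.

Lemma hw_del_ge0 j : 0 <= lam 0 (rshift m j).
Proof.
have [+ _] := long_primitive osp Mod (parD j) hw_neq0 hw_weight (hw_long j).
by rewrite pairing_D ler0z.
Qed.

(** As del_j precedes eps_i in [Sigma], both del_j + eps_i and del_j - eps_i are positive, and
    [long_trivial] applies to the highest weight vector. *)
Lemma hw_del_eps (j : 'I_n) (i : 'I_m) : (key g m n (false, j : nat) < key g m n (true, i : nat))%N ->
  lam 0 (rshift m j) = 0 -> lam 0 (lshift n i) = 0.
Proof.
move=> ji Mj.
have P a : a \in [:: eps m n i.+1 + del m n j.+1; - eps m n i.+1 + del m n j.+1] ->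
    a \in odd_pos g m n.
  by move=> aP; apply: (@pos_eps_del m n g i j) => //; rewrite ltnNge (ltnW ji).
have e1 : r (rv B (D j) (E i)) v = 0.
  by apply: hw_kill_odd; rewrite wtD wtE P // !inE [- _ + _]addrC eqxx orbT.
have e2 : r (rv B (D j) (star B (E i))) v = 0.
  by apply: hw_kill_odd; rewrite wt_star wtD wtE P // !inE opprK [del _ _ _ + _]addrC eqxx.
have := long_trivial osp Mod (parD j) (parE i) hw_neq0 hw_weight (hw_long j) e1 e2.
rewrite pairing_D pairing_E Mj => /(_ erefl) /eqP.
by rewrite intr_eq0 => /eqP.
Qed.

End Dominance.

Section DominantWeights.

Variables (C : numClosedFieldType) (m n : nat).
Implicit Types (lam : 'rV[int]_(m + n)).

Definition einE (i : 'I_m) : 'I_((m + m) + (n + n)) := lshift (n + n) (lshift m i).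
Definition einD (j : 'I_n) : 'I_((m + m) + (n + n)) := rshift (m + m) (lshift n j).
Definition oinE (i : 'I_m) : 'I_((m + m + 1) + (n + n)) :=
  lshift (n + n) (lshift 1 (lshift m i)).
Definition oinD (j : 'I_n) : 'I_((m + m + 1) + (n + n)) := rshift (m + m + 1) (lshift n j).
Definition oin0 : 'I_((m + m + 1) + (n + n)) := lshift (n + n) (rshift (m + m) ord0).

Lemma wt_einE i : wt (even_basis C m n) (einE i) = eps m n i.+1.
Proof. by rewrite /= /bwt split_lshift /half_wt split_lshift. Qed.
Lemma wt_einD j : wt (even_basis C m n) (einD j) = del m n j.+1.
Proof. by rewrite /= /bwt split_rshift /half_wt split_lshift. Qed.
Lemma cw_einE i : coweight (even_basis C m n) (einE i) = delta_mx 0 (lshift n i).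
Proof. by rewrite /= /bcw split_lshift /half_cw split_lshift. Qed.
Lemma cw_einD j : coweight (even_basis C m n) (einD j) = delta_mx 0 (rshift m j).
Proof. by rewrite /= /bcw split_rshift /half_cw split_lshift. Qed.
Lemma par_einE i : ~~ @parity OSPeven m n (einE i). Proof. by rewrite /parity bpar_lshift. Qed.
Lemma par_einD j : @parity OSPeven m n (einD j). Proof. by rewrite /parity /= leq_addr. Qed.

Lemma wt_oinE i : wt (odd_basis C m n) (oinE i) = eps m n i.+1.
Proof. by rewrite /= /bwt split_lshift /o3wt split_lshift /half_wt split_lshift. Qed.
Lemma wt_oinD j : wt (odd_basis C m n) (oinD j) = del m n j.+1.
Proof. by rewrite /= /bwt split_rshift /half_wt split_lshift. Qed.
Lemma wt_oin0 : wt (odd_basis C m n) oin0 = 0.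
Proof. by rewrite /= /bwt split_lshift /o3wt split_rshift. Qed.
Lemma cw_oinE i : coweight (odd_basis C m n) (oinE i) = delta_mx 0 (lshift n i).
Proof. by rewrite /= /bcw split_lshift /o3cw split_lshift /half_cw split_lshift. Qed.
Lemma cw_oinD j : coweight (odd_basis C m n) (oinD j) = delta_mx 0 (rshift m j).
Proof. by rewrite /= /bcw split_rshift /half_cw split_lshift. Qed.
Lemma par_oinE i : ~~ @parity OSPodd m n (oinE i). Proof. by rewrite /parity bpar_lshift. Qed.
Lemma par_oinD j : @parity OSPodd m n (oinD j). Proof. by rewrite /parity /= leq_addr. Qed.
Lemma par_oin0 : ~~ @parity OSPodd m n oin0. Proof. by rewrite /parity bpar_lshift. Qed.

Lemma star_oin0 : star (odd_basis C m n) oin0 = oin0.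
Proof. by rewrite /= /bstar split_lshift /o3star split_rshift. Qed.

(** Necessary conditions for finite dimension, from which the tail coordinates are read off. *)
Record osp_dominant (g : superType) lam : Prop := OspDominant {
  eps_le : forall i k : 'I_m, (i < k)%N -> lam 0 (lshift n k) <= lam 0 (lshift n i);
  eps_add : forall i k : 'I_m, (i < k)%N -> 0 <= lam 0 (lshift n i) + lam 0 (lshift n k);
  del_le : forall j k : 'I_n, (j < k)%N -> lam 0 (rshift m k) <= lam 0 (rshift m j);
  del_ge0 : forall j : 'I_n, 0 <= lam 0 (rshift m j);
  del_eps : forall (j : 'I_n) (i : 'I_m),
    (key g m n (false, j : nat) < key g m n (true, i : nat))%N ->
    lam 0 (rshift m j) = 0 -> lam 0 (lshift n i) = 0
}.

Lemma even_dominant lam : Lambda_plus C OSPeven lam -> osp_dominant OSPeven lam.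
Proof.
case=> V [V_ [r [Mod _ [v hw]]]]; split.
- exact: (hw_eps_le (g := OSPeven) isT wt_einE par_einE cw_einE Mod hw).
- exact: (hw_eps_add (g := OSPeven) isT wt_einE par_einE cw_einE Mod hw).
- exact: (hw_del_le (g := OSPeven) isT wt_einD par_einD cw_einD Mod hw).
- exact: (hw_del_ge0 (g := OSPeven) isT wt_einD par_einD cw_einD Mod hw).
- exact: (hw_del_eps (g := OSPeven) isT wt_einE wt_einD par_einE par_einD cw_einE cw_einD Mod hw).
Qed.

Lemma odd_dominant lam : Lambda_plus C OSPodd lam -> osp_dominant OSPodd lam.
Proof.
case=> V [V_ [r [Mod _ [v hw]]]]; split.
- exact: (hw_eps_le (g := OSPodd) isT wt_oinE par_oinE cw_oinE Mod hw).
- exact: (hw_eps_add (g := OSPodd) isT wt_oinE par_oinE cw_oinE Mod hw).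
- exact: (hw_del_le (g := OSPodd) isT wt_oinD par_oinD cw_oinD Mod hw).
- exact: (hw_del_ge0 (g := OSPodd) isT wt_oinD par_oinD cw_oinD Mod hw).
- exact: (hw_del_eps (g := OSPodd) isT wt_oinE wt_oinD par_oinE par_oinD cw_oinE cw_oinD Mod hw).
Qed.

Local Notation B := (odd_basis C m n).

Lemma oin0_neq i : oinE i != oin0.
Proof. by rewrite /oinE /oin0 eq_lshift eq_lrshift. Qed.

Lemma odd_eps_ge0 lam i : Lambda_plus C OSPodd lam -> 0 <= lam 0 (lshift n i).
Proof.
case=> V [V_ [r [Mod _ [v hw]]]].
have e : r (rv B (oinE i) oin0) v = 0.
  by apply: (hw_kill_even (g := OSPodd) isT hw); rewrite wt_oinE wt_oin0 subr0 pos_eps.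
have p0 : @pp OSPodd m n (oinE i) oin0 = false.
  by rewrite /pp (negbTE (par_oinE i)) (negbTE par_oin0).
have := even_primitive (g := OSPodd) (B := B) isT Mod p0 (oin0_neq i) _ _ (hw_neq0 hw) (hw_weight hw) e.
rewrite star_oin0 oin0_neq (E_star wt_oinE) => /(_ isT isT).
have -> : pairing B (int_weight lam) oin0 = 0.
  by rewrite /pairing /= /bcw split_lshift /o3cw split_rshift weight_eval_0r.
by rewrite subr0 (pairing_E cw_oinE) ler0z.
Qed.

(** The three inequalities say that the letters occur in [Sigma] in the order eps_i1, del_j1,
    eps_i2, del_j2, which makes the root vectors in [no_repeated_half] positive. *)
Lemma odd_no_repeated_half lam (i1 i2 : 'I_m) (j1 j2 : 'I_n) : Lambda_plus C OSPodd lam ->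
  (i1 + n <= j1 + m)%N -> (j1 + m < i2 + n)%N -> (i2 + n <= j2 + m)%N ->
  lam 0 (lshift n i1) = 1 -> lam 0 (lshift n i2) = 1 -> lam 0 (rshift m j2) <> 0.
Proof.
move=> LP k1 k2 k3 l1 l2 l3; have dom := odd_dominant LP.
case: LP => V [V_ [r [Mod _ [v hw]]]].
have i12 : (i1 < i2)%N by lia.
have j12 : (j1 < j2)%N by lia.
have ni : (i1 == i2) = false by rewrite -val_eqE /= ltn_eqF.
have nj : (j1 == j2) = false by rewrite -val_eqE /= ltn_eqF.
have K a b : wt B a - wt B b \in even_pos OSPodd m n ++ odd_pos OSPodd m n -> r (rv B a b) v = 0.
  exact: (hw_kill (g := OSPodd) isT hw).
have Ke a b : wt B a - wt B b \in even_pos OSPodd m n -> r (rv B a b) v = 0.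
  by move=> ab; apply: K; rewrite mem_cat ab.
have Ko a b : wt B a - wt B b \in odd_pos OSPodd m n -> r (rv B a b) v = 0.
  by move=> ab; apply: K; rewrite mem_cat ab orbT.
have ed (i : 'I_m) (j : 'I_n) : (i + n <= j + m)%N -> r (rv B (oinE i) (oinD j)) v = 0.
  move=> ij; apply: Ko; rewrite wt_oinE wt_oinD.
  apply: (@pos_eps_del m n OSPodd i j) => //.
  by rewrite ifT ?inE ?eqxx ?orbT // /key /=; lia.
have de (i : 'I_m) (j : 'I_n) : (j + m < i + n)%N -> r (rv B (oinD j) (oinE i)) v = 0.
  move=> ij; apply: Ko; rewrite wt_oinE wt_oinD.
  apply: (@pos_eps_del m n OSPodd i j) => //.
  by rewrite ifF ?inE 1?addrC ?eqxx ?orbT // /key /=; lia.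
have /eqP := hw_neq0 hw; apply.
apply: (@no_repeated_half C OSPodd m n B isT V V_ r Mod (int_weight lam) v
  (oinE i1) (oinE i2) (oinD j1) (oinD j2) oin0).
- have sE i : star B (oinE i) = lshift (n + n) (lshift 1 (rshift m i)).
    by rewrite /= /bstar split_lshift /o3star split_lshift /half_star split_lshift.
  have sD j : star B (oinD j) = rshift (m + m + 1) (rshift n j).
    by rewrite /= /bstar split_rshift /half_star split_lshift.
  rewrite !sE !sD /oinE /oinD /oin0 cons_uniq.
  by rewrite /= !inE !(eq_lshift, eq_rshift, eq_lrshift, eq_rlshift) ni nj.
- exact: star_oin0.
- exact: par_oinE.
- exact: par_oinE.
- exact: par_oinD.
- exact: par_oinD.
- exact: par_oin0.
- exact: hw_weight hw.
- by apply: Ke; rewrite wt_oinE wt_oin0 subr0 pos_eps.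
- by apply: Ko; rewrite wt_oinD wt_oin0 subr0 pos_del.
- by apply: Ko; rewrite wt_oinD wt_oin0 subr0 pos_del.
- by apply: ed; lia.
- apply: Ke; rewrite !wt_oinD; apply: (pos_del_del (g := OSPodd) isT j12).
  by rewrite !inE eqxx orbT.
- by apply: de; lia.
- apply: Ke; rewrite !wt_oinE; apply: (pos_eps_eps (g := OSPodd) isT i12).
  by rewrite !inE eqxx orbT.
- by apply: ed; lia.
- by apply: ed; lia.
- by rewrite (pairing_E cw_oinE) l1.
- by rewrite (pairing_E cw_oinE) l2.
- by rewrite (pairing_D cw_oinD) l3.
- by rewrite (pairing_D cw_oinD) ler0z (del_ge0 dom).
Qed.

End DominantWeights.

(** * Inequalities for the highest weights of gl *)

Section DominanceGl.

Variables (C : numClosedFieldType) (m n : nat) (lam : 'rV[int]_(m + n)).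
Local Notation smx := 'M[C]_(m + n).
Implicit Types a b : 'I_(m + n).

Definition gwt a : weight m n :=
  match split a with inl i => eps m n i.+1 | inr j => del m n j.+1 end.

Lemma gwt_eval a (x : 'rV[C]_(m + n)) : weight_eval (gwt a) x = x 0 a.
Proof.
by rewrite /gwt; case: (split_ordP a) => i ->; rewrite ?weval_eps ?weval_del.
Qed.

Lemma gl_cartan_delta (x : 'rV[C]_(m + n)) a b :
  diag_mx x *m delta_mx a b - delta_mx a b *m diag_mx x = (x 0 a - x 0 b) *: delta_mx a b :> smx.
Proof.
rewrite mul_diag_mx mul_mx_diag; apply/matrixP => c d; rewrite !mxE.
have [/andP[/eqP-> /eqP->]|_] := boolP ((c == a) && (d == b)); rewrite /=; ring.
Qed.

Lemma gl_in_g_delta a b : @parity GL m n a = @parity GL m n b ->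
  @in_g C GL m n false (delta_mx a b : smx).
Proof.
move=> ab; split=> //; apply: homogeneous_entries => c d; rewrite mxE.
have [/andP[/eqP-> /eqP->]|] := boolP ((c == a) && (d == b)); last by rewrite eqxx.
by rewrite ab addbb.
Qed.

Lemma gl_in_g_cartan (x : 'rV[C]_(m + n)) : @in_g C GL m n false (diag_mx x : smx).
Proof.
split=> //; apply: homogeneous_entries => c d; rewrite mxE.
by have [->|] := eqVneq c d; rewrite ?addbb // mulr0n eqxx.
Qed.

(** The sl2-triple consists of the matrix units E_ab, E_ba and of E_aa - E_bb. *)
Lemma gl_dominant a b : Lambda_plus C GL lam -> @parity GL m n a = @parity GL m n b ->
  a != b -> gwt a - gwt b \in even_pos GL m n -> lam 0 b <= lam 0 a.
Proof.
case=> V [V_ [r [Mod _ [v [v0 vw vk]]]]] pab ab pos.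
pose x : 'rV[C]_(m + n) := delta_mx 0 a - delta_mx 0 b.
have e : r (delta_mx a b) v = 0.
  apply: (vk false _ (gwt a - gwt b)).
  - by rewrite mem_cat pos.
  - exact: gl_in_g_delta.
  move=> y; rewrite /cartan gl_cartan_delta sum_weight_eval weight_evalN.
  by rewrite !gwt_eval.
have Iab := gl_in_g_delta pab; have Iba := gl_in_g_delta (esym pab).
have ba : b != a by rewrite eq_sym.
have xa : x 0 a = 1 by rewrite !mxE !eqxx (negbTE ab) subr0.
have xb : x 0 b = - 1 by rewrite !mxE !eqxx (negbTE ba) sub0r.
have ef u : r (delta_mx a b) (r (delta_mx b a) u)
    = r (delta_mx b a) (r (delta_mx a b) u) + r (diag_mx x) u.
  rewrite (act_swap Mod u Iab Iba) expr0 scale1r; congr (_ + r _ u).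
  rewrite /sbracket expr0 scale1r !mul_delta_mx_cond !eqxx !mulr1n.
  apply/matrixP => c d; rewrite !mxE.
  have [->|cd] := eqVneq c d; first by rewrite !andbb mulr1n !eqxx.
  rewrite mulr0n; have -> : (c == a) && (d == a) = false.
    by apply/negbTE; apply: contra cd => /andP[/eqP-> /eqP->].
  have -> : (c == b) && (d == b) = false.
    by apply/negbTE; apply: contra cd => /andP[/eqP-> /eqP->].
  by rewrite subr0.
have hf u : r (diag_mx x) (r (delta_mx b a) u)
    = r (delta_mx b a) (r (diag_mx x) u) - 2 *: r (delta_mx b a) u.
  rewrite (act_swap Mod u (gl_in_g_cartan x) Iba) expr0 scale1r; congr (_ + _).
  rewrite /sbracket expr0 scale1r gl_cartan_delta xa xb (actZ Mod _ Iba) scale_lfunE.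
  by rewrite -scaleNr; congr (_ *: _); ring.
have hv : r (diag_mx x) v = ((lam 0 a)%:~R - (lam 0 b)%:~R : C) *: v.
  have -> : diag_mx x = cartan GL x by [].
  rewrite vw; congr (_ *: _).
  rewrite /weight_eval (bigD1 a) //= (bigD1 b) //= big1 => [|k /andP[ka kb]].
    by rewrite xa xb !mxE !ratr_int addr0; ring.
  by rewrite /x !mxE (negbTE ka) (negbTE kb) !andbF subrr mulr0.
have [+ _] := sl2_primitive (ltr0n C 2) v0 ef hf e hv.
by rewrite subr_ge0 ler_int.
Qed.

Lemma gl_eps_le (i k : 'I_m) : Lambda_plus C GL lam -> (i < k)%N ->
  lam 0 (lshift n k) <= lam 0 (lshift n i).
Proof.
move=> LP ik; apply: (gl_dominant LP).
- by rewrite /parity /= [(m <= i)%N]leqNgt [(m <= k)%N]leqNgt !ltn_ord.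
- by rewrite eq_lshift -val_eqE /= neq_ltn ik.
by rewrite /gwt !split_lshift; apply: pos_gl_eps.
Qed.

Lemma gl_del_le (j k : 'I_n) : Lambda_plus C GL lam -> (j < k)%N ->
  lam 0 (rshift m k) <= lam 0 (rshift m j).
Proof.
move=> LP jk; apply: (gl_dominant LP).
- by rewrite /parity /= !leq_addr.
- by rewrite eq_rshift -val_eqE /= neq_ltn jk.
by rewrite /gwt !split_rshift; apply: pos_gl_del.
Qed.

End DominanceGl.

(** * The tail coordinates of lambda + rho *)

Section TailCoordinates.

Variables (m n : nat) (lam : 'rV[int]_(m + n)).

Local Notation L i := (lam 0 (lshift n i)).
Local Notation M j := (lam 0 (rshift m j)).

Lemma card_ord_ge k (a : 'I_k) : #|[pred j : 'I_k | (a <= j)%N]| = (k - a)%N.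
Proof.
rewrite -sum1_card (eq_bigl (fun j : 'I_k => (a <= j)%N)) //.
by rewrite -(big_geq_mkord a k xpredT (fun=> 1%N)) sum_nat_const_nat muln1.
Qed.

(** Converts the counts that define the tail into positions: the coordinates counted form a final
    segment. *)
Lemma up_closed_card k (P : pred 'I_k) : (forall i j : 'I_k, (i < j)%N -> P i -> P j) ->
  forall i, P i = (k - #|P| <= i)%N.
Proof.
move=> Pup i; case: (boolP (P i)) => Pi.
  have : (#|[pred j : 'I_k | (i <= j)%N]| <= #|P|)%N.
    apply/subset_leq_card/subsetP => j; rewrite !inE leq_eqVlt => /orP[/eqP/val_inj <- //|ij].
    exact: Pup ij Pi.
  by rewrite card_ord_ge; have := ltn_ord i; lia.
apply/esym/negbTE; rewrite -ltnNge.
have : (#|P| <= #|[pred j : 'I_k | (i < j)%N]|)%N.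
  apply/subset_leq_card/subsetP => j; rewrite !inE ltnNge => Pj.
  apply: contra Pi; rewrite leq_eqVlt => /orP[/eqP/val_inj <- //|ij].
  exact: Pup ij Pj.
have -> : #|[pred j : 'I_k | (i < j)%N]| = (k - i.+1)%N.
  rewrite -sum1_card (eq_bigl (fun j : 'I_k => (i.+1 <= j)%N)) //.
  by rewrite -(big_geq_mkord i.+1 k xpredT (fun=> 1%N)) sum_nat_const_nat muln1.
by have := ltn_ord i; lia.
Qed.

Lemma acoordE g i : acoord g lam 0 i = (L i)%:~R + rho g m n 0 (lshift n i).
Proof. by rewrite /acoord /lam_rho !mxE. Qed.

Lemma bcoordE g j : bcoord g lam 0 j = (M j)%:~R + rho g m n 0 (rshift m j).
Proof. by rewrite /bcoord /lam_rho !mxE. Qed.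

Lemma lam_rho_lshift g i : lam_rho g lam 0 (lshift n i) = acoord g lam 0 i.
Proof. by rewrite /acoord [RHS]mxE. Qed.

Lemma lam_rho_rshift g j : lam_rho g lam 0 (rshift m j) = bcoord g lam 0 j.
Proof. by rewrite /bcoord [RHS]mxE. Qed.

Lemma natr_intE (k : nat) : k%:R = (k%:Z)%:~R :> rat. Proof. by []. Qed.

Lemma even_acoord i : acoord OSPeven lam 0 i = (L i + (m - 1 - n - i)%N%:Z)%:~R.
Proof. by rewrite acoordE rho_even_eps natr_intE -intrD. Qed.

Lemma even_bcoord j : bcoord OSPeven lam 0 j = (M j + (n - m - j)%N%:Z)%:~R.
Proof. by rewrite bcoordE rho_even_del natr_intE -intrD. Qed.

Section Even.

Hypothesis dom : osp_dominant OSPeven lam.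
Let s := tail OSPeven lam.
Let r := (s + (tpar OSPeven lam == 2))%N.

Let Mge0 j : 0 <= M j. Proof. exact: (del_ge0 dom j). Qed.

Lemma even_b0E j : (bcoord OSPeven lam 0 j == 0) = (n - s <= j)%N.
Proof.
have -> : s = #|[pred j | bcoord OSPeven lam 0 j == 0]|.
  by apply: eq_card => k; rewrite !inE normr_eq0.
apply: (@up_closed_card n (fun j => bcoord OSPeven lam 0 j == 0)) => i k ik.
rewrite !even_bcoord !intr_eq0; have := Mge0 i; have := Mge0 k.
by have := del_le dom ik; move: (lam 0 _) (lam 0 _) => x y *; lia.
Qed.

Lemma even_tail_del (j : 'I_n) : (n - s <= j)%N -> lam_rho OSPeven lam 0 (rshift m j) = 0.
Proof. by rewrite -even_b0E lam_rho_rshift => /eqP. Qed.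

Lemma even_M0 (j : 'I_n) : (n - s <= j)%N -> M j = 0 /\ (n - m <= j)%N.
Proof.
rewrite -even_b0E even_bcoord intr_eq0; have := Mge0 j.
by move: (lam 0 _) => x *; split; lia.
Qed.

Lemma even_tail_le_n : (s <= n)%N.
Proof. by rewrite /s /tail /num_b (leq_trans (max_card _)) // card_ord. Qed.

Lemma even_tail_le_m : (s <= m)%N.
Proof.
have [->//|s0] := posnP s; have sn := even_tail_le_n.
have jn : (n - s < n)%N by lia.
have [_] := @even_M0 (Ordinal jn) (leqnn _); rewrite /=; lia.
Qed.

(** The del with index i + n - m stands immediately before eps_i in [Sigma], and lambda vanishes on
    it; [del_eps] transfers this to eps_i. *)
Lemma even_L0 (i : 'I_m) : (m - s <= i)%N -> acoord OSPeven lam 0 i = 0.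
Proof.
move=> si; have sn := even_tail_le_n; have sm := even_tail_le_m; have im := ltn_ord i.
have jn : (i + n - m < n)%N by lia.
have [M0 nm] : M (Ordinal jn) = 0 /\ (n - m <= i + n - m)%N.
  by apply: (@even_M0 (Ordinal jn)); rewrite /=; lia.
have k : (key OSPeven m n (false, (i + n - m)%N) < key OSPeven m n (true, i : nat))%N.
  by rewrite /key /=; lia.
rewrite even_acoord (del_eps dom (j := Ordinal jn) k M0) add0r.
by rewrite (_ : (m - 1 - n - i)%N = 0%N) //; lia.
Qed.

(** For t = 2 some a_(i0) = 0 lies before the last s coordinates, so lambda_(i0) <= 0. If i0 is not
    yet the position just before them, then lambda_i <= lambda_(i0) and lambda_i + lambda_(i0) >= 0
    force both to vanish, and a_i = 0 at that position too. *)
Lemma even_tail_eps : (r <= m)%N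
  /\ forall i : 'I_m, (m - r <= i)%N -> lam_rho OSPeven lam 0 (lshift n i) = 0.
Proof.
have sm := even_tail_le_m.
rewrite /r /tpar; case: (eqVneq (num_a OSPeven lam 0) (num_b OSPeven lam 0)) => /= [_|ab].
  by rewrite addn0; split=> // i si; rewrite lam_rho_lshift even_L0.
rewrite addn1.
have [i0 ai0 i0s] : exists2 i : 'I_m, acoord OSPeven lam 0 i = 0 & (i < m - s)%N.
  have [/existsP[i /andP[/eqP ai is_]]|/existsPn H] :=
    boolP [exists i : 'I_m, (acoord OSPeven lam 0 i == 0) && (i < m - s)%N].
    by exists i.
  case/eqP: ab; rewrite -[RHS]/s /num_a.
  rewrite (eq_card (B := [pred i : 'I_m | (m - s <= i)%N])) => [|i]; last first.
    rewrite !inE normr_eq0; have := H i; rewrite negb_and -leqNgt.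
    case: (leqP (m - s) i) => [si _|_]; last by rewrite orbF => /negbTE.
    by rewrite even_L0 ?eqxx.
  have [s0|s0] := posnP s.
    by rewrite s0 subn0 eq_card0 // => i; rewrite !inE leqNgt ltn_ord.
  have ms : (m - s < m)%N by lia.
  by rewrite (card_ord_ge (Ordinal ms)) /= subKn.
have sm1 : (s < m)%N by lia.
split=> // i si; rewrite lam_rho_lshift.
have [is_|si'] := ltnP i (m - s); last by rewrite even_L0.
have [/val_inj<-//|i0i] := eqVneq (i0 : nat) i.
have lt_i0i : (i0 < i)%N by move: i0i i0s si is_; rewrite neq_ltn; lia.
move: ai0; rewrite !even_acoord => /eqP; rewrite intr_eq0 => /eqP ai0.
have := eps_le dom lt_i0i; have := eps_add dom lt_i0i.
move: ai0; move: (lam 0 _) (lam 0 _) => x y ai0 h1 h2.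
by apply/eqP; rewrite intr_eq0; apply/eqP; lia.
Qed.

End Even.

Lemma half_int_norm (c : int) :
  (`|c%:~R - 2^-1 : rat| == 2^-1) = (c == 0) || (c == 1).
Proof.
rewrite eqr_norml; have -> : (0 <= 2^-1 :> rat) by [].
rewrite andbT !subr_eq addNr (_ : 2^-1 + 2^-1 = 1%:~R :> rat) // eqr_int.
by rewrite (_ : 0 = 0%:~R :> rat) // eqr_int orbC.
Qed.

Lemma half_int_norm_ge0 (c : int) : 0 <= c -> (`|c%:~R + 2^-1 : rat| == 2^-1) = (c == 0).
Proof.
move=> c0; rewrite ger0_norm ?addr_ge0 ?ler0z // -subr_eq0 addrK intr_eq0.
by [].
Qed.

Lemma odd_acoord i : acoord OSPodd lam 0 i = (L i + (m - n - i)%N%:Z)%:~R - 2^-1.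
Proof. by rewrite acoordE rho_odd_eps natr_intE intrD addrA. Qed.

Lemma odd_bcoord j : bcoord OSPodd lam 0 j = (M j + (n - m - 1 - j)%N%:Z)%:~R + 2^-1.
Proof. by rewrite bcoordE rho_odd_del natr_intE intrD addrA. Qed.

Section Odd.

Variable C : numClosedFieldType.
Hypothesis LP : Lambda_plus C OSPodd lam.
Let dom := odd_dominant LP.
Let s := tail OSPodd lam.
Let za := num_a OSPodd lam 2^-1.
Let zb := num_b OSPodd lam 2^-1.

Lemma odd_za (i : 'I_m) : (m - za <= i)%N = (L i + (m - n - i)%N%:Z <= 1).
Proof.
have E k : (`|acoord OSPodd lam 0 k| == 2^-1) = (L k + (m - n - k)%N%:Z <= 1).
  rewrite odd_acoord half_int_norm; have := odd_eps_ge0 k LP.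
  by move: (lam 0 _) => x x0; apply/idP/idP => [/orP[]/eqP|]; lia.
rewrite -E /za /num_a -(@up_closed_card m (fun i => `|acoord OSPodd lam 0 i| == 2^-1)) //.
move=> k l kl; rewrite !E; have := eps_le dom kl.
by move: (lam 0 _) (lam 0 _) => x y *; lia.
Qed.

Lemma odd_zb (j : 'I_n) : (n - zb <= j)%N = (M j + (n - m - 1 - j)%N%:Z == 0).
Proof.
have E k : (`|bcoord OSPodd lam 0 k| == 2^-1) = (M k + (n - m - 1 - k)%N%:Z == 0).
  by rewrite odd_bcoord half_int_norm_ge0 // addr_ge0 // (del_ge0 dom).
rewrite -E /zb /num_b -(@up_closed_card n (fun j => `|bcoord OSPodd lam 0 j| == 2^-1)) //.
move=> k l kl; rewrite !E; have := del_le dom kl; have := del_ge0 dom l; have := del_ge0 dom k.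
by move: (lam 0 _) (lam 0 _) => x y *; lia.
Qed.

Lemma zb_le_n : (zb <= n)%N.
Proof. by rewrite /zb /num_b (leq_trans (max_card _)) // card_ord. Qed.

Lemma za_le_m : (za <= m)%N.
Proof. by rewrite /za /num_a (leq_trans (max_card _)) // card_ord. Qed.

Lemma odd_tail_le : (s <= za)%N /\ (s <= zb)%N.
Proof. by rewrite /s /tail -/za -/zb; lia. Qed.

Lemma odd_tail_le_mn : (s <= m)%N /\ (s <= n)%N.
Proof. by have := odd_tail_le; have := zb_le_n; have := za_le_m; lia. Qed.

Lemma odd_tail_del (j : 'I_n) : (n - s <= j)%N -> lam_rho OSPodd lam 0 (rshift m j) = 2^-1.
Proof.
move=> sj; have [_ szb] := odd_tail_le.
have : (n - zb <= j)%N by lia.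
by rewrite odd_zb lam_rho_rshift odd_bcoord => /eqP ->; rewrite add0r.
Qed.

Lemma odd_M0 (j : 'I_n) : (n - zb <= j)%N -> M j = 0 /\ (n <= m + j.+1)%N.
Proof.
rewrite odd_zb; have := del_ge0 dom j; move: (lam 0 _) => x *; split; lia.
Qed.

(** By monotonicity it suffices to treat the first tail position m - s. There lambda is 0 or 1, and
    1 must be excluded, both when some further b_j equals 1/2 and when none does. *)
Lemma odd_first_zero (i : 'I_m) : (m - s <= i)%N -> L i + (m - n - i)%N%:Z = 0.
Proof.
move=> si; have [sza szb] := odd_tail_le; have [sm sn] := odd_tail_le_mn.
have zbn := zb_le_n; have zam := za_le_m; have im := ltn_ord i.
have c1 (k : 'I_m) : (m - za <= k)%N -> L k + (m - n - k)%N%:Z <= 1 by rewrite odd_za.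
have i0m : (m - s < m)%N by lia.
pose i0 := Ordinal i0m.
have Ei0 : (m - n - (m - s) = 0)%N by lia.
suff Li0 : L i0 = 0.
  have [/val_inj<-|ne] := eqVneq (i0 : nat) i; first by rewrite Li0 /= Ei0.
  have lt : (i0 < i)%N by rewrite ltn_neqAle ne.
  have := eps_le dom lt; rewrite Li0; have := odd_eps_ge0 i LP.
  by move: (lam 0 _) => x *; lia.
apply/eqP; apply: contraT => Li0.
have Li01 : L i0 = 1.
  have := c1 i0; rewrite /= Ei0; have := odd_eps_ge0 i0 LP; move: Li0.
  have : (m - za <= m - s)%N by lia.
  by move: (lam 0 _) => x *; lia.
have half : [exists i, acoord OSPodd lam 0 i == 2^-1].
  by apply/existsP; exists i0; rewrite odd_acoord Li01 /= Ei0.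
(* If s < zb, the del just before this eps in [Sigma] has lambda-coordinate 0, which forces 0 on the
   eps. *)
have [s_zb|zbs] := ltnP s zb.
  have jn : (n - s - 1 < n)%N by lia.
  have [M0 _] : M (Ordinal jn) = 0 /\ (n <= m + (Ordinal jn).+1)%N.
    by apply: odd_M0; rewrite /=; lia.
  have k : (key OSPodd m n (false, (n - s - 1)%N) < key OSPodd m n (true, i0 : nat))%N.
    by rewrite /key /=; lia.
  by move: Li0; rewrite (del_eps dom (j := Ordinal jn) k M0) eqxx.
have szb' : s = zb by lia.
(* With za = zb and a coordinate 1/2 present, the definition of the tail would subtract 1, contrary
   to s = zb. Hence the preceding eps also has |a| = 1/2, so lambda is 1 on two successive eps and
   [odd_no_repeated_half] applies. *)
have zbza : (zb < za)%N.
  rewrite ltn_neqAle; apply/andP; split; last by lia.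
  apply/eqP => zE; have : s = (minn za zb - [&& za == zb, 0 < za
      & [exists i, acoord OSPodd lam 0 i == 2^-1]%R])%N by [].
  by rewrite half zE eqxx minnn; lia.
have i1m : (m - s - 1 < m)%N by lia.
pose i1 := Ordinal i1m.
have lt10 : (i1 < i0)%N by rewrite /=; lia.
have := c1 i1; have := eps_le dom lt10; rewrite Li01 /=.
have ge : (m - za <= m - s - 1)%N by lia.
move=> L1 /(_ ge) L1'.
have Li11 : L i1 = 1 by move: L1 L1'; move: (lam 0 _) => x; lia.
have nz : (m - n - (m - s - 1) = 0)%N.
  by move: L1'; rewrite Li11; lia.
have j1n : (n - s - 1 < n)%N by lia.
have j2n : (n - s < n)%N by lia.
have [M0 _] : M (Ordinal j2n) = 0 /\ (n <= m + (Ordinal j2n).+1)%N.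
  by apply: odd_M0; rewrite /= szb'.
have k1 : (i1 + n <= Ordinal j1n + m)%N by rewrite /=; lia.
have k2 : (Ordinal j1n + m < i0 + n)%N by rewrite /=; lia.
have k3 : (i0 + n <= Ordinal j2n + m)%N by rewrite /=; lia.
by case: (odd_no_repeated_half LP k1 k2 k3 Li11 Li01 M0).
Qed.

Lemma odd_tail_eps (i : 'I_m) : (m - s <= i)%N ->
  lam_rho OSPodd lam 0 (lshift n i) = - 2^-1.
Proof. by move=> si; rewrite lam_rho_lshift odd_acoord odd_first_zero // sub0r. Qed.

End Odd.

End TailCoordinates.

(** * Tail coordinates of a stable weight of gl *)

Section TailGl.

Variables (m n : nat) (lam : 'rV[int]_(m + n)).

Local Notation L i := (lam 0 (lshift n i)).
Local Notation M j := (lam 0 (rshift m j)).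

Lemma gl_acoord i : acoord GL lam 0 i = (L i + (m - i)%N%:Z)%:~R.
Proof. by rewrite acoordE rho_gl_eps natr_intE -intrD. Qed.

Lemma gl_bcoord j : bcoord GL lam 0 j = (M j - j.+1%:Z)%:~R.
Proof. by rewrite bcoordE rho_gl_del natr_intE -intrB. Qed.

(** A strictly decreasing integer sequence bounded below by c exceeds c by at least the distance to
    the end. By induction on l, the value c + l can only be attained at distance l. *)
Lemma decreasing_run k (f : 'I_k -> int) (c : int) (s : nat) :
  (forall i j : 'I_k, (i < j)%N -> f j + (j%:Z - i%:Z) <= f i) ->
  (forall i, c <= f i) -> (forall l, (l < s)%N -> exists i, f i = c + l%:Z) ->
  (s <= k)%N /\ forall i : 'I_k, (k - s <= i)%N -> f i = c + (k - 1 - i)%N%:Z.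
Proof.
move=> fd fc fs.
have lower (i : 'I_k) : c + (k - 1 - i)%N%:Z <= f i.
  have ik := ltn_ord i; have k1 : (k - 1 < k)%N by lia.
  have [->|ne] := eqVneq i (Ordinal k1).
    by have := fc (Ordinal k1); rewrite /= subnn addr0.
  have lt : (i < Ordinal k1)%N.
    have {}ne : (i : nat) != (k - 1)%N by rewrite -[(k - 1)%N]/(val (Ordinal k1)) val_eqE.
    by rewrite /=; lia.
  have := fd i (Ordinal k1) lt; have := fc (Ordinal k1); rewrite /=.
  by move: (f i) (f _) => x y *; lia.
have H l : (l < s)%N -> exists2 i : 'I_k, f i = c + l%:Z & (k - 1 - i)%N = l.
  elim/ltn_ind: l => l IH ls; have [i fi] := fs l ls; exists i => //.
  have := lower i; rewrite fi => lo; have le : (k - 1 - i <= l)%N by lia.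
  move: le; rewrite leq_eqVlt => /orP[/eqP //|lt].
  have [i' fi' i'E] := IH _ lt (ltn_trans lt ls).
  have ii' : i' = i.
    by apply: val_inj => /=; have := ltn_ord i; have := ltn_ord i'; lia.
  by move: fi'; rewrite ii' fi; lia.
split=> [|i si].
  have [->//|s0] := posnP s; have s1 : (s - 1 < s)%N by lia.
  by have [i _] := H _ s1; have := ltn_ord i; lia.
have il : (k - 1 - i < s)%N by have := ltn_ord i; lia.
have [i' fi' i'E] := H _ il; rewrite -fi'; congr f.
by apply: val_inj => /=; have := ltn_ord i; have := ltn_ord i'; lia.
Qed.

Variable C : numClosedFieldType.
Hypothesis LP : Lambda_plus C GL lam.
Hypothesis stable : gl_stable GL lam.
Let s := gl_tail GL lam.

(** Stability puts the leftmost cross c to the left of every other occupied position. The run of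
    crosses starting at c therefore consists of the s smallest a_i and of the s smallest -b_j. *)
Lemma gl_tail_coords : (0 < s)%N -> exists c : int,
  [/\ (s <= m)%N, (s <= n)%N,
      forall i : 'I_m, (m - s <= i)%N -> acoord GL lam 0 i = (c + (m - 1 - i)%N%:Z)%:~R
    & forall j : 'I_n, (j < s)%N -> bcoord GL lam 0 j = - (c + j%:Z)%:~R].
Proof.
move=> s0.
have [i0 i0l crosses] : exists2 i, gl_leftmost GL lam i
    & forall l, (l < s)%N -> has_cross GL lam (acoord GL lam 0 i + l%:R).
  pose P (k : 'I_m.+1) := [exists i, gl_leftmost GL lam i
    && [forall l : 'I_k, has_cross GL lam (acoord GL lam 0 i + l%:R)]].
  have sE : s = \max_(k < m.+1 | P k) k by [].
  have [k0 Pk0|P0] := pickP P; last by move: s0; rewrite sE big_pred0.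
  have [k /existsP[i /andP[il /forallP ic]] ks] : exists2 k, P k & s = k.
    rewrite sE (bigop.bigmax_eq_arg _ Pk0); case: arg_maxnP => // k Pk _.
    by exists k.
  by exists i => // l ls; rewrite ks in ls; apply: (ic (Ordinal ls)).
pose f i := L i + (m - i)%N%:Z; pose g (j : 'I_n) := j.+1%:Z - M j.
have aE i : acoord GL lam 0 i = (f i)%:~R by apply: gl_acoord.
have bE j : bcoord GL lam 0 j = - (g j)%:~R.
  by rewrite gl_bcoord -intrN opprB.
have gtE (x : int) : has_gt GL lam x%:~R -> exists i, f i = x.
  by case/existsP => i; rewrite aE eqr_int => /eqP; exists i.
have ltE (x : int) : has_lt GL lam x%:~R -> exists j, g j = x.
  by case/existsP => j; rewrite bE opprK eqr_int => /eqP; exists j.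
have gtI i : has_gt GL lam (f i)%:~R by apply/existsP; exists i; rewrite aE.
have ltI j : has_lt GL lam (g j)%:~R by apply/existsP; exists j; rewrite bE opprK.
pose c := f i0; case/andP: i0l => cr /forallP i0min.
rewrite aE in cr i0min crosses.
have crossc (x : int) : has_cross GL lam x%:~R -> c <= x.
  move=> xc; have [i fi] : exists i, f i = x by apply: gtE; case/andP: xc.
  by have := i0min i; rewrite aE fi xc /= ler_int.
have corec (x : int) : has_core GL lam x%:~R -> c <= x.
  by move=> xc; have := stable cr xc; rewrite ltr_int => /ltW.
have allc (x : int) : has_gt GL lam x%:~R || has_lt GL lam x%:~R -> c <= x.
  move=> h; have [cx|ncx] := boolP (has_cross GL lam x%:~R); first exact: crossc.
  apply: corec; move: h ncx; rewrite /has_core /has_cross.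
  by case: (has_gt _ _ _); case: (has_lt _ _ _).
have fc i : c <= f i by apply: allc; rewrite gtI.
have gc j : c <= g j by apply: allc; rewrite ltI orbT.
have run l : (l < s)%N -> has_cross GL lam (c + l%:Z)%:~R.
  by move=> /crosses; rewrite natr_intE -intrD.
have fd (i j : 'I_m) : (i < j)%N -> f j + (j%:Z - i%:Z) <= f i.
  move=> ij; have := gl_eps_le LP ij; rewrite /f; have := ltn_ord j.
  by move: (lam 0 _) (lam 0 _) => x y *; lia.
(* The numbers -b_j increase with j, so the del are reversed before [decreasing_run] is applied. *)
have gd (i j : 'I_n) : (i < j)%N -> g (rev_ord j) + (j%:Z - i%:Z) <= g (rev_ord i).
  move=> ij; have ij' : (rev_ord j < rev_ord i)%N by rewrite /=; have := ltn_ord j; lia.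
  have := gl_del_le LP ij'; rewrite /g; have := ltn_ord j; have := ltn_ord i.
  by move: (lam 0 _) (lam 0 _) => x y *; rewrite /=; lia.
have [sm fE] : (s <= m)%N /\ forall i : 'I_m, (m - s <= i)%N -> f i = c + (m - 1 - i)%N%:Z.
  by apply: (decreasing_run fd fc) => l ls; apply: gtE; case/andP: (run l ls).
have [sn gE] : (s <= n)%N /\ forall j : 'I_n, (n - s <= j)%N ->
    g (rev_ord j) = c + (n - 1 - j)%N%:Z.
  apply: (decreasing_run gd) => [j|l ls]; first exact: gc.
  have [j gj] : exists j, g j = c + l%:Z by apply: ltE; case/andP: (run l ls).
  by exists (rev_ord j); rewrite rev_ordK.
exists c; split=> // [i si|j js]; first by rewrite aE fE.
rewrite bE -[j in LHS]rev_ordK gE; last by rewrite /=; have := ltn_ord j; lia.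
congr (- (c + _)%:~R); have jn := ltn_ord j.
by rewrite /= (_ : (n - 1 - (n - j.+1) = j)%N) //; lia.
Qed.

End TailGl.

(** * Exponentials of the tail roots *)

Lemma prod_codom (A : comNzRingType) r k (h : 'I_r -> 'I_k) (F : 'I_k -> A) : injective h ->
  \prod_i F i = (\prod_(i | i \notin codom h) F i) * \prod_i F (h i).
Proof.
move=> hi; rewrite (bigID (mem (codom h))) /= mulrC; congr (_ * _).
rewrite -big_uniq ?big_image //.
by rewrite map_inj_uniq ?enum_uniq.
Qed.

Section ExpFactors.

Variables m n : nat.
Local Notation K := (charField m n).
Local Notation P := {mpoly rat[m + n]}.
Implicit Types mu nu : weight m n.

Definition posz (z : int) : nat := if z is Posz d then d else 0.
Definition negz (z : int) : nat := if z is Negz d then d.+1 else 0.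

(** An explicit quotient of monomials, so that relations between exponentials can be refuted by
    evaluation. *)
Lemma exp_fraction mu : exists2 pq : P * P,
  Exp mu * FracField.tofrac pq.2 = FracField.tofrac pq.1
  & forall v : 'I_(m + n) -> rat,
      pq.1.@[v] = \prod_k v k ^+ posz (numq (2 * mu 0 k))
      /\ pq.2.@[v] = \prod_k v k ^+ negz (numq (2 * mu 0 k)).
Proof.
exists (\prod_k 'X_k ^+ posz (numq (2 * mu 0 k)), \prod_k 'X_k ^+ negz (numq (2 * mu 0 k))).
  rewrite ExpE !rmorph_prod -big_split; apply: eq_bigr => k _ /=.
  rewrite !rmorphXn /= -/(XK k).
  case: (numq _) => d /=; first by rewrite expr0 mulr1.
  by rewrite NegzE -exprnN mulVf // expf_neq0 // XK_neq0.
by move=> v /=; rewrite !rmorph_prod; split; apply: eq_bigr => k _;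
  rewrite rmorphXn /= mevalXU.
Qed.

Lemma one_add_Exp_neq0 mu : 1 + Exp mu != 0 :> K.
Proof.
have [[p q] /= pq pqv] := exp_fraction mu; apply/eqP => E0.
have qp : q + p = 0.
  apply/eqP; rewrite -(tofrac_eq0 (q + p)) rmorphD /= -pq -[X in X + _]mul1r -mulrDl.
  by rewrite E0 mul0r.
have := congr1 (meval (fun=> 1)) qp; rewrite mevalD meval0 (pqv _).1 (pqv _).2.
by rewrite !big1 // => k _; rewrite expr1n.
Qed.

(** Evaluation with one variable equal to 2 and the others to 1 isolates one exponent. *)
Lemma Exp_eq1 mu : Exp mu = 1 :> K -> mu = 0.
Proof.
have [[p q] /= pq pqv] := exp_fraction mu => E1.
have qp : q = p by apply/eqP; rewrite -tofrac_eq -pq E1 mul1r.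
apply/rowP => k; rewrite mxE; set e := numq (2 * mu 0 k).
have := congr1 (meval (fun l => if l == k then 2 else 1)) qp.
have E (f : 'I_(m + n) -> nat) :
    \prod_l (if l == k then 2 else 1 : rat) ^+ f l = 2 ^+ f k.
  rewrite (bigD1 k) //= eqxx big1 ?mulr1 // => l /negbTE ->.
  by rewrite expr1n.
rewrite (pqv _).1 (pqv _).2 (E (fun l => negz _)) (E (fun l => posz _)) -/e -!natrX.
move=> /eqP; rewrite eqr_nat eqn_exp2l // => /eqP he.
have e0 : e = 0 by move: he; case: e => [d|d] /= => [<-|].
have /eqP : 2 * mu 0 k = 0 by apply/eqP; rewrite -numq_eq0 -/e e0.
by rewrite mulf_eq0 /= => /eqP.
Qed.

Lemma positive_neq0 (w : seq letter) (alpha : weight m n) : positive w alpha -> alpha != 0.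
Proof.
apply: contraTneq => ->; rewrite /positive.
have W (a b : seq rat) : all (pred1 0) a -> all (pred1 0) b -> all (pred1 0) (word_coords w a b).
  have hd s : all (pred1 0) s -> head 0 s = 0 :> rat /\ all (pred1 0) (behead s).
    by case: s => //= x s /andP[/eqP].
  elim: w a b => [//|[] w IH] a b a0 b0 /=.
    by rewrite (hd _ a0).1 eqxx IH // (hd _ a0).2.
  by rewrite (hd _ b0).1 eqxx IH // (hd _ b0).2.
set l := word_coords _ _ _.
have l0 : all (pred1 0) l.
  by apply: W; apply/allP => x /mapP[i _ ->]; rewrite !mxE /= eqxx.
rewrite (_ : [seq c <- l | c != 0] = [::]) ?ltxx //.
by apply/eqP; rewrite -size_eq0 size_filter -leqn0 leqNgt -has_count -all_predC;
  apply/allP => x /(allP l0) /=; rewrite negbK.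
Qed.

Lemma R_neq0 g : R g m n != 0.
Proof.
have prod_neq0 (s : seq (weight m n)) (F : weight m n -> K) :
    (forall a, a \in s -> F a != 0) -> \prod_(a <- s) F a != 0.
  elim: s => [|a s IH] Fs; first by rewrite big_nil oner_neq0.
  rewrite big_cons; apply: mulf_neq0; first exact/Fs/mem_head.
  by apply: IH => b bs; apply: Fs; rewrite inE bs orbT.
apply: mulf_neq0; last rewrite invr_eq0.
  apply: prod_neq0 => a; rewrite mem_filter => /andP[/positive_neq0 a0 _].
  rewrite subr_eq0 eq_sym; apply: contra a0 => /eqP/Exp_eq1/eqP.
  by rewrite oppr_eq0.
by apply: prod_neq0 => a _; apply: one_add_Exp_neq0.
Qed.

Lemma ExpN mu : Exp (- mu) = (Exp mu)^-1 :> K.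
Proof.
rewrite !ExpE -prodfV; apply: eq_bigr => k _.
by rewrite mxE mulrN numqN -invr_expz.
Qed.

Lemma R_euler_char g lam :
  R g m n * Exp (rho g m n) * euler_char g lam
  = JW g (Exp (lam_rho g lam) / \prod_(a <- tail_odd_pos g lam) (1 + Exp (- a))).
Proof.
have cancel_ab (F : fieldType) (a b c : F) : a != 0 -> b != 0 -> a * b * (a^-1 * b^-1 * c) = c.
  by move=> a0 b0; rewrite -invfM mulVKf // mulf_neq0.
rewrite /euler_char ExpN.
exact: cancel_ab (R_neq0 g) (Exp_neq0 (rho g m n)).
Qed.

Lemma Exp_split mu :
  Exp mu = (\prod_i xe n i ^ numq (2 * mu 0 (lshift n i)))
           * \prod_j xd m j ^ numq (2 * mu 0 (rshift m j)) :> K.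
Proof. by rewrite ExpE big_split_ord. Qed.

Variables (r s : nat) (he : 'I_r -> 'I_m) (hd : 'I_s -> 'I_n).
Hypotheses (he_inj : injective he) (hd_inj : injective hd).

Definition rest mu : K :=
  (\prod_(i | i \notin codom he) xe n i ^ numq (2 * mu 0 (lshift n i)))
  * \prod_(j | j \notin codom hd) xd m j ^ numq (2 * mu 0 (rshift m j)).

Lemma Exp_rest mu : Exp mu = rest mu
  * (\prod_i xe n (he i) ^ numq (2 * mu 0 (lshift n (he i))))
  * \prod_j xd m (hd j) ^ numq (2 * mu 0 (rshift m (hd j))).
Proof.
rewrite Exp_split (prod_codom _ he_inj) (prod_codom _ hd_inj) /rest.
by rewrite -!mulrA; congr (_ * _); rewrite mulrCA.
Qed.

Lemma rest_free mu : tail_free he hd (rest mu).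
Proof.
move=> w t A B wA tB; rewrite rmorphM !rmorph_prod; congr (_ * _).
  apply: eq_bigr => i /wA[wi /negbTE iA].
  by rewrite fmorphXz /= wfrac_xe wi iA expr1z.
apply: eq_bigr => j /tB[tj /negbTE jB].
by rewrite fmorphXz /= wfrac_xd tj jB expr1z.
Qed.

Lemma rest_eq mu nu :
  (forall i, i \notin codom he -> mu 0 (lshift n i) = nu 0 (lshift n i)) ->
  (forall j, j \notin codom hd -> mu 0 (rshift m j) = nu 0 (rshift m j)) ->
  rest mu = rest nu.
Proof.
move=> ee dd; congr (_ * _); apply: eq_bigr => k kh; first by rewrite ee.
by rewrite dd.
Qed.

End ExpFactors.

Section TailIndices.

Variables (k r : nat) (rk : (r <= k)%N).

(** Counting from the end makes the exponents of the staircase grow with the index: index 0 is eps_m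
    or del_n. *)
Definition last_ord (i : 'I_r) : 'I_k := rev_ord (widen_ord rk i).

Lemma last_ord_inj : injective last_ord.
Proof. by move=> i j /rev_ord_inj/(congr1 val) /= /val_inj. Qed.

Lemma codom_last_ord (i : 'I_k) : (i \in codom last_ord) = (k - r <= i)%N.
Proof.
have ik := ltn_ord i; apply/codomP/idP => [[a ->] /=|ri]; first by have := ltn_ord a; lia.
have ar : (k - i.+1 < r)%N by lia.
by exists (Ordinal ar); apply: val_inj => /=; lia.
Qed.

Lemma widen_ord_inj : injective (widen_ord rk).
Proof. by move=> i j /(congr1 val) /= /val_inj. Qed.

Lemma codom_widen_ord (i : 'I_k) : (i \in codom (widen_ord rk)) = (i < r)%N.
Proof.
apply/codomP/idP => [[a ->] /=|ir]; first exact: ltn_ord.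
by exists (Ordinal ir); apply: val_inj.
Qed.

End TailIndices.

Section TailProducts.

Variable F : fieldType.

Lemma prod_codom1 r k (h : 'I_r -> 'I_k) (c : pred 'I_k) (G : 'I_k -> F) : injective h ->
  (forall i, c i = (i \in codom h)) -> \prod_(i | c i) G i = \prod_i G (h i).
Proof.
move=> hi cE; rewrite big_mkcond (prod_codom _ hi) [X in X * _]big1 ?mul1r.
  by apply: eq_bigr => i _; rewrite cE codom_f.
by move=> i /negbTE ih; rewrite cE ih.
Qed.

Lemma prod_if (r s : nat) (c : nat -> nat -> bool) (a : 'I_r -> F) (b : 'I_s -> F) :
  \prod_(i < r) \prod_(j < s) (if c i j then a i else b j)
  = (\prod_i a i ^+ #|[pred j : 'I_s | c i j]|) * \prod_j b j ^+ #|[pred i : 'I_r | ~~ c i j]|.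
Proof.
have -> : \prod_(j < s) b j ^+ #|[pred i : 'I_r | ~~ c i j]|
    = \prod_(i < r) \prod_(j < s | ~~ c i j) b j.
  rewrite (exchange_big_dep xpredT) //=; apply: eq_bigr => j _.
  by rewrite -prodr_const; apply: eq_bigl => i; rewrite inE.
rewrite -big_split; apply: eq_bigr => i _ /=.
rewrite (bigID (fun j : 'I_s => c i j)) /=; congr (_ * _).
  rewrite -prodr_const; apply: eq_big => [j|j ->//]; by rewrite inE.
by apply: eq_bigr => j /negbTE ->.
Qed.

Lemma card_ord_ltn (s i : nat) : (i <= s)%N -> #|[pred j : 'I_s | (j < i)%N]| = i.
Proof.
move=> is_; rewrite -sum1_card -(big_ord_widen_cond s xpredT (fun=> 1%N)) //.
by rewrite sum1_card card_ord.
Qed.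

(** The two positive odd roots in one eps and one del. The monomial left over involves the letter
    that comes first in [Sigma]; [b] says that it is the eps. *)
Lemma even_pair (x y : F) (b : bool) : x != 0 -> y != 0 ->
  (1 + x ^- 2 * y ^- 2) * (1 + if b then x ^- 2 * y ^+ 2 else x ^+ 2 * y ^- 2)
  = (uu x + uu y) * if b then x ^- 2 else y ^- 2.
Proof. by move=> x0 y0; rewrite /uu; case: b; field; rewrite ?x0 ?y0. Qed.

End TailProducts.

Section OddRoots.

Variables m n : nat.
Local Notation K := (charField m n).

Definition pm_root (a b : bool) (i j : nat) : weight m n :=
  (-1) ^+ a *: eps m n i.+1 + (-1) ^+ b *: del m n j.+1.

Lemma pm_rootE i j :
  (eps m n i.+1 + del m n j.+1 = pm_root false false i j)
  * (eps m n i.+1 - del m n j.+1 = pm_root false true i j)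
  * (- eps m n i.+1 + del m n j.+1 = pm_root true false i j).
Proof. by rewrite /pm_root !expr0 !expr1 !scale1r !scaleN1r. Qed.

Lemma pm_rootN a b i j : - pm_root a b i j = pm_root (~~ a) (~~ b) i j.
Proof.
by rewrite /pm_root opprD -!scaleNr; case: a; case: b; rewrite !expr0 !expr1 ?opprK.
Qed.

Lemma pm_root_lshift a b i j (k : 'I_m) :
  pm_root a b i j 0 (lshift n k) = (-1) ^+ a * (k == i :> nat)%:R.
Proof. by rewrite mxE mxE [X in _ + X]mxE eps_lshift del_lshift mulr0 addr0. Qed.

Lemma pm_root_rshift a b i j (k : 'I_n) :
  pm_root a b i j 0 (rshift m k) = (-1) ^+ b * (k == j :> nat)%:R.
Proof. by rewrite mxE mxE [X in _ + X]mxE eps_rshift del_rshift mulr0 add0r. Qed.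

Lemma support_pm_root (T : pred 'I_(m + n)) a b (i : 'I_m) (j : 'I_n) :
  [forall k, (pm_root a b i j 0 k != 0) ==> T k] = T (lshift n i) && T (rshift m j).
Proof.
apply/forallP/andP => [H|[Ti Tj] k].
  split; [have := H (lshift n i)|have := H (rshift m j)];
  by rewrite ?pm_root_lshift ?pm_root_rshift eqxx mulr1 signr_eq0.
case: (split_ordP k) => l ->; rewrite ?pm_root_lshift ?pm_root_rshift.
  by case: (eqVneq (l : nat) i) => [/val_inj ->|_]; rewrite ?mulr0 ?eqxx ?Ti ?implybT.
by case: (eqVneq (l : nat) j) => [/val_inj ->|_]; rewrite ?mulr0 ?eqxx ?Tj ?implybT.
Qed.

Lemma support_del (T : pred 'I_(m + n)) (j : 'I_n) :
  [forall k, (del m n j.+1 0 k != 0) ==> T k] = T (rshift m j).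
Proof.
apply/forallP/idP => [H|Tj k].
  by have := H (rshift m j); rewrite del_rshift eqxx.
case: (split_ordP k) => l ->; rewrite ?del_lshift ?del_rshift ?eqxx //.
by case: (eqVneq (l : nat) j) => [/val_inj ->|_]; rewrite ?eqxx ?Tj ?implybT.
Qed.

Lemma prod_sign_exp k (x : 'I_k -> K) (i : 'I_k) (a : bool) :
  \prod_(l < k) x l ^ numq (2 * ((-1) ^+ a * (l == i :> nat)%:R))
  = if a then x i ^- 2 else x i ^+ 2.
Proof.
rewrite (bigD1 i) //= eqxx big1 ?mulr1; first by case: a.
by move=> l; rewrite -val_eqE => /negbTE /= ->; rewrite !mulr0.
Qed.

Lemma Exp_pm_root a b (i : 'I_m) (j : 'I_n) :
  Exp (pm_root a b i j) = (if a then xe n i ^- 2 else xe n i ^+ 2)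
                          * (if b then xd m j ^- 2 else xd m j ^+ 2) :> K.
Proof.
rewrite Exp_split; congr (_ * _); rewrite -prod_sign_exp; apply: eq_bigr => k _.
  by rewrite pm_root_lshift.
by rewrite pm_root_rshift.
Qed.

Lemma Exp_opp_del (j : 'I_n) : Exp (- del m n j.+1) = xd m j ^- 2 :> K.
Proof.
rewrite Exp_split [X in X * _]big1 ?mul1r => [|i _]; last first.
  by rewrite mxE del_lshift oppr0 mulr0.
rewrite -(prod_sign_exp (fun j => xd m j) j true); apply: eq_bigr => k _.
by rewrite mxE del_rshift mulN1r.
Qed.

End OddRoots.

Section TailRoots.

Variables m n : nat.
Local Notation K := (charField m n).
Variables (lam : 'rV[int]_(m + n)) (r s : nat) (he : 'I_r -> 'I_m) (hd : 'I_s -> 'I_n).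
Hypotheses (he_inj : injective he) (hd_inj : injective hd).

Definition tail_indices g :=
  (forall i, tail_coord g lam (lshift n i) = (i \in codom he))
  /\ forall j, tail_coord g lam (rshift m j) = (j \in codom hd).

Lemma prod_tail_odd_pos g (H : weight m n -> K) :
  \prod_(a <- tail_odd_pos g lam) H a
  = \prod_(a <- odd_pos g m n)
      if [forall k, (a 0 k != 0) ==> tail_coord g lam k] then H a else 1.
Proof. by rewrite /tail_odd_pos big_filter big_mkcond. Qed.

Lemma prod_tail_pairs g (H : 'I_m -> 'I_n -> K) : tail_indices g ->
  \prod_i \prod_j (if tail_coord g lam (lshift n i) && tail_coord g lam (rshift m j)
                   then H i j else 1)
  = \prod_i \prod_j H (he i) (hd j).
Proof.
move=> [Te Td].
rewrite -(prod_codom1 (fun i => \prod_j H i (hd j)) he_inj Te) [RHS]big_mkcond.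
apply: eq_bigr => i _; case: ifP => _; last by rewrite big1.
by rewrite -(prod_codom1 (H i) hd_inj Td) [RHS]big_mkcond.
Qed.

Local Notation Y := (fun j => xd m (hd j)).
Local Notation X := (fun i => xe n (he i)).

Lemma prod_osp_pairs (g : superType) (c c' : nat -> nat -> bool) : tail_indices g ->
  (forall i j, c' (he i) (hd j) = c i j) ->
  \prod_(i < m) \prod_(j < n)
     (if tail_coord g lam (lshift n i) && tail_coord g lam (rshift m j)
      then (1 + Exp (- pm_root m n false false i j))
           * (1 + Exp (- (if c' i j then pm_root m n false true i j
                          else pm_root m n true false i j)))
      else 1)
  = (\prod_i (X i ^- 2) ^+ #|[pred j : 'I_s | c i j]|)
    * (\prod_j (Y j ^- 2) ^+ #|[pred i : 'I_r | ~~ c i j]|) * den he hd :> K.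
Proof.
move=> T cE; rewrite (prod_tail_pairs _ T) -prod_if.
have -> : den he hd = \prod_i \prod_j (uu (X i) + uu (Y j)) by rewrite /den /cauchy_den exchange_big.
rewrite [RHS]mulrC -[RHS]big_split; apply: eq_bigr => i _ /=.
rewrite -[RHS]big_split; apply: eq_bigr => j _ /=.
rewrite cE pm_rootN Exp_pm_root -(even_pair (c i j) (xe_neq0 n (he i)) (xd_neq0 m (hd j))).
by congr (_ * _); case: (c i j); rewrite pm_rootN Exp_pm_root.
Qed.

(** Counted from the end, eps_i precedes del_j exactly when j < i. The exponents count, for each
    letter, the letters of the other kind that it precedes. *)
Lemma prod_tail_even : tail_indices OSPeven -> (s <= r <= s.+1)%N ->
  (forall i, he i = (m - i.+1)%N :> nat) -> (forall j, hd j = (n - j.+1)%N :> nat) ->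
  (r <= m)%N -> (s <= n)%N ->
  \prod_(a <- tail_odd_pos OSPeven lam) (1 + Exp (- a))
  = (\prod_i (X i ^- 2) ^+ i) * (\prod_j (Y j ^- 2) ^+ j.+1) * den he hd :> K.
Proof.
move=> T rs heE hdE rm sn; rewrite prod_tail_odd_pos big_odd_pos_even.
pose c (i j : nat) := (j < i)%N; pose c' (i j : nat) := (i + n < j + m)%N.
have cE i j : c' (he i) (hd j) = c i j.
  by rewrite /c /c' heE hdE; have := ltn_ord i; have := ltn_ord j; lia.
have <- : (\prod_i (X i ^- 2) ^+ #|[pred j : 'I_s | c i j]|)
    * (\prod_j (Y j ^- 2) ^+ #|[pred i : 'I_r | ~~ c i j]|) * den he hd
  = (\prod_i (X i ^- 2) ^+ i) * (\prod_j (Y j ^- 2) ^+ j.+1) * den he hd.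
  congr (_ * _ * _); apply: eq_bigr => i _.
    by rewrite card_ord_ltn //; have := ltn_ord i; move: rs; lia.
  congr (_ ^+ _); rewrite -[RHS](@card_ord_ltn r i.+1); last first.
    by have := ltn_ord i; move: rs; lia.
  by apply: eq_card => a; rewrite !inE /c -leqNgt ltnS.
rewrite -(prod_osp_pairs T cE); apply: eq_bigr => i _; apply: eq_bigr => j _.
rewrite -/(c' i j) !pm_rootE support_pm_root.
case: (c' i j); rewrite support_pm_root; case: ifP => // _; exact: mulr1.
Qed.

(** Here eps_i precedes del_j when j <= i, and the last product comes from the odd roots del_j. *)
Lemma prod_tail_odd : tail_indices OSPodd -> r = s ->
  (forall i, he i = (m - i.+1)%N :> nat) -> (forall j, hd j = (n - j.+1)%N :> nat) ->
  (r <= m)%N -> (s <= n)%N ->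
  \prod_(a <- tail_odd_pos OSPodd lam) (1 + Exp (- a))
  = (\prod_i (X i ^- 2) ^+ i.+1) * (\prod_j (Y j ^- 2) ^+ j) * den he hd
    * \prod_j (1 + Y j ^- 2) :> K.
Proof.
move=> T rs heE hdE rm sn; rewrite prod_tail_odd_pos big_odd_pos_odd.
pose c (i j : nat) := (j <= i)%N; pose c' (i j : nat) := (i + n <= j + m)%N.
have cE i j : c' (he i) (hd j) = c i j.
  by rewrite /c /c' heE hdE; have := ltn_ord i; have := ltn_ord j; lia.
congr (_ * _); last first.
  rewrite -(prod_codom1 (fun j => 1 + xd m j ^- 2) hd_inj T.2) [RHS]big_mkcond.
  by apply: eq_bigr => j _; rewrite support_del Exp_opp_del.
have <- : (\prod_i (X i ^- 2) ^+ #|[pred j : 'I_s | c i j]|)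
    * (\prod_j (Y j ^- 2) ^+ #|[pred i : 'I_r | ~~ c i j]|) * den he hd
  = (\prod_i (X i ^- 2) ^+ i.+1) * (\prod_j (Y j ^- 2) ^+ j) * den he hd.
  congr (_ * _ * _); apply: eq_bigr => i _; congr (_ ^+ _).
    rewrite -[RHS](@card_ord_ltn s i.+1); last by have := ltn_ord i; move: rs; lia.
    by apply: eq_card => a; rewrite !inE.
  rewrite -[RHS](@card_ord_ltn r i); last by have := ltn_ord i; move: rs; lia.
  by apply: eq_card => a; rewrite !inE /c -ltnNge.
rewrite -(prod_osp_pairs T cE); apply: eq_bigr => i _; apply: eq_bigr => j _.
rewrite -/(c' i j) !pm_rootE support_pm_root.
case: (c' i j); rewrite support_pm_root; case: ifP => // _; exact: mulr1.
Qed.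

Lemma prod_tail_gl : tail_indices GL ->
  \prod_(a <- tail_odd_pos GL lam) (1 + Exp (- a))
  = (\prod_i (X i ^- 2) ^+ s)
    * cauchy_den (fun i => X i ^+ 2) (fun j => Y j ^+ 2) :> K.
Proof.
move=> T; rewrite prod_tail_odd_pos big_odd_pos_gl.
pose H (i : 'I_m) (j : 'I_n) : K := 1 + xe n i ^- 2 * xd m j ^+ 2.
transitivity (\prod_i \prod_j H (he i) (hd j)).
  rewrite -(prod_tail_pairs H T); apply: eq_bigr => i _; apply: eq_bigr => j _.
  by rewrite pm_rootE support_pm_root pm_rootN Exp_pm_root.
rewrite /cauchy_den [X in _ * X]exchange_big -[RHS]big_split; apply: eq_bigr => i _ /=.
rewrite -[X in _ ^+ X]card_ord -prodr_const -[RHS]big_split; apply: eq_bigr => j _ /=.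
rewrite /H mulrDr mulVf //.
exact: expf_neq0 (xe_neq0 n (he i)).
Qed.

End TailRoots.

(** * The three cases *)

Section Osp.

Variables m n : nat.
Local Notation K := (charField m n).

Lemma big_isoset (T : Type) (idx : T) (op : Monoid.com_law idx) (s : nat) (f : nat -> weight m n)
    (F : weight m n -> T) :
  \big[op/idx]_(b <- [seq f i | i <- iota 0 s]) F b = \big[op/idx]_(j < s) F (f j).
Proof. by rewrite big_map -{1}[s]subn0 -/(index_iota 0 s) big_mkord. Qed.

Lemma pm_root_iso (i : 'I_m) (j : 'I_n) k l : i = (m - k.+1)%N :> nat -> j = (n - l.+1)%N :> nat ->
  (k < m)%N -> (l < n)%N ->
  (del m n (n - l) - eps m n (m - k) = pm_root m n true false i j)
  * (eps m n (m - k) - del m n (n - l) = pm_root m n false true i j).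
Proof.
by move=> iE jE km ln; rewrite -!pm_rootE iE jE !subnSK // addrC.
Qed.

Lemma prod_isoset_even s (e : 'I_s -> 'I_m) (d : 'I_s -> 'I_n) :
  (s <= m)%N -> (s <= n)%N ->
  (forall i, e i = (m - i.+1)%N :> nat) -> (forall j, d j = (n - j.+1)%N :> nat) ->
  \prod_(b <- isoset OSPeven m n s) (1 + Exp (- b))
  = \prod_j (1 + xe n (e j) ^+ 2 * xd m (d j) ^- 2) :> K.
Proof.
move=> sm sn eE dE; rewrite /isoset big_isoset; apply: eq_bigr => j _.
have jm := leq_trans (ltn_ord j) sm; have jn := leq_trans (ltn_ord j) sn.
by rewrite (pm_root_iso (eE j) (dE j) jm jn) pm_rootN Exp_pm_root.
Qed.

Lemma prod_isoset_odd s (e : 'I_s -> 'I_m) (d : 'I_s -> 'I_n) :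
  (s <= m)%N -> (s <= n)%N ->
  (forall i, e i = (m - i.+1)%N :> nat) -> (forall j, d j = (n - j.+1)%N :> nat) ->
  \prod_(b <- isoset OSPodd m n s) (1 + Exp (- b))
  = \prod_j (1 + xd m (d j) ^+ 2 * xe n (e j) ^- 2) :> K.
Proof.
move=> sm sn eE dE; rewrite /isoset big_isoset; apply: eq_bigr => j _.
have jm := leq_trans (ltn_ord j) sm; have jn := leq_trans (ltn_ord j) sn.
by rewrite (pm_root_iso (eE j) (dE j) jm jn) pm_rootN Exp_pm_root [X in 1 + X]mulrC.
Qed.

(** Joins the cases t = 0 (r = s) and t = 2 (r = s + 1). For s = 0 nothing is symmetrised and the
    constant is 1. *)
Lemma core_even_tail r s (he : 'I_r -> 'I_m) (hd : 'I_s -> 'I_n) (e : 'I_s -> 'I_m) (E : K) :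
  injective he -> injective hd -> tail_free he hd E -> (s <= r <= s.+1)%N ->
  (forall i, he i = (m - i.+1)%N :> nat) -> (forall i, e i = (m - i.+1)%N :> nat) ->
  (if r == s then maxn 1 (2 ^ (s - 1) * s`!) else 2 ^ s * s`!)%N%:R
    * JW OSPeven (E * (\prod_i xe n (he i) ^+ (2 * i)) * (\prod_j xd m (hd j) ^+ (2 * j.+1))
                  / den he hd)
  = JW OSPeven (E * \prod_j (1 + xe n (e j) ^+ 2 * xd m (hd j) ^- 2)^-1).
Proof.
move=> he_inj hd_inj Ef /andP[sr rs] heE eE.
have [s0|s0] := posnP s.
  subst s; rewrite [X in X%:R](_ : _ = 1%N) ?mul1r; last by case: (r == 0%N).
  rewrite /den /cauchy_den !big_ord0 invr1 !mulr1 big1 ?mulr1 // => i _.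
  by have := ltn_ord i; case: (i : nat) => // k; move: rs; lia.
have [rE|rE] : r = s \/ r = s.+1 by lia.
  subst r; rewrite eqxx (maxn_idPr _) ?muln_gt0 ?expn_gt0 ?fact_gt0 //.
  rewrite (core_even he_inj hd_inj Ef s0); congr (JW _ (_ * _)).
  apply: eq_bigr => j _; rewrite (_ : he j = e j) //.
  by apply: val_inj; rewrite /= heE eE.
subst r; rewrite -[X in X == _]addn1 -[X in _ == X]addn0 eqn_add2l.
rewrite (core_even_ones he_inj hd_inj Ef s0); congr (JW _ (_ * _)).
apply: eq_bigr => j _; rewrite (_ : he (lift ord_max j) = e j) //.
by apply: val_inj; rewrite /= heE eE lift_max.
Qed.

Variable lam : 'rV[int]_(m + n).

(** Since lambda + rho vanishes on the tail, its exponential is tail-free, and the staircase comes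
    from the denominator alone. *)
Lemma even_identity : osp_dominant OSPeven lam ->
  (j_osp OSPeven lam)%:R * (R OSPeven m n * Exp (rho OSPeven m n) * euler_char OSPeven lam)
  = KW OSPeven (lam_rho OSPeven lam) (isoset OSPeven m n (tail OSPeven lam)).
Proof.
move=> dom; have [] := even_tail_eps dom.
have d0 j := @even_tail_del _ _ _ dom j.
have sn := even_tail_le_n lam; have sm := even_tail_le_m dom.
set s := tail _ _; set r := (s + _)%N => rm e0.
have rs : (s <= r <= s.+1)%N by rewrite /r; case: (_ == 2); rewrite ?addn0 ?addn1 leqnn leqnSn.
have jE : j_osp OSPeven lam
    = (if r == s then maxn 1 (2 ^ (s - 1) * s`!) else 2 ^ s * s`!)%N.
  rewrite /j_osp -/s (_ : (r == s) = (tpar OSPeven lam == 0)) // /r /tpar.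
  by case: (num_a _ _ _ == _); rewrite ?addn0 ?addn1 ?eqxx // gtn_eqF.
pose he := last_ord rm; pose hd := last_ord sn; pose e := last_ord sm.
have heE i : he i = (m - i.+1)%N :> nat by [].
have hdE i : hd i = (n - i.+1)%N :> nat by [].
have eE i : e i = (m - i.+1)%N :> nat by [].
have he_inj : injective he := @last_ord_inj _ _ rm.
have hd_inj : injective hd := @last_ord_inj _ _ sn.
have T : tail_indices lam he hd OSPeven.
  by split=> k; rewrite /tail_coord ?split_lshift ?split_rshift codom_last_ord.
rewrite R_euler_char (prod_tail_even he_inj hd_inj T rs heE hdE rm sn) /KW.
rewrite (prod_isoset_even sm sn eE hdE) jE -prodfV.
set mu := lam_rho _ _.
have muE : Exp mu = rest he hd mu.
  rewrite (Exp_rest he_inj hd_inj) big1 ?mulr1 => [|i _]; last first.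
    by rewrite e0 -?codom_last_ord ?codom_f ?mulr0.
  rewrite big1 ?mulr1 // => j _.
  by rewrite d0 -?codom_last_ord ?codom_f ?mulr0.
have fr : tail_free he hd (Exp mu) by rewrite muE; apply: rest_free.
rewrite -(core_even_tail he_inj hd_inj fr rs heE eE).
congr (_ * JW _ _).
rewrite 2!invfM -!prodfV !mulrA; congr (_ * _ * _ * _).
  by apply: eq_bigr => i _; rewrite exprVn invrK exprM.
by apply: eq_bigr => i _; rewrite exprVn invrK exprM.
Qed.

Lemma odd_identity (C : numClosedFieldType) : Lambda_plus C OSPodd lam ->
  (j_osp OSPodd lam)%:R * (R OSPodd m n * Exp (rho OSPodd m n) * euler_char OSPodd lam)
  = KW OSPodd (lam_rho OSPodd lam) (isoset OSPodd m n (tail OSPodd lam)).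
Proof.
move=> LP; have [sm sn] := odd_tail_le_mn lam.
have eh i := @odd_tail_eps _ _ _ _ LP i; have dh j := @odd_tail_del _ _ _ _ LP j.
rewrite R_euler_char /j_osp [tpar _ _ == 0]/=.
have T : tail_indices lam (last_ord sm) (last_ord sn) OSPodd.
  by split=> k; rewrite /tail_coord ?split_lshift ?split_rshift codom_last_ord ?addn0.
move: (tail _ _) sm sn eh dh T => s sm sn eh dh.
set he := last_ord sm; set hd := last_ord sn => T.
have heE i : he i = (m - i.+1)%N :> nat by [].
have hdE i : hd i = (n - i.+1)%N :> nat by [].
have he_inj : injective he := @last_ord_inj _ _ sm.
have hd_inj : injective hd := @last_ord_inj _ _ sn.
rewrite (prod_tail_odd he_inj hd_inj T erefl heE hdE sm sn) /KW.
rewrite (prod_isoset_odd sm sn heE hdE).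
set mu := lam_rho _ _.
have muE : Exp mu = rest he hd mu * \prod_i ((xe n (he i))^-1 * xd m (hd i)).
  rewrite (Exp_rest he_inj hd_inj) big_split -mulrA; congr (_ * (_ * _)).
    by apply: eq_bigr => i _; rewrite eh -?codom_last_ord ?codom_f.
  by apply: eq_bigr => j _; rewrite dh -?codom_last_ord ?codom_f.
have [s0|s0] := posnP s.
  subst s; rewrite mul1r /den /cauchy_den; congr (JW _ (_ / _)).
  by rewrite !big_ord0 !mulr1.
have fr := rest_free mu : tail_free he hd _.
transitivity (JW OSPodd (rest he hd mu
    * \prod_j ((xe n (he j))^-1 * xd m (hd j) / (1 + xd m (hd j) ^+ 2 * xe n (he j) ^- 2)))).
  rewrite -(core_odd he_inj hd_inj fr s0); congr (_ * JW _ _).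
  rewrite muE -[LHS]mulrA -2![in RHS]mulrA; congr (_ * _).
  have one_addV (F : fieldType) (y : F) : y != 0 -> (1 + y ^- 2)^-1 = y / (y + y^-1).
    move=> y0; rewrite (_ : 1 + y ^- 2 = y^-1 * (y + y^-1)) ?invfM ?invrK //.
    by rewrite mulrDr mulVf // -invfM.
  have x_pow (F : fieldType) (x : F) i : x != 0 -> x ^+ (2 * i).+1 = x^-1 / (x ^- 2) ^+ i.+1.
    by move=> x0; rewrite exprVn invrK -exprM mulnS [in RHS]exprS mulKf.
  have yE : (\prod_j (1 + xd m (hd j) ^- 2))^-1
      = (\prod_j xd m (hd j)) / \prod_j (xd m (hd j) + (xd m (hd j))^-1).
    rewrite -!prodfV -big_split; apply: eq_bigr => j _.
    exact: one_addV (xd_neq0 m (hd j)).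
  have -> : \prod_i xe n (he i) ^+ (2 * i).+1
      = (\prod_i (xe n (he i))^-1) / \prod_i (xe n (he i) ^- 2) ^+ i.+1.
    rewrite -!prodfV -big_split; apply: eq_bigr => i _.
    exact: x_pow (xe_neq0 n (he i)).
  have -> : \prod_j xd m (hd j) ^+ (2 * j.+1)
      = (\prod_j xd m (hd j)) * ((\prod_j xd m (hd j)) / \prod_j (xd m (hd j) ^- 2) ^+ j).
    rewrite -!prodfV -!big_split; apply: eq_bigr => j _ /=.
    by rewrite exprVn invrK -exprM mulnS exprD expr2 mulrA.
  have regroup (F : fieldType) (a b c d o z : F) :
      a * b * (c * d * o * (b * z)) = a * c * (b * (b * d) * (z * o)) by ring.
  by rewrite big_split /= !invfM yE; exact: regroup.
congr (JW _ _); rewrite muE -[RHS]mulrA; congr (_ * _).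
by rewrite -prodfV -big_split.
Qed.

End Osp.

(** * The case gl(m|n) *)

Section GeneralLinear.

Variables m n : nat.
Local Notation K := (charField m n).

Lemma rhoL_lshift s (k : 'I_m) : (s <= m)%N ->
  rhoL m n s 0 (lshift n k) = rho GL m n 0 (lshift n k) + (k - (m - s))%:R.
Proof.
move=> sm; rewrite /rhoL mxE; congr (_ + _); rewrite big_add1 big_mkord summxE.
have term (i : 'I_s) :
    (\sum_(1 <= j < i.+1) (eps m n (m - s + i.+1) - del m n j)) 0 (lshift n k)
    = (k == m - s + i :> nat)%N%:R *+ i.
  rewrite summxE (eq_bigr (fun=> (k == m - s + i :> nat)%N%:R)).
    by rewrite sumr_const_nat subn1.
  by move=> j _; rewrite mxE addnS eps_lshift mxE del_lshift oppr0 addr0.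
rewrite (eq_bigr _ (fun i _ => term i)); have km := ltn_ord k.
have [ks|ks] := leqP (m - s) k.
  have k0s : (k - (m - s) < s)%N by lia.
  rewrite (bigD1 (Ordinal k0s)) //= subnKC // eqxx big1 ?addr0 // => i.
  rewrite -val_eqE /= => ik; rewrite (_ : (_ == _)%N = false) ?mul0rn //.
  by apply: contraNF ik => /eqP ->; rewrite addKn.
rewrite (eqP (ltnW ks)) big1 // => i _.
by rewrite (_ : (_ == _)%N = false) ?mul0rn // ltn_eqF // ltn_addr.
Qed.

Lemma rhoL_rshift s (l : 'I_n) :
  rhoL m n s 0 (rshift m l) = rho GL m n 0 (rshift m l) - (s - l.+1)%:R.
Proof.
rewrite /rhoL mxE; congr (_ + _); rewrite big_add1 big_mkord summxE.
have term (i : 'I_s) :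
    (\sum_(1 <= j < i.+1) (eps m n (m - s + i.+1) - del m n j)) 0 (rshift m l)
    = if (l < i)%N then - 1 else 0.
  rewrite summxE big_add1 big_mkord.
  rewrite (eq_bigr (fun j : 'I_i => - (l == j :> nat)%N%:R)); last first.
    by move=> j _; rewrite mxE eps_rshift mxE del_rshift add0r.
  case: ltnP => li.
    rewrite (bigD1 (Ordinal li)) //= eqxx big1 ?addr0 // => j.
    by rewrite -val_eqE /= eq_sym => /negbTE ->; rewrite oppr0.
  rewrite big1 // => j _; rewrite gtn_eqF ?oppr0 //.
  exact: leq_trans (ltn_ord j) li.
rewrite (eq_bigr _ (fun i _ => term i)) -big_mkcond /=.
by rewrite -(big_geq_mkord l.+1 s xpredT (fun=> - 1)) sumr_const_nat mulNrn.
Qed.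

Lemma exp_numq_int (x : K) (z : int) : x ^ numq (2 * z%:~R) = (x ^+ 2) ^ z.
Proof. by rewrite -[2]/(2%:~R) -intrM numq_int -exprz_exp. Qed.

Lemma prod_isoset_gl s (e : 'I_s -> 'I_m) (d : 'I_s -> 'I_n) : (s <= m)%N ->
  (forall i, e i = (m - i.+1)%N :> nat) -> (forall j, d j = j :> nat) ->
  \prod_(b <- isoset GL m n s) (1 + Exp (- b))
  = \prod_j (1 + xe n (e j) ^- 2 * xd m (d j) ^+ 2) :> K.
Proof.
move=> sm eE dE; rewrite /isoset big_map big_iota1; apply: eq_bigr => j _.
have jm := leq_trans (ltn_ord j) sm.
have -> : eps m n (m + 1 - j.+1) - del m n j.+1 = pm_root m n false true (e j) (d j).
  by rewrite -pm_rootE eE dE addn1 subSS subnSK.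
by rewrite pm_rootN Exp_pm_root.
Qed.

(** On the tail, lambda + rho is c + i on the eps and -(c + j) on the del; adding rho_L - rho levels
    these to c + s - 1 and -(c + s - 1). *)
Lemma gl_identity (C : numClosedFieldType) (lam : 'rV[int]_(m + n)) :
  Lambda_plus C GL lam -> gl_stable GL lam ->
  (j_gl GL lam)%:~R * (R GL m n * Exp (rho GL m n) * euler_char GL lam)
  = KW GL (int_weight lam + rhoL m n (tail GL lam)) (isoset GL m n (tail GL lam)).
Proof.
move=> LP st.
have [c [sm sn ac bc]] : exists c : int, [/\ (gl_tail GL lam <= m)%N, (gl_tail GL lam <= n)%N,
    forall i : 'I_m, (m - gl_tail GL lam <= i)%N ->
      acoord GL lam 0 i = (c + (m - 1 - i)%N%:Z)%:~R
  & forall j : 'I_n, (j < gl_tail GL lam)%N -> bcoord GL lam 0 j = - (c + j%:Z)%:~R].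
  have [s0|] := posnP (gl_tail GL lam); last exact: gl_tail_coords LP st.
  by exists 0; rewrite s0; split=> // i; rewrite subn0 leqNgt ltn_ord.
have nuL i : (int_weight lam + rhoL m n (gl_tail GL lam)) 0 (lshift n i)
    = lam_rho GL lam 0 (lshift n i) + (i - (m - gl_tail GL lam))%:R.
  by rewrite mxE rhoL_lshift // addrA [lam_rho _ _ _ _]mxE.
have nuR j : (int_weight lam + rhoL m n (gl_tail GL lam)) 0 (rshift m j)
    = lam_rho GL lam 0 (rshift m j) - (gl_tail GL lam - j.+1)%:R.
  by rewrite mxE rhoL_rshift addrA [lam_rho _ _ _ _]mxE.
have T : tail_indices lam (last_ord sm) (widen_ord sn) GL.
  by split=> k; rewrite /tail_coord ?split_lshift ?split_rshift
    ?codom_last_ord ?codom_widen_ord ?addn0.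
rewrite R_euler_char /j_gl /KW.
rewrite -[tail GL lam]/(gl_tail GL lam).
set nu := int_weight lam + _ in nuL nuR *.
move: (gl_tail GL lam) sm sn ac bc nuL nuR T => s sm sn ac bc nuL nuR.
have natL k : (k < s)%N -> (k + (m - k.+1 - (m - s)) = s.-1)%N.
  by move: sm; clear; lia.
have natR k : (k < s)%N -> (k + (s - k.+1) = s.-1)%N by clear; lia.
set he := last_ord sm; set hd := widen_ord sn => T.
have heE i : he i = (m - i.+1)%N :> nat by [].
have hdE i : hd i = i :> nat by [].
have he_inj : injective he := @last_ord_inj _ _ sm.
have hd_inj : injective hd := @widen_ord_inj _ _ sn.
rewrite (prod_tail_gl he_inj hd_inj T) (prod_isoset_gl sm heE hdE).
set mu := lam_rho _ _ in nuL nuR *.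
pose X i := xe n (he i) ^+ 2; pose Y j := xd m (hd j) ^+ 2.
have X0 i : X i != 0 by apply: expf_neq0; apply: xe_neq0.
have Y0 j : Y j != 0 by apply: expf_neq0; apply: xd_neq0.
pose E := rest he hd mu.
have muL (i : 'I_s) : mu 0 (lshift n (he i)) = (c + i%:Z)%:~R.
  rewrite lam_rho_lshift ac -?codom_last_ord ?codom_f //.
  by rewrite /= (_ : (m - 1 - (m - i.+1))%N = i) //; have := ltn_ord i; lia.
have muR (j : 'I_s) : mu 0 (rshift m (hd j)) = (- (c + j%:Z))%:~R.
  by rewrite lam_rho_rshift bc //= intrN.
have muE : Exp mu = E * (\prod_i X i ^ (c + i%:Z)) * \prod_j Y j ^ (- (c + j%:Z)).
  rewrite (Exp_rest he_inj hd_inj); congr (_ * _ * _); apply: eq_bigr => k _.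
    by rewrite muL exp_numq_int.
  by rewrite muR exp_numq_int.
have nuE : Exp nu = E * (\prod_i X i ^ (c + s.-1%:Z)) * \prod_j Y j ^ (- (c + s.-1%:Z)).
  rewrite (Exp_rest he_inj hd_inj); congr (_ * _ * _).
  - apply: rest_eq => k; rewrite ?codom_last_ord ?codom_widen_ord -?ltnNge => kh.
      by rewrite nuL (eqP (ltnW kh)) addr0.
    by rewrite nuR (eqP (ltnW kh)) subr0.
  - apply: eq_bigr => k _; rewrite nuL muL -exp_numq_int [(_ - _)%N%:R]natr_intE -intrD -addrA -PoszD.
    congr (_ ^ numq (_ * (c + Posz _)%:~R)).
    exact: natL (ltn_ord k).
  apply: eq_bigr => k _; rewrite nuR muR -exp_numq_int [(_ - _)%N%:R]natr_intE -intrB -opprD -addrA -PoszD.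
  congr (_ ^ numq (_ * (- (c + Posz _))%:~R)).
  exact: natR (ltn_ord k).
have fr : tail_free he hd E := rest_free mu.
(* The symmetric part of the Euler summand: X_i^c and Y_j^-c come from the weight, X_i^s from the
   denominator; the staircases X_i^i and Y_j^-j are what remains. *)
pose G := E * (\prod_i X i ^ (c + s%:Z)) * \prod_j Y j ^ (- c).
have Ge w : wfrac (eperm n he_inj w) G = G.
  rewrite /G 2!rmorphM /= (eperm_E he_inj fr) !rmorph_prod; congr (_ * _ * _).
    rewrite [RHS](reindex_inj (@perm_inj _ w)); apply: eq_bigr => i _.
    by rewrite fmorphXz /X rmorphXn /= eperm_x.
  by apply: eq_bigr => j _; rewrite fmorphXz /Y rmorphXn /= eperm_y.
have Gd w : wfrac (dperm m hd_inj w) G = G.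
  rewrite /G 2!rmorphM /= (dperm_E hd_inj fr) !rmorph_prod; congr (_ * _ * _).
    by apply: eq_bigr => i _; rewrite fmorphXz /X rmorphXn /= dperm_x.
  rewrite [RHS](reindex_inj (@perm_inj _ w)); apply: eq_bigr => j _.
  by rewrite fmorphXz /Y rmorphXn /= dperm_y.
have core := core_gl Ge Gd.
transitivity (JW GL (G * (\prod_j Y j ^- s.-1) * \prod_j (X j + Y j)^-1)).
  rewrite -core; congr (_ * JW _ _).
  set cd := cauchy_den _ _.
  have xE : (\prod_i X i ^ (c + i%:Z)) / \prod_i (X i)^-1 ^+ s
      = (\prod_i X i ^ (c + s%:Z)) * \prod_i X i ^+ i.
    rewrite -prodfV -!big_split; apply: eq_bigr => i _.
    by rewrite exprVn invrK !expfzDr //= mulrAC.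
  have yE : \prod_j Y j ^ (- (c + j%:Z)) = (\prod_j Y j ^ (- c)) * \prod_j (Y j)^-1 ^+ j.
    rewrite -big_split; apply: eq_bigr => j _.
    by rewrite opprD expfzDr // -[Y j ^ (- j%:Z)]invr_expz exprVn.
  have regroup (F : fieldType) (e a b d o u v v' : F) : a * u = b * v -> d = v' * o ->
      forall z, e * a * d * (u * z) = e * b * v' * v * o * z.
    move=> abuv -> z; transitivity (e * (a * u) * (v' * o) * z); first by ring.
    by rewrite abuv; ring.
  by rewrite muE invfM; exact: regroup xE yE _.
congr (JW _ _); rewrite nuE /G.
have xE : (\prod_i X i ^ (c + s.-1%:Z)) / \prod_j (1 + xe n (he j) ^- 2 * xd m (hd j) ^+ 2)
    = (\prod_i X i ^ (c + s%:Z)) * \prod_j (X j + Y j)^-1.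
  rewrite -prodfV -!big_split; apply: eq_bigr => i _ /=.
  have s1 : s = s.-1.+1 by rewrite prednK //; apply: leq_trans (ltn_ord i).
  have quot (F : fieldType) (x y : F) z : x != 0 ->
      x ^ z / (1 + x^-1 * y) = x ^ (z + 1) * (x + y)^-1.
    move=> x0; rewrite expfzDr // expr1z (_ : x + y = x * (1 + x^-1 * y)).
      by rewrite invfM mulrA mulfK.
    by rewrite mulrDr mulr1 mulVKf.
  have -> : c + s%:Z = c + s.-1%:Z + 1 by rewrite {1}s1 intS [1 + _]addrC addrA.
  exact: quot (X0 i).
have yE : \prod_j Y j ^ (- (c + s.-1%:Z)) = (\prod_j Y j ^ (- c)) * \prod_j Y j ^- s.-1.
  rewrite -big_split; apply: eq_bigr => j _.
  by rewrite opprD expfzDr // -[X in _ * X]invr_expz.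
have regroup (F : fieldType) (e a b d d' d'' u v : F) : a * u = b * v -> d = d' * d'' ->
    e * b * d' * d'' * v = e * a * d * u.
  move=> abuv ->; transitivity (e * (b * v) * (d' * d'')); first by ring.
  by rewrite -abuv; ring.
exact: regroup xE yE.
Qed.

End GeneralLinear.

Theorem proposition4p3 (C : numClosedFieldType) (g : superType) (m n : nat)
    (lam : 'rV[int]_(m + n)) :
  Lambda_plus C g lam ->
  (g = GL -> gl_stable g lam) ->
  let s := tail g lam in
  (g = OSPeven \/ g = OSPodd ->
     (j_osp g lam)%:R * (R g m n * Exp (rho g m n) * euler_char g lam)
     = KW g (lam_rho g lam) (isoset g m n s))
  /\
  (g = GL ->
     (j_gl g lam)%:~R * (R g m n * Exp (rho g m n) * euler_char g lam)
     = KW g (int_weight lam + rhoL m n s) (isoset g m n s)).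
Proof.
move=> LP st s; split=> [[gE|gE]|gE]; subst g.
- exact: even_identity (even_dominant LP).
- exact: odd_identity LP.
exact: gl_identity LP (st erefl).
Qed.
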